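(* Consider the optimal Dirichlet boundary control problem $\min_{u\in U^{ad}}\widehat J(u)$ and its variational discretization $\min_{u\in U^{ad}}\widehat J_h(u)$ (i.e. the control is not discretized: $U_h=U=L^2(\Gamma)$ and $U^{ad}_h=U^{ad}$), as described in the context. Let $u\in U^{ad}$ be the solution of the continuous problem with optimal state $y$ and adjoint potential and flux $(z,\mathbf p)$, and let $u_h\in U^{ad}$ be the solution of the variationally discretized problem with discrete state $y_h=y_h(u_h)$. Then there is a constant $C(\omega)>0$, independent of the mesh size $h$, such that $$\omega\|u-u_h\|_{0,\Gamma}^2+\|y-y_h\|_{0,\Omega}^2\le \|y-y_h(u)\|_{0,\Omega}^2+C(\omega)\Big(\epsilon\,\|(\mathbf p_h(u)-\mathbf p)\cdot\mathbf n\|_{0,\Gamma}^2+\|\kappa_z\,(z_h(u)-z)\|_{0,\Gamma}^2\Big),$$ where $y_h(u)$ is the LDG state with boundary datum $u$, and $(\mathbf p_h(u),z_h(u))\in\mathbf W_h\times V_h$ is the LDG approximation of $(\mathbf p,z)$, i.e. the solution of the discrete adjoint system with right-hand side $g=y-y^d$, where $y=y(u)$ is the continuous optimal state.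
   Context: **Data.** $\Omega\subset\mathbb R^2$ is a convex polygonal domain with Lipschitz boundary $\Gamma$ and outward unit normal $\mathbf n$; $\epsilon,\omega>0$ are constants; $\beta\in W^{1,\infty}(\Omega)^2$ with $\nabla\cdot\beta=0$; $\alpha\in L^\infty(\Omega)$, $\alpha\ge0$; $f,y^d\in L^2(\Omega)$; $u_a\le u_b$ are real numbers. $U=L^2(\Gamma)$ and $U^{ad}=\{u\in L^2(\Gamma): u_a\le u\le u_b\text{ a.e. on }\Gamma\}$. $(\cdot,\cdot)_\Omega$ and $\langle\cdot,\cdot\rangle_\Gamma$ are the $L^2$ inner products, with norms $\|\cdot\|_{0,\Omega}$, $\|\cdot\|_{0,\Gamma}$. **Continuous problem.** For $u\in L^2(\Gamma)$, $y(u)\in L^2(\Omega)$ is the unique very weak solution of $\nabla\cdot(-\epsilon\nabla y+\beta y)+\alpha y=f$ in $\Omega$, $y=u$ on $\Gamma$: for all $v\in H^1_0(\Omega)\cap H^2(\Omega)$, $$-\epsilon(y,\Delta v)_\Omega-(y,\beta\cdot\nabla v)_\Omega+(\alpha y,v)_\Omega=(f,v)_\Omega-\epsilon\langle u,\partial_n v\rangle_\Gamma .$$ Put $J(y,u)=\frac12\|y-y^d\|_{0,\Omega}^2+\frac\omega2\|u\|_{0,\Gamma}^2$ and $\widehat J(u)=J(y(u),u)$. The problem $\min_{U^{ad}}\widehat J$ has a unique solution $u$; $y=y(u)$. The adjoint potential $z\in H^2(\Omega)\cap H^1_0(\Omega)$ and flux $\mathbf p=\epsilon^{1/2}\nabla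 z$ solve $\nabla\cdot(-\beta z-\epsilon^{1/2}\mathbf p)+\alpha z=y-y^d$ in $\Omega$, $z=0$ on $\Gamma$. **Meshes and spaces.** $\{\mathcal T_h\}_h$ is a shape-regular family of conforming triangulations of $\Omega$ (no hanging nodes); $h=\max_K h_K$; $\mathcal E_h^0$ and $\mathcal E_h^\partial$ are the interior and boundary edges; $h_E$ is the length of the edge $E$. $\Gamma^-=\{x\in\Gamma:\beta\cdot\mathbf n<0\}$, $\Gamma^+=\{x\in\Gamma:\beta\cdot\mathbf n\ge0\}$. $V_h$ is the space of (discontinuous) piecewise linear functions on $\mathcal T_h$ (i.e. polynomials of degree at most one on each triangle), and $\mathbf W_h=V_h^2$. On an interior edge $E$ shared by $K,K^e$: $[\![y]\!]=y|_E\mathbf n_K+y^e|_E\mathbf n_{K^e}$, $\{\!\{y\}\!\}=\frac12(y|_E+y^e|_E)$, $[\![\mathbf q]\!]=\mathbf q|_E\cdot\mathbf n_K+\mathbf q^e|_E\cdot\mathbf n_{K^e}$, where $y|_E,y^e|_E$ (resp. $\mathbf q|_E,\mathbf q^e|_E$) are the traces from $K,K^e$. **LDG forms.** Let $C_{11}=\epsilon/h_E$ on each edge $E$; $\mathbf C_{12}$ satisfies $\mathbf C_{12}\cdot\mathbf n=\frac12\operatorname{sign}(\mathbf n\cdot\mathbf v)$ for a fixed nonzero vector $\mathbf v$, and $\mathbf D_{11}\cdot\mathbf n=\frac12\operatorname{sign}(\mathbf n\cdot\beta)$, on interior edges with unit normal $\mathbf n$. Define $$a_h(\mathbf q,\mathbf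 r)=\int_\Omega\mathbf q\cdot\mathbf r\,dx,$$ $$b_h(y,\mathbf r)=-\sum_{K}\int_K\epsilon^{1/2}y\,\nabla\cdot\mathbf r\,dx+\sum_{E\in\mathcal E_h^0}\int_E\epsilon^{1/2}(\{\!\{y\}\!\}+\mathbf C_{12}\cdot[\![y]\!])[\![\mathbf r]\!]\,ds,$$ $$c_h(y,v)=\sum_K\int_K(\alpha yv-y\,\beta\cdot\nabla v)\,dx+\sum_{E\in\mathcal E_h^0}\int_E(\{\!\{y\}\!\}+\mathbf D_{11}\cdot[\![y]\!])\,\beta\cdot[\![v]\!]\,ds-\sum_{E\in\mathcal E_h^0}\int_E\epsilon^{1/2}C_{11}[\![y]\!]\cdot[\![v]\!]\,ds+\int_{\Gamma^+}(\mathbf n\cdot\beta)yv\,ds-\sum_{E\in\mathcal E_h^\partial}\int_E\epsilon^{1/2}C_{11}yv\,ds,$$ $$m_{h,1}(u,\mathbf r)=-\int_\Gamma\epsilon^{1/2}u\,\mathbf r\cdot\mathbf n\,ds,\qquad m_{h,2}(u,v)=-\sum_{E\in\mathcal E_h^\partial}\int_E\epsilon^{1/2}C_{11}uv\,ds+\int_{\Gamma^-}|\beta\cdot\mathbf n|uv\,ds,$$ and $F(v)=\int_\Omega fv\,dx$. On $\Gamma$ set $\kappa_z=-\epsilon^{1/2}C_{11}+\chi_{\Gamma^-}|\beta\cdot\mathbf n|$, a function on $\Gamma$ ($\chi_{\Gamma^-}$ is the indicator function of $\Gamma^-$). **Discrete state.** For $u\in L^2(\Gamma)$, $(y_h(u),\mathbf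 q_h(u))\in V_h\times\mathbf W_h$ solves $$a_h(\mathbf q_h,\mathbf r)+b_h(y_h,\mathbf r)=m_{h,1}(u,\mathbf r)\ \ \forall\mathbf r\in\mathbf W_h,\qquad -b_h(v,\mathbf q_h)+c_h(y_h,v)=m_{h,2}(u,v)+F(v)\ \ \forall v\in V_h.$$ As throughout the paper, this system is taken to be uniquely solvable (for all $u\in L^2(\Gamma)$, $f\in L^2(\Omega)$). **Discrete adjoint system with right-hand side $g\in L^2(\Omega)$.** Find $(\mathbf p_h,z_h)\in\mathbf W_h\times V_h$ with $$a_h(\mathbf p_h,\psi)-b_h(z_h,\psi)=0\ \ \forall\psi\in\mathbf W_h,\qquad b_h(\phi,\mathbf p_h)+c_h(\phi,z_h)=(g,\phi)_\Omega\ \ \forall\phi\in V_h.$$ **Discrete reduced functional.** $\widehat J_h(u)=J(y_h(u),u)$. *)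

(* Defs.v *)
From HB Require Import structures.
From mathcomp Require Import all_boot all_order all_algebra.
From mathcomp Require Import all_classical all_reals all_analysis.
Set Implicit Arguments.
Unset Strict Implicit.
Unset Printing Implicit Defensive.
Import Order.TTheory GRing.Theory Num.Theory numFieldNormedType.Exports.
Local Open Scope classical_set_scope.
Local Open Scope ring_scope.

(* The norm that the library puts on [R * R] is the sup norm, so Euclidean lengths
   are written with [elen]. *)

Section Plane.
Context {R : realType}.
Local Notation pt := (R * R)%type.

(* [measurableTypeR R] is R with its Borel sets, under the measurability display
   that [lebesgue_measure] carries. *)
Definition mpt := (measurableTypeR R * measurableTypeR R)%type.

Definition lebesgue2 : {measure set mpt -> \bar R} :=
  (@lebesgue_measure R \x @lebesgue_measure R)%E.

Definition dot (a b : pt) : R := a.1 * b.1 + a.2 * b.2.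
Definition elen (a : pt) : R := Num.sqrt (dot a a).
Definition cross (a b : pt) : R := a.1 * b.2 - a.2 * b.1.
Definition pscale (c : R) (a : pt) : pt := (c * a.1, c * a.2).

Definition seg (a b : pt) (t : R) : pt :=
  ((1 - t) * a.1 + t * b.1, (1 - t) * a.2 + t * b.2).
Definition segment (a b : pt) : set pt := seg a b @` `[0, 1].

(* Unit normal on the right-hand side of the direction a -> b: the outward
   normal when [a, b] is a side of a counterclockwise polygon. *)
Definition right_normal (a b : pt) : pt :=
  pscale (elen (b - a))^-1 ((b - a).2, - (b - a).1).

(* Integral of g over the part of the segment [a, b] that lies in A, with
   respect to arc length. *)
Definition line_int (a b : pt) (A : set pt) (g : pt -> R) : R :=
  elen (b - a) *
  \int[@lebesgue_measure R]_(t in `[0, 1] `&` seg a b @^-1` A) g (seg a b t).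

End Plane.

Section Polygon.
Context {R : realType} {n : nat}.
Local Notation pt := (R * R)%type.
Variable P : 'I_n -> pt.

(* P lists the vertices of a convex polygon counterclockwise, without repetition
   and without flat angles: every vertex lies strictly to the left of every side
   that does not contain it. *)
Definition convex_polygon : Prop :=
  (2 < n)%N /\
  forall i j : 'I_n, j != i -> j != ordS i ->
    0 < cross (P (ordS i) - P i) (P j - P i).

Definition popen : set pt :=
  [set x | forall i, 0 < cross (P (ordS i) - P i) (x - P i)].
Definition pclosed : set pt :=
  [set x | forall i, 0 <= cross (P (ordS i) - P i) (x - P i)].

Definition side (i : 'I_n) : set pt := segment (P i) (P (ordS i)).
Definition side_normal (i : 'I_n) : pt := right_normal (P i) (P (ordS i)).
Definition pboundary : set pt := \bigcup_i side i.

(* At a corner the normal of one of the two sides is picked; corners are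
   negligible for all integrals over the boundary. *)
Definition normal (x : pt) : pt :=
  if [pick i | `[< side i x >]] is Some i then side_normal i else 0.

(* Integral over the intersection of A with the boundary. *)
Definition bint (A : set pt) (g : pt -> R) : R :=
  \sum_(i < n) line_int (P i) (P (ordS i)) A g.

Definition bae (Q : pt -> Prop) : Prop :=
  forall i : 'I_n, {ae @lebesgue_measure R, forall t : R,
    `[0, 1]%classic t -> Q (seg (P i) (P (ordS i)) t)}.

Definition L2b (g : pt -> R) : Prop :=
  forall i : 'I_n,
    measurable_fun (`[0, 1]%classic : set (measurableTypeR R))
      (g \o seg (P i) (P (ordS i))) /\
    (@lebesgue_measure R).-integrable `[0, 1]
      (fun t => ((g (seg (P i) (P (ordS i)) t)) ^+ 2)%:E).

Definition normb (g : pt -> R) : R := Num.sqrt (bint setT (fun x => g x ^+ 2)).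

End Polygon.

Section Sobolev.
Context {R : realType} {n : nat}.
Local Notation pt := (R * R)%type.
Variable P : 'I_n -> pt.
Local Notation Omega := (popen P).

Definition ex : pt := (1, 0).
Definition ey : pt := (0, 1).

Fixpoint Ck (k : nat) (f : pt -> R) : Prop :=
  continuous f /\
  if k is k'.+1 then
    (forall x, derivable f x ex /\ derivable f x ey) /\
    Ck k' (fun x => 'D_ex f x) /\ Ck k' (fun x => 'D_ey f x)
  else True.
Definition smooth (f : pt -> R) : Prop := forall k, Ck k f.

Definition test_fun (phi : pt -> R) : Prop :=
  smooth phi /\
  exists2 K : set pt, compact K & K `<=` Omega /\ forall x, ~ K x -> phi x = 0.

Definition L2 (f : pt -> R) : Prop :=
  measurable_fun (Omega : set mpt) f /\
  lebesgue2.-integrable Omega (fun x => (f x ^+ 2)%:E).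
Definition ip (f g : pt -> R) : R := \int[lebesgue2]_(x in Omega) (f x * g x).
Definition norm (f : pt -> R) : R := Num.sqrt (ip f f).

Definition dae (Q : pt -> Prop) : Prop :=
  {ae lebesgue2, forall x : pt, Omega x -> Q x}.
Definition Linf (f : pt -> R) : Prop :=
  measurable_fun (Omega : set mpt) f /\ exists M : R, dae (fun x => `|f x| <= M).

Definition is_wderiv (e : pt) (v g : pt -> R) : Prop :=
  forall phi, test_fun phi -> ip v (fun x => 'D_e phi x) = - ip g phi.

(* The distributional divergence of F is the function g. *)
Definition is_wdiv (F : pt -> pt) (g : pt -> R) : Prop :=
  forall phi, test_fun phi ->
    \int[lebesgue2]_(x in Omega) dot (F x) ('D_ex phi x, 'D_ey phi x) =
    - ip g phi.

(* Vector fields with components in W^{1,oo} are evaluated on edges below: the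
   representative continuous on the closed polygon is meant. *)
Definition W1inf (f : pt -> R) : Prop :=
  Linf f /\ forall e, e = ex \/ e = ey ->
    exists2 g, Linf g & is_wderiv e f g.

(* The weak derivative as a function: a representative chosen in its class of
   L^2 functions (meaningful on functions that have one). *)
Definition wderiv (e : pt) (v : pt -> R) : pt -> R :=
  xget (fun=> 0) [set g | L2 g /\ is_wderiv e v g].

Definition grad (v : pt -> R) (x : pt) : pt := (wderiv ex v x, wderiv ey v x).
Definition laplacian (v : pt -> R) (x : pt) : R :=
  wderiv ex (wderiv ex v) x + wderiv ey (wderiv ey v) x.

Definition H1 (v : pt -> R) : Prop :=
  L2 v /\ forall e, e = ex \/ e = ey -> exists2 g, L2 g & is_wderiv e v g.
Definition H2 (v : pt -> R) : Prop :=
  H1 v /\ H1 (wderiv ex v) /\ H1 (wderiv ey v).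

Definition cvg_H1 (phi : nat -> pt -> R) (v : pt -> R) : Prop :=
  [/\ norm (fun x => phi k x - v x) @[k --> \oo] --> (0 : R),
      norm (fun x => 'D_ex (phi k) x - wderiv ex v x) @[k --> \oo] --> (0 : R) &
      norm (fun x => 'D_ey (phi k) x - wderiv ey v x) @[k --> \oo] --> (0 : R)].

Definition H10 (v : pt -> R) : Prop :=
  H1 v /\ exists2 phi : nat -> pt -> R,
    (forall k, test_fun (phi k)) & cvg_H1 phi v.

(* Trace on the boundary: the L^2 limit of the boundary values of smooth
   functions that converge to v in H^1. *)
Definition is_trace (v g : pt -> R) : Prop :=
  L2b P g /\ exists phi : nat -> pt -> R,
    [/\ forall k, smooth (phi k), cvg_H1 phi v &
        normb P (fun x => phi k x - g x) @[k --> \oo] --> (0 : R)].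
Definition trace (v : pt -> R) : pt -> R := xget (fun=> 0) (is_trace v).

(* Normal derivative on the boundary: normal component of the trace of grad v. *)
Definition dnormal (v : pt -> R) (x : pt) : R :=
  dot (trace (wderiv ex v) x, trace (wderiv ey v) x) (normal P x).

End Sobolev.

Section ContinuousProblem.
Context {R : realType} {n : nat}.
Local Notation pt := (R * R)%type.
Variables (P : 'I_n -> pt) (eps omega : R) (beta : pt -> pt).
Variables (alpha f yd : pt -> R) (ua ub : R).
Local Notation Omega := (popen P).

Definition very_weak_solution (u y : pt -> R) : Prop :=
  L2 P y /\
  forall v, H2 P v -> H10 P v ->
    - eps * ip P y (laplacian P v)
    - ip P y (fun x => dot (beta x) (grad P v x))
    + ip P (fun x => alpha x * y x) v =
    ip P f v - eps * bint P setT (fun x => u x * dnormal P v x).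

(* For every u in L^2 of the boundary there is exactly one very weak solution,
   up to equality almost everywhere. *)
Definition state_well_posed : Prop :=
  forall u, L2b P u -> exists y, very_weak_solution u y /\
    forall y', very_weak_solution u y' -> dae P (fun x => y' x = y x).

Definition state (u : pt -> R) : pt -> R :=
  xget (fun=> 0) (very_weak_solution u).

Definition cost (y u : pt -> R) : R :=
  2^-1 * norm P (fun x => y x - yd x) ^+ 2 + omega / 2 * normb P u ^+ 2.
Definition reduced_cost (u : pt -> R) : R := cost (state u) u.

Definition admissible (u : pt -> R) : Prop :=
  L2b P u /\ bae P (fun x => ua <= u x <= ub).

Definition minimizer (F : (pt -> R) -> R) (u : pt -> R) : Prop :=
  admissible u /\ forall w, admissible w -> F u <= F w.

Definition flux (z : pt -> R) (x : pt) : pt := pscale (Num.sqrt eps) (grad P z x).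

(* Normal component on the boundary of the flux p = eps^(1/2) grad z, that is
   eps^(1/2) times the normal derivative of z. *)
Definition flux_normal (z : pt -> R) (x : pt) : R :=
  Num.sqrt eps * dnormal P z x.

(* The adjoint equation with datum g, in divergence form and in the sense of
   distributions. *)
Definition adjoint_solution (g z : pt -> R) : Prop :=
  [/\ H2 P z, H10 P z, bae P (fun x => trace P z x = 0) &
      is_wdiv P
        (fun x => - pscale (z x) (beta x) - pscale (Num.sqrt eps) (flux z x))
        (fun x => g x - alpha x * z x)].

Definition Gamma_minus : set pt :=
  [set x | pboundary P x /\ dot (beta x) (normal P x) < 0].
Definition Gamma_plus : set pt :=
  [set x | pboundary P x /\ 0 <= dot (beta x) (normal P x)].

End ContinuousProblem.

Record mesh (R : realType) := Mesh {
  ncells : nat;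
  cell :> 'I_ncells -> 'I_3 -> R * R (* vertices, counterclockwise *)
}.

Section Mesh.
Context {R : realType} {n : nat}.
Local Notation pt := (R * R)%type.
Variables (P : 'I_n -> pt) (T : mesh R).

(* Two different closed triangles are disjoint, or meet in a common vertex or in
   a common edge. *)
Definition conforming_triangulation : Prop :=
  [/\ forall K, convex_polygon (T K),
      \bigcup_K pclosed (T K) = pclosed P &
      forall K L, K != L ->
        let I := pclosed (T K) `&` pclosed (T L) in
        [\/ I = set0,
            exists i j, T K i = T L j /\ I = [set T K i] |
            exists i j, side (T K) i = side (T L) j /\ I = side (T K) i]].

Definition diameter (K : 'I_(ncells T)) : R :=
  \big[Num.max/0]_(i < 3) elen (T K (ordS i) - T K i).

(* An edge together with a triangle that it bounds: (K, i) is side i of K. *)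
Definition edge : Type := ('I_(ncells T) * 'I_3)%type.

Definition etail (e : edge) : pt := T e.1 e.2.
Definition ehead (e : edge) : pt := T e.1 (ordS e.2).
Definition eset (e : edge) : set pt := segment (etail e) (ehead e).
Definition esize (e : edge) : R := elen (ehead e - etail e).
Definition enormal (e : edge) : pt := right_normal (etail e) (ehead e).

(* An interior edge is seen from its two triangles; the condition on the indices
   lists each of them once. *)
Definition interior_edge (e e' : edge) : bool :=
  (e.1 < e'.1)%N && `[< eset e = eset e' >].
Definition boundary_edge (e : edge) : bool := `[< eset e `<=` pboundary P >].

Definition edge_int (e : edge) (g : pt -> R) : R :=
  line_int (etail e) (ehead e) setT g.

(* Boundary edge through a boundary point (unique except at the mesh vertices). *)
Definition edge_at (x : pt) : option edge :=
  [pick e : edge | boundary_edge e && `[< eset e x >]].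

(* Polynomials of degree at most one: the entries of p are the coefficients of
   1, x_1 and x_2. *)
Definition aff : Type := 'rV[R]_3.
Definition aeval (p : aff) (x : pt) : R := p 0 0 + p 0 1 * x.1 + p 0 2 * x.2.
Definition agrad (p : aff) : pt := (p 0 1, p 0 2).

Definition Vh := {ffun 'I_(ncells T) -> 'rV[R]_3}.
Definition Wh := (Vh * Vh)%type.

Definition weval (q : Wh) (K : 'I_(ncells T)) (x : pt) : pt :=
  (aeval (q.1 K) x, aeval (q.2 K) x).
Definition wdiv (q : Wh) (K : 'I_(ncells T)) : R :=
  (agrad (q.1 K)).1 + (agrad (q.2 K)).2.

(* Elements of V_h as functions on the domain (set to 0 on the edges) and their
   boundary values. *)
Definition vfun (v : Vh) (x : pt) : R :=
  \sum_(K < ncells T) \1_(popen (T K)) x * aeval (v K) x.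
Definition vtrace (v : Vh) (x : pt) : R :=
  if edge_at x is Some e then aeval (v e.1) x else 0.
Definition wnormal (q : Wh) (x : pt) : R :=
  dot (vtrace q.1 x, vtrace q.2 x) (normal P x).

Definition avg (y : Vh) (e e' : edge) (x : pt) : R :=
  2^-1 * (aeval (y e.1) x + aeval (y e'.1) x).
Definition jump (y : Vh) (e e' : edge) (x : pt) : pt :=
  pscale (aeval (y e.1) x) (enormal e) + pscale (aeval (y e'.1) x) (enormal e').
Definition wjump (q : Wh) (e e' : edge) (x : pt) : R :=
  dot (weval q e.1 x) (enormal e) + dot (weval q e'.1 x) (enormal e').

End Mesh.

(* Every triangle contains a disc whose radius is comparable to its diameter. *)
Definition shape_regular (R : realType) (I : Type) (T : I -> mesh R) : Prop :=
  exists2 kappa : R, 0 < kappa &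
    forall (h : I) (K : 'I_(ncells (T h))), exists c : R * R,
      [set x | elen (x - c) <= kappa * diameter K] `<=` pclosed (T h K).

Section LDG.
Context {R : realType} {n : nat}.
Local Notation pt := (R * R)%type.
Variables (P : 'I_n -> pt) (eps omega : R) (beta : pt -> pt).
Variables (alpha f yd : pt -> R).
Variable T : mesh R.
(* Edge coefficients; on an interior edge seen as (e, e') they are indexed by e. *)
Variables (C12 D11 : edge T -> pt -> pt).
Local Notation Vh := (Vh T).
Local Notation Wh := (Wh T).

Definition C12_spec (v : pt) : Prop :=
  forall e e' x, interior_edge e e' -> eset e x ->
    dot (C12 e x) (enormal e) = 2^-1 * Num.sg (dot (enormal e) v).
Definition D11_spec : Prop :=
  forall e e' x, interior_edge e e' -> eset e x ->
    dot (D11 e x) (enormal e) = 2^-1 * Num.sg (dot (enormal e) (beta x)).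

Definition C11 (e : edge T) : R := eps / esize e.

Definition a_h (q r : Wh) : R :=
  \int[lebesgue2]_(x in popen P)
    dot (vfun q.1 x, vfun q.2 x) (vfun r.1 x, vfun r.2 x).

Definition b_h (y : Vh) (r : Wh) : R :=
  - (\sum_(K < ncells T) \int[lebesgue2]_(x in pclosed (T K))
       (Num.sqrt eps * aeval (y K) x * wdiv r K))
  + \sum_(e : edge T) \sum_(e' : edge T | interior_edge e e')
      edge_int e (fun x => Num.sqrt eps
        * (avg y e e' x + dot (C12 e x) (jump y e e' x)) * wjump r e e' x).

Definition c_h (y v : Vh) : R :=
  \sum_(K < ncells T) \int[lebesgue2]_(x in pclosed (T K))
     (alpha x * aeval (y K) x * aeval (v K) x
      - aeval (y K) x * dot (beta x) (agrad (v K)))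
  + \sum_(e : edge T) \sum_(e' : edge T | interior_edge e e')
      edge_int e (fun x =>
        (avg y e e' x + dot (D11 e x) (jump y e e' x))
        * dot (beta x) (jump v e e' x))
  - \sum_(e : edge T) \sum_(e' : edge T | interior_edge e e')
      edge_int e (fun x =>
        Num.sqrt eps * C11 e * dot (jump y e e' x) (jump v e e' x))
  + bint P (Gamma_plus P beta) (fun x =>
      dot (normal P x) (beta x) * vtrace P y x * vtrace P v x)
  - \sum_(e : edge T | boundary_edge P e)
      bint P (eset e) (fun x =>
        Num.sqrt eps * C11 e * aeval (y e.1) x * aeval (v e.1) x).

Definition m_h1 (u : pt -> R) (r : Wh) : R :=
  - bint P setT (fun x => Num.sqrt eps * u x * wnormal P r x).

Definition m_h2 (u : pt -> R) (v : Vh) : R :=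
  - (\sum_(e : edge T | boundary_edge P e)
       bint P (eset e) (fun x => Num.sqrt eps * C11 e * u x * aeval (v e.1) x))
  + bint P (Gamma_minus P beta) (fun x =>
      `|dot (beta x) (normal P x)| * u x * vtrace P v x).

Definition kappa_z (x : pt) : R :=
  - (Num.sqrt eps * (if edge_at P T x is Some e then C11 e else 0))
  + \1_(Gamma_minus P beta) x * `|dot (beta x) (normal P x)|.

Definition discrete_state_eq (g u : pt -> R) (s : Vh * Wh) : Prop :=
  (forall r : Wh, a_h s.2 r + b_h s.1 r = m_h1 u r) /\
  (forall v : Vh, - b_h v s.2 + c_h s.1 v = m_h2 u v + ip P g (vfun v)).

Definition discrete_well_posed : Prop :=
  forall u g, L2b P u -> L2 P g -> exists! s, discrete_state_eq g u s.

Definition discrete_state (u : pt -> R) : pt -> R :=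
  vfun (xget (0 : Vh * Wh) (discrete_state_eq f u)).1.

Definition discrete_adjoint_eq (g : pt -> R) (p : Wh) (z : Vh) : Prop :=
  (forall psi : Wh, a_h p psi - b_h z psi = 0) /\
  (forall phi : Vh, b_h phi p + c_h phi z = ip P g (vfun phi)).

Definition discrete_reduced_cost (u : pt -> R) : R :=
  cost P omega yd (discrete_state u) u.

End LDG.

(* Main.v *)
Require Import Defs.
From HB Require Import structures.
From mathcomp Require Import all_boot all_order all_algebra.
From mathcomp Require Import all_classical all_reals all_analysis.
From mathcomp Require Import measurable_realfun zify ring lra.
Set Implicit Arguments.
Unset Strict Implicit.
Unset Printing Implicit Defensive.
Import Order.TTheory GRing.Theory Num.Theory numFieldNormedType.Exports.
Local Open Scope classical_set_scope.
Local Open Scope ring_scope.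

(** Both optimal controls satisfy a variational inequality, and the two are added.

    For the continuous problem, the derivative of the reduced cost in a direction
    [w - u] is the inner product of [y - yd] with the state difference plus the
    control term.  Testing the very weak equation of the state difference with the
    adjoint potential [z] turns the first part into a boundary integral of the normal
    derivative of [z] ([continuous_variational_inequality]).  For the discrete problem
    the derivative is kept as it is ([discrete_variational_inequality]); the inner
    product of [y - yd] with the difference of the discrete states for [u] and [u_h]
    is a boundary integral too, because the discrete adjoint system and the discrete
    state equations, tested with each other, leave only the data terms
    ([discrete_duality]).  In the sum the boundary integrals are the products of the
    control error with the errors of the discrete flux and of [kappa_z] times the
    discrete potential, the trace of [z] being zero; Young's inequality absorbs the
    control error and gives the constant [2 / omega].

    The analytic point is the use of [z] as a test function.  The adjoint equation
    holds in the sense of distributions, while the state difference is only square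
    integrable; so the equation is first turned into an equality almost everywhere.
    This takes the fundamental lemma of the calculus of variations
    ([fundamental_lemma]), for which smooth cutoffs of boxes inside the polygon are
    built from [exp (- 1 / s)], and an integration by parts for a field without
    divergence ([convection_by_parts]), where [z] is replaced by the test functions
    that approximate it.

    The geometric point is that boundary integrals over single edges add up to
    integrals over the boundary: two boundary edges of the triangulation have at most
    one point in common, since triangles with a common side on the boundary of a
    convex polygon would overlap ([boundary_edges_meet]).

    The rest is linearity of the discrete forms, hence integrability of everything
    that they contain; on edges this is done with bounded measurable functions
    ([tame]), on triangles inside the open polygon, up to null sets
    ([cell_integralE]). *)

(** * Square integrable functions *)

Lemma aeS d (T : measurableType d) (R : realType)
    (mu : {measure set T -> \bar R}) (A B : T -> Prop) :
  (forall x, A x -> B x) -> {ae mu, forall x, A x} -> {ae mu, forall x, B x}.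
Proof.
move=> AB [N [mN N0 AN]]; exists N; split=> // x nB.
by apply: AN => /AB.
Qed.

Lemma aeS2 d (T : measurableType d) (R : realType)
    (mu : {measure set T -> \bar R}) (A B C : T -> Prop) :
  (forall x, A x -> B x -> C x) ->
  {ae mu, forall x, A x} -> {ae mu, forall x, B x} -> {ae mu, forall x, C x}.
Proof.
move=> ABC [N1 [mN1 N10 H1]] [N2 [mN2 N20 H2]].
exists (N1 `|` N2); split; [exact: measurableU|exact: null_set_setU|].
move=> x /= nC; apply: contrapT => /not_orP[n1 n2]; apply: nC; apply: ABC.
  by apply: contrapT => nA; apply: n1; exact: H1.
by apply: contrapT => nB; apply: n2; exact: H2.
Qed.

Section SquareIntegrable.
Context d (T : measurableType d) (R : realType).
Variables (mu : {measure set T -> \bar R}) (D : set T).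
Hypothesis mD : measurable D.
Implicit Types f g : T -> R.
Import HBNNSimple.

Definition sqint f : Prop :=
  measurable_fun D f /\ mu.-integrable D (fun x => (f x ^+ 2)%:E).

Lemma sqintM f g : sqint f -> sqint g -> mu.-integrable D (EFin \o (f \* g)).
Proof.
move=> [mf f2] [mg g2].
apply: (le_integrable mD _ _ (integrableD mD f2 g2)).
  by apply/measurable_EFinP; exact: measurable_funM.
move=> x Dx /=; rewrite lee_fin.
rewrite normrM [leRHS]ger0_norm ?addr_ge0 ?sqr_ge0//.
rewrite -(real_normK (num_real (f x))) -(real_normK (num_real (g x))).
have := normr_ge0 (f x); have := normr_ge0 (g x).
have := sqr_ge0 (`|f x| - `|g x|).
set a := `|f x|; set b := `|g x|; nra.
Qed.

Lemma sqintZ (k : R) f : sqint f -> sqint (fun x => k * f x).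
Proof.
move=> [mf f2]; split; first exact: measurable_funM.
under eq_fun do rewrite exprMn EFinM.
exact: integrableZl.
Qed.

Lemma sqintD f g : sqint f -> sqint g -> sqint (fun x => f x + g x).
Proof.
move=> sf sg; split; first by apply: measurable_funD; [case: sf|case: sg].
have := integrableD mD (integrableD mD sf.2 sg.2)
  (integrableZl mD 2 (sqintM sf sg)).
apply: eq_integrable => // x _ /=.
by rewrite -EFinM -!EFinD; congr EFin; ring.
Qed.

Lemma sqintB f g : sqint f -> sqint g -> sqint (fun x => f x - g x).
Proof.
move=> sf sg; rewrite (_ : (fun _ => _) = (fun x => f x + -1 * g x)).
  by apply: sqintD => //; exact: sqintZ.
by apply/funext => x; rewrite mulN1r.
Qed.

Lemma sqint0 : sqint (fun=> 0).
Proof.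
split; first exact: measurable_cst.
under eq_fun do rewrite expr0n /=.
exact: integrable0.
Qed.

Lemma sqint_sum (I : Type) (s : seq I) (F : I -> T -> R) :
  (forall i, sqint (F i)) -> sqint (fun x => \sum_(i <- s) F i x).
Proof.
move=> sF; elim: s => [|i s IH].
  by under eq_fun do rewrite big_nil; exact: sqint0.
by under eq_fun do rewrite big_cons; exact: sqintD.
Qed.

Lemma ae_null_set (Q : T -> Prop) : {ae mu, forall x, D x -> Q x} ->
  exists N, [/\ measurable N, mu N = 0%E & forall x, D x -> ~ N x -> Q x].
Proof.
move=> [N [mN N0 QN]]; exists N; split=> // x Dx nNx.
by apply: contrapT => nQ; apply: nNx; apply: QN => /(_ Dx).
Qed.

(** Essential boundedness is a condition up to a null set, which does not affect
    integrability of a measurable function. *)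
Lemma sqintM_ae_bounded (a f : T -> R) (M : R) : measurable_fun D a ->
  {ae mu, forall x, D x -> `|a x| <= M} -> sqint f ->
  sqint (fun x => a x * f x).
Proof.
move=> ma /ae_null_set[N [mN N0 aM]] [mf f2].
have mDN : measurable (D `\` N) by exact: measurableD.
split; first exact: measurable_funM.
have maf : measurable_fun D (fun x => ((a x * f x) ^+ 2)%:E).
  by apply/measurable_EFinP; apply: measurable_funX; exact: measurable_funM.
apply/(negligible_integrable mN mD maf N0).
have f2N : mu.-integrable (D `\` N) (fun x => (f x ^+ 2)%:E).
  by apply: integrableS f2 => //; exact: subDsetl.
apply: (le_integrable mDN _ _ (integrableZl mDN (M ^+ 2) f2N)).
  by apply: measurable_funS maf => //; exact: subDsetl.
move=> x [Dx nNx] /=; rewrite lee_fin.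
rewrite exprMn [leLHS]ger0_norm; last by apply: mulr_ge0; exact: sqr_ge0.
rewrite [leRHS]ger0_norm; last by apply: mulr_ge0; exact: sqr_ge0.
apply: ler_wpM2r; first exact: sqr_ge0.
rewrite -(real_normK (num_real (a x))) lerXn2r ?nnegrE//.
- exact: le_trans (aM _ Dx nNx).
- exact: aM.
Qed.

Lemma sqintM_bounded (a f : T -> R) (M : R) : measurable_fun D a ->
  (forall x, D x -> `|a x| <= M) -> sqint f -> sqint (fun x => a x * f x).
Proof. by move=> ma aM; apply: (@sqintM_ae_bounded a f M) => //; exact: aeW. Qed.

Lemma sqint_bounded (f : T -> R) (M : R) : (mu D < +oo)%E ->
  measurable_fun D f -> (forall x, D x -> `|f x| <= M) -> sqint f.
Proof.
move=> Doo mf fM; split=> //.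
apply: (@measurable_bounded_integrable _ _ _ _ (fun x => f x ^+ 2)) => //.
  exact: measurable_funX.
exists (M ^+ 2); split; first exact: num_real.
move=> y My x Dx; apply: ltW; apply: le_lt_trans My.
rewrite normrX lerXn2r ?nnegrE//; last exact: fM.
exact: le_trans (fM _ Dx).
Qed.

(** True for every [f], as a simple function below the positive part of [f] may be set
    to 0 on [N] without changing its integral. *)
Lemma integral_setD_null (N : set T) (f : T -> \bar R) : measurable N ->
  mu N = 0%E ->
  (\int[mu]_(x in D) f x = \int[mu]_(x in D `\` N) f x)%E.
Proof.
move=> mN N0.
suff H (g : T -> \bar R) : (forall x, 0 <= g x)%E ->
    (\int[mu]_(x in D) g x = \int[mu]_(x in D `\` N) g x)%E.
  by rewrite integralE [RHS]integralE !H//.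
move=> g0; apply/eqP; rewrite eq_le; apply/andP; split; last first.
  rewrite integral_mkcond [leRHS]integral_mkcond.
  rewrite !ge0_integralTE/=.
  - apply: le_ereal_sup => _ [h hg <-]; exists h => // x.
    apply: le_trans (hg x) _; rewrite !patchE.
    case: ifPn => [/[!inE] -[Dx _]|_]; first by rewrite mem_set.
    by case: ifPn.
  - by move=> x; rewrite patchE; case: ifPn.
  - by move=> x; rewrite patchE; case: ifPn.
rewrite integral_mkcond [leRHS]integral_mkcond.
rewrite !ge0_integralTE/=.
- apply: ge_ereal_sup => _ [h hg <-].
  pose k : {nnsfun T >-> R} := mul_nnsfun h (indic_nnsfun R (measurableC mN)).
  have -> : sintegral mu h = sintegral mu k.
    rewrite -!integralT_nnsfun/=.
    have mh (g' : {nnsfun T >-> R}) : measurable_fun setT (EFin \o g').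
      by apply/measurable_EFinP.
    rewrite (@ge0_negligible_integral _ _ _ mu setT N (EFin \o h))//; last first.
      by move=> x _ /=; rewrite lee_fin.
    rewrite (@ge0_negligible_integral _ _ _ mu setT N (EFin \o k))//; last first.
      by move=> x _ /=; rewrite lee_fin mulr_ge0.
    apply: eq_integral => x /[!inE] -[_ nNx] /=.
    have -> : mindic R (measurableC mN) x = \1_(~` N) x by [].
    by rewrite indicE mem_set// mulr1.
  apply: ereal_sup_ubound; exists k => //= x /=.
  have -> : mindic R (measurableC mN) x = \1_(~` N) x by [].
  rewrite indicE; case: (boolP (x \in _)) => xN /=.
    rewrite mulr1n mulr1; apply: le_trans (hg x) _.
    rewrite !patchE; case: ifPn => //.
    by move=> /[!inE] Dx; rewrite ifT// inE; split=> //; rewrite inE in xN.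
    by move=> xD; case: ifPn.
  by rewrite mulr0 patchE; case: ifPn.
- by move=> x; rewrite patchE; case: ifPn.
- by move=> x; rewrite patchE; case: ifPn.
Qed.
End SquareIntegrable.

(** * The product measure of the plane *)

Section PlaneMeasure.
Context {R : realType}.
Local Notation pt := (R * R)%type.
Local Notation mpt := (@mpt R).
Local Notation leb2 := (@lebesgue2 R).

Definition box (a b c d : R) : set pt := `]a, b[ `*` `]c, d[.

Lemma measurable_box (a b c d : R) : measurable (box a b c d : set mpt).
Proof. by apply: measurableX; exact: measurable_itv. Qed.

(** Second countability of the plane, in the form that makes its open sets
    measurable for the product sigma-algebra. *)
Lemma open_rational_boxes (U : set pt) : open U ->
  U = \bigcup_(q : (rat * rat) * (rat * rat))
    (if `[< box (ratr q.1.1) (ratr q.1.2) (ratr q.2.1) (ratr q.2.2) `<=` U >]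
     then box (ratr q.1.1) (ratr q.1.2) (ratr q.2.1) (ratr q.2.2) else set0).
Proof.
move=> oU; apply/seteqP; split=> [[x1 x2] Ux|x [q _]]; last first.
  by case: ifPn => [/asboolP|_ //]; exact.
have [e /= e0 He] : exists2 e : R, 0 < e & ball ((x1, x2) : pt) e `<=` U.
  by apply/nbhs_ballP; exact: open_nbhs_nbhs.
have qin (r : R) : exists p : rat * rat,
    [/\ r - e < ratr p.1, ratr p.1 < r, r < ratr p.2 & ratr p.2 < r + e].
  have re1 : r - e < r by rewrite ltrBlDr ltrDl.
  have re2 : r < r + e by rewrite ltrDl.
  have [q1 /[!in_itv]/= /andP[? ?]] := rat_in_itvoo re1.
  have [q2 /[!in_itv]/= /andP[? ?]] := rat_in_itvoo re2.
  by exists (q1, q2).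
have [p [p1 p2 p3 p4]] := qin x1; have [q [q1 q2 q3 q4]] := qin x2.
exists (p, q) => //=; rewrite ifT.
  by split=> /=; rewrite in_itv/=; apply/andP.
apply/asboolP => -[y1 y2] [/=]; rewrite !in_itv/= => /andP[? ?] /andP[? ?].
by apply: He; split => /=; rewrite /ball/= ltr_distlC; apply/andP; split; lra.
Qed.

Lemma open_measurable2 (U : set pt) : open U -> measurable (U : set mpt).
Proof.
move=> /open_rational_boxes ->; apply: countable_bigcupT_measurable.
  exact: countableP.
by move=> q; case: ifPn => // _; exact: measurable_box.
Qed.

Lemma closed_measurable2 (U : set pt) : closed U -> measurable (U : set mpt).
Proof.
by move/closed_openC/open_measurable2/measurableC; rewrite setCK.
Qed.

Lemma continuous_measurable2 (f : pt -> R) : continuous f ->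
  measurable_fun [set: mpt] f.
Proof.
move=> /continuousP cf; apply: (measurability _ (RGenOpens.measurableE R)).
move=> _ [_ [a [b ->] <-]]; rewrite setTI; apply: open_measurable2.
exact/cf/interval_open.
Qed.

Lemma lebesgue2X (A B : set (measurableTypeR R)) : measurable A ->
  measurable B ->
  leb2 (A `*` B) = (@lebesgue_measure R A * @lebesgue_measure R B)%E.
Proof. by move=> mA mB; exact: product_measure1E. Qed.

Lemma lebesgue2_box_lty (a b c d : R) : (leb2 (box a b c d) < +oo)%E.
Proof.
rewrite lebesgue2X; try exact: measurable_itv.
have H x y : exists r : R, lebesgue_measure `]x, y[%classic = r%:E.
  rewrite lebesgue_measure_itv/=; case: ifPn => _; last by exists 0.
  by exists (y - x).
by have [r ->] := H a b; have [r' ->] := H c d; rewrite -EFinM ltry.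
Qed.

Lemma measurable_affine (a b c : R) :
  measurable_fun [set: mpt] (fun x : pt => a * x.1 + b * x.2 + c).
Proof.
apply: measurable_funD => //; apply: measurable_funD; exact: measurable_funM.
Qed.

Definition line (a b c : R) : set pt := [set x | a * x.1 + b * x.2 + c = 0].

Lemma measurable_line (a b c : R) : measurable (line a b c : set mpt).
Proof.
have -> : line a b c = setT `&` (fun x : pt => a * x.1 + b * x.2 + c) @^-1` [set 0].
  by rewrite setTI.
by apply: measurable_affine => //; exact: measurable_set1.
Qed.

Lemma lebesgue2_line (a b c : R) : (a, b) != (0, 0) -> leb2 (line a b c) = 0%E.
Proof.
have [->|b0 _] := eqVneq b 0; last first.
  rewrite /lebesgue2 /= /product_measure1 integral0_eq// => x _ /=.
  have -> : xsection (line a b c) x = [set - (a * x + c) / b].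
    apply/seteqP; split=> y; rewrite xsectionE /line/=.
      by move=> H; apply: (mulfI b0); rewrite mulrCA mulfV// mulr1; lra.
    by move=> ->; field.
  exact: lebesgue_measure_set1.
rewrite xpair_eqE eqxx andbT => a0.
have -> : line a 0 c = [set - c / a] `*` setT.
  apply/seteqP; split=> -[y1 y2]; rewrite /line/=.
    by move=> H; split=> //; apply: (mulfI a0); rewrite mulrCA mulfV// mulr1; lra.
  by move=> [-> _]; field.
by rewrite lebesgue2X// lebesgue_measure_set1 mul0e.
Qed.

End PlaneMeasure.

(** * Smooth functions built from exp (- 1 / s) *)

Section FlatFunction.
Context {R : realType}.
Implicit Types (s t : R) (n : nat).

(** [exp (- 1 / s)] times a power of [1 / s], extended by 0.  The powers make the family
    stable under differentiation up to linear combinations, which is how its members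
    are seen to be smooth. *)
Definition flat n s : R := if 0 < s then s^-1 ^+ n * expR (- s^-1) else 0.

Lemma flat_nonpos n s : s <= 0 -> flat n s = 0.
Proof. by move=> s0; rewrite /flat ltNge s0. Qed.

Lemma flat_ge0 n s : 0 <= flat n s.
Proof.
rewrite /flat; case: ifPn => // s0.
by rewrite mulr_ge0 ?expR_ge0// exprn_ge0// invr_ge0 ltW.
Qed.

(** The exponential dominates every power, here [t ^ n.+1 <= n.+1`! exp t] at
    [t = 1 / s]. *)
Lemma flat_le n s : 0 <= s -> flat n s <= n.+1`!%:R * s.
Proof.
move=> s0; rewrite /flat; case: ifPn => [{}s0|_]; last by rewrite mulr_ge0.
have t0 : 0 < s^-1 by rewrite invr_gt0.
have := expR_ge1Dxn n (ltW t0).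
set t := s^-1 in t0 *; have -> : s = t^-1 by rewrite invrK.
move=> H; rewrite expRN ler_pdivrMr ?expR_gt0// mulrAC ler_pdivlMr//.
have c0 : 0 < n.+1`!%:R :> R by rewrite ltr0n fact_gt0.
rewrite -exprSr mulrC -ler_pdivrMr//; apply: le_trans H; lra.
Qed.

Lemma flat_norm_le n s : `|flat n s| <= n.+1`!%:R * `|s|.
Proof.
rewrite ger0_norm ?flat_ge0//; have [s0|s0] := leP 0 s.
  by rewrite ger0_norm// flat_le.
by rewrite flat_nonpos ?mulr_ge0// ltW.
Qed.

Lemma flat_cvg0 n : flat n h @[h --> (0 : R)] --> (0 : R).
Proof.
apply/cvgr0Pnorm_le => e e0.
have c0 : 0 < n.+1`!%:R :> R by rewrite ltr0n fact_gt0.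
near=> h; apply: le_trans (flat_norm_le n h) _.
rewrite -ler_pdivlMl//.
by near: h; apply: (@nbhs0_le R R); rewrite mulr_gt0// invr_gt0.
Unshelve. all: by end_near. Qed.

Lemma is_derive_flat n s :
  is_derive s 1 (flat n) (flat n.+2 s - n%:R * flat n.+1 s).
Proof.
have [s0|s0|<-] := ltgtP 0 s.
- have -> : flat n.+2 s - n%:R * flat n.+1 s =
     n%:R * s^-1 ^+ n.-1 * (- s ^- 2) * expR (- s^-1) + s^-1 ^+ n * (s ^- 2 * expR (- s^-1)).
    rewrite /flat s0; case: n => [|n]/=; rewrite !exprS ?expr0; field; rewrite gt_eqF//.
  apply: (@near_eq_is_derive _ _ _ (fun s => s^-1 ^+ n * expR (- s^-1))).
    near=> t; rewrite /flat ifT//; near: t; exact: lt_nbhsr.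
  have sn0 : s != 0 by rewrite gt_eqF.
  have dV : is_derive s 1 (fun t : R => t^-1) (- s ^- 2).
    have := is_deriveV sn0 (is_derive_id s 1).
    by move=> /is_derive_eq; apply; rewrite scaler1.
  have dN : is_derive s 1 (fun t : R => - t^-1) (s ^- 2).
    by have /is_derive_eq := is_deriveN dV; apply; rewrite opprK.
  have dE : is_derive s 1 (fun t : R => expR (- t^-1)) (s ^- 2 * expR (- s^-1)).
    have /is_derive_eq :=
      @is_derive1_comp _ expR (fun t => - t^-1) s _ _ (is_derive_expR _) dN.
    by apply; rewrite mulrC.
  have dX : is_derive s 1 (fun t : R => t^-1 ^+ n)
      (n%:R * s^-1 ^+ n.-1 * (- s ^- 2)).
    have := is_deriveX n dV; rewrite exprfctE => /is_derive_eq; apply.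
    by rewrite -mulr_natl.
  have := is_deriveM dX dE; rewrite mulrfctE => /is_derive_eq; apply.
  rewrite /GRing.scale/=; ring.
- apply: (@near_eq_is_derive _ _ _ (cst 0)).
    near=> t; rewrite flat_nonpos// ltW//.
    by near: t; exact: lt_nbhsl.
  rewrite !(flat_nonpos _ (ltW s0)) mulr0 subrr; exact: is_derive_cst.
(* at 0 the difference quotient of [flat n] is [flat n.+1] *)
- have -> : flat n.+2 0 - n%:R * flat n.+1 0 = 0 by rewrite /flat ltxx mulr0 subrr.
  have H : h^-1 *: ((flat n \o shift 0) (h *: 1) - flat n 0) @[h --> 0^'] --> 0.
    have : flat n.+1 h @[h --> 0^'] --> 0.
      by apply: cvg_within_filter; exact: flat_cvg0.
    apply: cvg_trans; apply: near_eq_cvg; near=> h.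
    rewrite /= /shift/= addr0 scaler1 /flat ltxx subr0.
    by case: ifPn => _; rewrite /GRing.scale/= ?mulr0// exprS mulrA.
  by apply: DeriveDef; [apply/cvg_ex; exists 0|exact/cvg_lim].
Unshelve. all: by end_near. Qed.

Lemma continuous_flat n : continuous (flat n).
Proof.
move=> s; have [d _] := is_derive_flat n s.
exact/differentiable_continuous/derivable1_diffP.
Qed.

Lemma is_derive_flat_dir n s (v : R) :
  is_derive s v (flat n) (v * (flat n.+2 s - n%:R * flat n.+1 s)).
Proof.
have [d dE] := is_derive_flat n s.
have df : differentiable (flat n) s by exact/derivable1_diffP.
apply: DeriveDef; first exact/diff_derivable.
by rewrite deriveE// diff1E// derive1E dE.
Qed.

End FlatFunction.

Section SmoothFunctions.
Context {R : realType}.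
Local Notation pt := (R * R)%type.
Implicit Types (f g : pt -> R) (k : nat).

Definition affine (a b c : R) (x : pt) : R := a * x.1 + b * x.2 + c.

Lemma continuous_affine (a b c : R) : continuous (affine a b c).
Proof.
move=> x; apply: cvgD; last exact: cvg_cst.
by apply: cvgD; apply: cvgM; first [exact: cvg_cst|exact: cvg_fst|exact: cvg_snd].
Qed.

(** Difference quotients of [flat n \o l] in the direction [e] are those of [flat n] in
    the direction of the increment of [l]. *)
Lemma is_derive_flat_affine n (a b c : R) (x e : pt) :
  let l := affine a b c in
  is_derive x e (flat n \o l)
    ((a * e.1 + b * e.2) * (flat n.+2 (l x) - n%:R * flat n.+1 (l x))).
Proof.
move=> l; have [d dE] := is_derive_flat_dir n (l x) (a * e.1 + b * e.2).
have E : (fun h : R => h^-1 *: ((flat n \o l \o shift x) (h *: e) - (flat n \o l) x))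
   = (fun h => h^-1 *: ((flat n \o shift (l x)) (h *: (a * e.1 + b * e.2)) - flat n (l x))).
  apply/funext => h /=; congr (_ *: (flat n _ - _)).
  by rewrite /l /affine /shift/= /GRing.scale/=; ring.
by apply: DeriveDef; rewrite /derivable/derive E.
Qed.

Lemma Ck_pred k f : Ck k.+1 f -> Ck k f.
Proof.
elim: k f => [|k IH] f [cf [df [d1 d2]]]; first exact: (conj cf I).
exact: (conj cf (conj df (conj (IH _ d1) (IH _ d2)))).
Qed.

Lemma Ck_continuous k f : Ck k f -> continuous f.
Proof. by case: k => [|k] []. Qed.

Lemma Ck_cst k (c : R) : Ck k (fun=> c).
Proof.
elim: k c => [|k IH] c; first by split=> // x; exact: cvg_cst.
split; first by move=> x; exact: cvg_cst.
split; first by move=> x; split; exact: derivable_cst.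
by split; under eq_fun do rewrite derive_cst.
Qed.

Lemma CkD k f g : Ck k f -> Ck k g -> Ck k (fun x => f x + g x).
Proof.
elim: k f g => [|k IH] f g.
  by move=> [cf _] [cg _]; split=> // x; exact: cvgD (cf x) (cg x).
move=> [cf [df [f1 f2]]] [cg [dg [g1 g2]]].
split; first by move=> x; exact: cvgD (cf x) (cg x).
split.
  move=> x; exact: (conj (derivableD (df x).1 (dg x).1)
                         (derivableD (df x).2 (dg x).2)).
have E e : (forall x, derivable f x e) -> (forall x, derivable g x e) ->
    (fun x => 'D_e (fun x => f x + g x) x) = (fun x => 'D_e f x + 'D_e g x).
  by move=> fe ge; apply/funext => x; rewrite (deriveD (fe x) (ge x)).
have E1 := E ex (fun x => (df x).1) (fun x => (dg x).1).
have E2 := E ey (fun x => (df x).2) (fun x => (dg x).2).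
exact: (conj (eq_ind_r (Ck k) (IH _ _ f1 g1) E1)
             (eq_ind_r (Ck k) (IH _ _ f2 g2) E2)).
Qed.

Lemma CkM k f g : Ck k f -> Ck k g -> Ck k (fun x => f x * g x).
Proof.
elim: k f g => [|k IH] f g.
  by move=> [cf _] [cg _]; split=> // x; exact: cvgM (cf x) (cg x).
move=> /[dup] /Ck_pred fk [cf [df [f1 f2]]] /[dup] /Ck_pred gk [cg [dg [g1 g2]]].
split; first by move=> x; exact: cvgM (cf x) (cg x).
split.
  move=> x; exact: (conj (derivableM (df x).1 (dg x).1)
                         (derivableM (df x).2 (dg x).2)).
have E e : (forall x, derivable f x e) -> (forall x, derivable g x e) ->
    (fun x => 'D_e (fun x => f x * g x) x) = (fun x => f x * 'D_e g x + g x * 'D_e f x).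
  by move=> fe ge; apply/funext => x; rewrite (deriveM (fe x) (ge x)).
have E1 := E ex (fun x => (df x).1) (fun x => (dg x).1).
have E2 := E ey (fun x => (df x).2) (fun x => (dg x).2).
exact: (conj
  (eq_ind_r (Ck k) (CkD (IH _ _ fk g1) (IH _ _ gk f1)) E1)
  (eq_ind_r (Ck k) (CkD (IH _ _ fk g2) (IH _ _ gk f2)) E2)).
Qed.

Lemma Ck_flat_affine k n (a b c : R) : Ck k (fun x => flat n (affine a b c x)).
Proof.
have cont m : continuous (fun x => flat m (affine a b c x)).
  move=> x; apply: continuous_comp; first exact: continuous_affine.
  exact: continuous_flat.
elim: k n => [|k IH] n; first by split.
have D e x : derivable (fun x => flat n (affine a b c x)) x e.
  by have [] := is_derive_flat_affine n a b c x e.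
apply: (conj (cont n)); apply: (conj (fun x => conj (D ex x) (D ey x))).
have E e : (fun x => 'D_e (fun x => flat n (affine a b c x)) x) =
    (fun x => (a * e.1 + b * e.2) * (flat n.+2 (affine a b c x) +
                - n%:R * flat n.+1 (affine a b c x))).
  apply/funext => x; have [_] := is_derive_flat_affine n a b c x e.
  by rewrite mulNr.
have CE e : Ck k (fun x => (a * e.1 + b * e.2) * (flat n.+2 (affine a b c x) +
                - n%:R * flat n.+1 (affine a b c x))).
  by apply: CkM; [exact: Ck_cst|apply: CkD (IH n.+2) (CkM (Ck_cst _ _) (IH n.+1))].
exact: (conj (eq_ind_r (Ck k) (CE ex) (E ex)) (eq_ind_r (Ck k) (CE ey) (E ey))).
Qed.

Lemma smoothM f g : smooth f -> smooth g -> smooth (fun x => f x * g x).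
Proof. by move=> sf sg k; apply: CkM. Qed.

Lemma smooth_prod (I : Type) (s : seq I) (F : I -> pt -> R) :
  (forall i, smooth (F i)) -> smooth (fun x => \prod_(i <- s) F i x).
Proof.
move=> sF; elim: s => [|i s IH].
  by under eq_fun do rewrite big_nil; move=> k; exact: Ck_cst.
by under eq_fun do rewrite big_cons; exact: smoothM.
Qed.

End SmoothFunctions.

(** * Functions with vanishing integrals over boxes *)

Section Density.
Context d (T : measurableType d) (R : realType).
Variable mu : {measure set T -> \bar R}.

Section DensityMeasure.
Variables (f : T -> \bar R).
Hypotheses (mf : measurable_fun setT f) (f0 : forall x, (0 <= f x)%E).

Definition density (A : set T) : \bar R := (\int[mu]_(x in A) f x)%E.

Let density0 : density set0 = 0%E.
Proof. by rewrite /density integral_set0. Qed.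

Let density_ge0 A : (0 <= density A)%E.
Proof. by apply: integral_ge0 => x _. Qed.

Let density_sigma : semi_sigma_additive density.
Proof. exact: semi_sigma_additive_nng_induced. Qed.

Definition density_measure : {measure set T -> \bar R} :=
  HB.pack density (isMeasure.Build _ _ _ density density0 density_ge0 density_sigma).

End DensityMeasure.

(** The positive and the negative part of the function are densities of two
    measures that agree on the generating system, hence everywhere. *)
Lemma ae_eq0_generated (G : set (set T)) (g : (set T)^nat) (w : T -> R) :
  measurable = <<s G >> -> setI_closed G -> (forall i, G (g i)) ->
  \bigcup_k (g k) = setT ->
  (forall A, G A -> mu.-integrable A (EFin \o w)) ->
  measurable_fun setT w ->
  (forall A, G A -> \int[mu]_(x in A) w x = 0) ->
  {ae mu, forall x, w x = 0}.
Proof.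
move=> mG IG Gg gT wint mw w0.
have Gm A : G A -> measurable A by move=> GA; rewrite mG; exact: sub_sigma_algebra.
have mwE : measurable_fun setT (EFin \o w) by exact/measurable_EFinP.
have mp : measurable_fun setT ((EFin \o w)^\+)%E by exact: measurable_funepos.
have mn : measurable_fun setT ((EFin \o w)^\-)%E by exact: measurable_funeneg.
have p0 x : (0 <= (EFin \o w)^\+ x)%E by exact: funepos_ge0.
have n0 x : (0 <= (EFin \o w)^\- x)%E by exact: funeneg_ge0.
have E A : measurable A -> density_measure mp p0 A = density_measure mn n0 A.
  apply: (measure_unique G g) => // [B GB|k]; last first.
    by apply: integral_funepos_lt_pinfty; [exact: Gm|exact: wint].
  have wB := wint _ GB.
  have mB := Gm _ GB.
  have := w0 _ GB; rewrite /Rintegral integralE /=.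
  have fp := integrable_pos_fin_num mB wB.
  have fn := integrable_neg_fin_num mB wB.
  rewrite fineB// => /eqP; rewrite subr_eq0 => /eqP pn.
  by rewrite /density -(fineK fp) -(fineK fn) pn.
have P : {ae mu, forall x, 0 < w x -> (EFin \o w)^\+%E x = 0%E}.
  have mA : measurable [set x | 0 < w x].
    rewrite (_ : [set x | _] = setT `&` w @^-1` `]0, +oo[%classic).
      by apply: mw => //; exact: measurable_itv.
    by apply/seteqP; split=> x /=; rewrite in_itv/= andbT// => -[].
  apply/(ae_eq_integral_abs _ mA); first exact: measurable_funTS.
  under eq_integral do rewrite gee0_abs//.
  have := E _ mA; rewrite /= /density => ->.
  apply: integral0_eq => x /= wx; rewrite funenegE /=.
  by apply/max_idPr; rewrite lee_fin ?oppr_le0 ltW.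
have N : {ae mu, forall x, w x < 0 -> (EFin \o w)^\-%E x = 0%E}.
  have mA : measurable [set x | w x < 0].
    rewrite (_ : [set x | _] = setT `&` w @^-1` `]-oo, 0[%classic).
      by apply: mw => //; exact: measurable_itv.
    by apply/seteqP; split=> x /=; rewrite in_itv/= => // -[].
  apply/(ae_eq_integral_abs _ mA); first exact: measurable_funTS.
  under eq_integral do rewrite gee0_abs//.
  have := E _ mA; rewrite /= /density => <-.
  apply: integral0_eq => x /= wx; rewrite funeposE /=.
  by apply/max_idPr; rewrite lee_fin ltW.
near=> x.
have Px : 0 < w x -> (EFin \o w)^\+%E x = 0%E by near: x.
have Nx : w x < 0 -> (EFin \o w)^\-%E x = 0%E by near: x.
have [w_gt0|w_lt0|//] := ltgtP 0 (w x).
- by have := Px w_gt0; rewrite funeposE/= max_l ?lee_fin ?ltW// => -[].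
- have := Nx w_lt0; rewrite funenegE/= max_l ?lee_fin ?oppr_ge0 ?ltW// => -[] /eqP.
  by rewrite oppr_eq0 => /eqP.
Unshelve. all: by end_near. Qed.

End Density.

Section BoxGenerated.
Context {R : realType}.
Local Notation pt := (R * R)%type.
Local Notation mpt := (@mpt R).
Local Notation leb2 := (@lebesgue2 R).

Definition boxes : set (set pt) :=
  [set A | exists a b c d : R, A = box a b c d].

Lemma setI_closed_boxes : setI_closed boxes.
Proof.
move=> _ _ [a [b [c [d ->]]]] [a' [b' [c' [d' ->]]]].
exists (Num.max a a'), (Num.min b b'), (Num.max c c'), (Num.min d d').
apply/seteqP; split=> -[x y] /=; rewrite /box/= !in_itv/= !gt_max !lt_min.
  by move=> [[/andP[-> ->] /andP[-> ->]] [/andP[-> ->] /andP[-> ->]]].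
by move=> [/andP[/andP[-> ->] /andP[-> ->]] /andP[/andP[-> ->] /andP[-> ->]]].
Qed.

Lemma boxes_cover : \bigcup_n box (- n%:R) n%:R (- n%:R) n%:R = [set: pt].
Proof.
apply/seteqP; split=> // -[x y] _.
have [n xyn] : exists n, `|x| + `|y| < n%:R.
  exists (Num.truncn (`|x| + `|y|)).+1.
  by rewrite truncnS_gt.
have x0 := normr_ge0 x; have y0 := normr_ge0 y.
by exists n => //; rewrite /box/= !in_itv/= -!ltr_norml; split; lra.
Qed.

(** The projections are measurable for the sigma-algebra generated by the boxes, as
    preimages of open intervals are open, hence countable unions of boxes. *)
Lemma measurable_boxes : @measurable _ mpt = <<s boxes >>.
Proof.
have So U : open U -> <<s boxes >> U.
  move=> /open_rational_boxes ->.
  apply: (@countable_bigcupT_measurable _ (g_sigma_algebraType boxes)).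
    exact: countableP.
  move=> q; case: ifPn => _; last exact: measurable0.
  apply: sub_sigma_algebra; do 4 eexists; reflexivity.
rewrite measurable_prod_measurableType; apply/seteqP; split; last first.
  apply: smallest_sub; first exact: smallest_sigma_algebra.
  move=> _ [a [b [c [d ->]]]]; rewrite -measurable_prod_measurableType.
  exact: measurable_box.
apply: smallest_sub; first exact: smallest_sigma_algebra.
move=> _ [A mA] [B mB] <-.
have mfst : measurable_fun setT (fst : g_sigma_algebraType boxes -> measurableTypeR R).
  apply: (measurability _ (RGenOpens.measurableE R)).
  move=> _ [_ [a [b ->] <-]]; rewrite setTI; apply: So.
  apply: open_comp; last exact: interval_open.
  by move=> x _; exact: cvg_fst.
have msnd : measurable_fun setT (snd : g_sigma_algebraType boxes -> measurableTypeR R).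
  apply: (measurability _ (RGenOpens.measurableE R)).
  move=> _ [_ [a [b ->] <-]]; rewrite setTI; apply: So.
  apply: open_comp; last exact: interval_open.
  by move=> x _; exact: cvg_snd.
have -> : A `*` B = (setT `&` fst @^-1` A) `&` (setT `&` snd @^-1` B).
  by rewrite !setTI.
apply: (@measurableI _ (g_sigma_algebraType boxes)).
  exact: mfst.
exact: msnd.
Qed.

Lemma ae_eq0_boxes (w : pt -> R) : measurable_fun setT (w : mpt -> R) ->
  (forall a b c d, leb2.-integrable (box a b c d) (EFin \o w)) ->
  (forall a b c d, \int[leb2]_(x in box a b c d) w x = 0) ->
  {ae leb2, forall x, w x = 0}.
Proof.
move=> mw wint w0.
apply: (@ae_eq0_generated _ _ _ leb2 boxes
   (fun n => box (- n%:R) n%:R (- n%:R) n%:R)) => //.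
- exact: measurable_boxes.
- exact: setI_closed_boxes.
- by move=> n; do 4 eexists; reflexivity.
- exact: boxes_cover.
- by move=> _ [a [b [c [d ->]]]].
- by move=> _ [a [b [c [d ->]]]].
Qed.

End BoxGenerated.

(** * Cutoff functions of convex polygons *)

Section TestFunctions.
Context {R : realType}.
Local Notation pt := (R * R)%type.
Local Notation mpt := (@mpt R).
Local Notation leb2 := (@lebesgue2 R).
Implicit Types (l : R * R * R) (s : seq (R * R * R)) (k : nat).

(** A triple [l] stands for the affine function with these coefficients; half planes
    are given by lists of triples. *)
Definition aff3 l : pt -> R := affine l.1.1 l.1.2 l.2.

Definition halfplanes s : set pt := [set x | forall l, l \in s -> 0 < aff3 l x].

(** Smooth function that vanishes unless every [aff3 l x] exceeds [k.+1^-1]; it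
    tends to 1 on the intersection of the half planes. *)
Definition cutoff k s (x : pt) : R :=
  \prod_(l <- s) flat 0 (k.+1%:R * aff3 l x - 1).

Lemma cutoff_smooth k s : smooth (cutoff k s).
Proof.
apply: smooth_prod => l.
have -> : (fun x => flat 0 (k.+1%:R * aff3 l x - 1)) = (fun x : pt =>
    flat 0 (affine (k.+1%:R * l.1.1) (k.+1%:R * l.1.2) (k.+1%:R * l.2 - 1) x)).
  by apply/funext => x; congr (flat _ _); rewrite /aff3/affine; ring.
by move=> m; exact: Ck_flat_affine.
Qed.

Lemma flat0_le1 (r : R) : flat 0 r <= 1.
Proof.
rewrite /flat; case: ifPn => // r0.
by rewrite expr0 mul1r expR_le1 oppr_le0 invr_ge0 ltW.
Qed.

Lemma cutoff_ge0 k s x : 0 <= cutoff k s x.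
Proof. by apply: prodr_ge0 => l _; exact: flat_ge0. Qed.

Lemma cutoff_le1 k s x : cutoff k s x <= 1.
Proof.
rewrite /cutoff; elim: s => [|l s IH]; first by rewrite big_nil.
rewrite big_cons mulr_ile1 ?flat_ge0 ?flat0_le1//.
exact: cutoff_ge0.
Qed.

Lemma cutoff_eq0 k s x l : l \in s -> k.+1%:R * aff3 l x <= 1 -> cutoff k s x = 0.
Proof.
move=> ls lx; apply/eqP; rewrite /cutoff prodf_seq_eq0; apply/hasP; exists l => //.
by rewrite /= flat_nonpos ?eqxx// subr_le0.
Qed.

Lemma cutoff_out k s x : ~ halfplanes s x -> cutoff k s x = 0.
Proof.
move=> /existsNP[l /not_implyP[ls /negP]]; rewrite -leNgt => lx.
apply: (cutoff_eq0 ls); apply: le_trans ler01.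
by rewrite mulr_ge0_le0.
Qed.

Lemma cutoff_cvg s x : cutoff k s x @[k --> \oo] --> (\1_(halfplanes s) x : R).
Proof.
have [xs|xs] := pselect (halfplanes s x); last first.
  rewrite indicE memNset//.
  by under eq_fun do rewrite cutoff_out//; exact: cvg_cst.
rewrite indicE mem_set//.
have H l : l \in s -> flat 0 (k.+1%:R * aff3 l x - 1) @[k --> \oo] --> (1 : R).
  move=> /xs; set a := aff3 l x => a0.
  apply/cvgrPdist_le => e e0; near=> k.
  set r := k.+1%:R * a - 1.
  have re : e^-1 <= r.
    rewrite /r lerBrDr -ler_pdivrMr//.
    have : (e^-1 + 1) / a <= k%:R by near: k; exact: nbhs_infty_ger.
    by move=> /le_trans; apply; rewrite ler_nat.
  have r0 : 0 < r by apply: lt_le_trans re; rewrite invr_gt0.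
  (* squeeze between 1 - 1 / r and 1 *)
  have f1 : 1 - r^-1 <= flat 0 r.
    by rewrite /flat r0 expr0 mul1r; exact: expR_ge1Dx.
  have f2 := flat0_le1 r.
  have re' : r^-1 <= e by rewrite -[leRHS]invrK lef_pV2// posrE invr_gt0.
  rewrite ger0_norm ?subr_ge0//; lra.
rewrite /cutoff; elim: s H {xs} => [|l s IH] H.
  by under eq_fun do rewrite big_nil; exact: cvg_cst.
under eq_fun do rewrite big_cons.
have IHs : (\prod_(l <- s) flat 0 (k.+1%:R * aff3 l x - 1)) @[k --> \oo] --> (1 : R).
  by apply: IH => l' ls; apply: H; rewrite in_cons ls orbT.
have := cvgM (H _ (mem_head l s)) IHs; rewrite mulr1; exact.
Unshelve. all: by end_near. Qed.


Definition edge_aff (p d : pt) : R * R * R := (- d.2, d.1, d.2 * p.1 - d.1 * p.2).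

Lemma aff3_edge p d x : aff3 (edge_aff p d) x = cross d (x - p).
Proof. by rewrite /aff3/affine/cross/=; ring. Qed.

Definition box_aff (a b c d : R) : seq (R * R * R) :=
  [:: (1, 0, - a); (-1, 0, b); (0, 1, - c); (0, -1, d)].

Lemma halfplanes_cons l s :
  halfplanes (l :: s) = [set x | 0 < aff3 l x] `&` halfplanes s.
Proof.
apply/seteqP; split=> x.
  move=> H; split; first by apply: H; rewrite mem_head.
  by move=> l' ls; apply: H; rewrite in_cons ls orbT.
by move=> [H1 H2] l'; rewrite in_cons => /predU1P[->|]; [exact: H1|exact: H2].
Qed.

Lemma halfplanes_cat s s' : halfplanes (s ++ s') = halfplanes s `&` halfplanes s'.
Proof.
elim: s => [|l s IH] /=; last by rewrite !halfplanes_cons IH setIA.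
by apply/seteqP; split=> x // [].
Qed.

Lemma halfplanes_box a b c d : halfplanes (box_aff a b c d) = box a b c d.
Proof.
rewrite !halfplanes_cons; apply/seteqP; split=> -[x y];
  rewrite /box/aff3/affine/= !in_itv/=.
  by move=> [H1 [H2 [H3 [H4 _]]]]; split; lra.
by move=> [/andP[? ?] /andP[? ?]]; repeat split=> //; lra.
Qed.

Lemma measurable_halfplanes s : measurable (halfplanes s : set mpt).
Proof.
elim: s => [|l s IH].
  rewrite (_ : halfplanes [::] = setT) //.
  by apply/seteqP; split=> x.
rewrite halfplanes_cons; apply: measurableI => //.
rewrite (_ : [set x | _] = setT `&` aff3 l @^-1` `]0, +oo[%classic).
  apply: measurable_affine => //; exact: measurable_itv.
by apply/seteqP; split=> x /=; rewrite in_itv/= andbT// => -[].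
Qed.

Section OnPolygon.
Context {n : nat} (P : 'I_n -> pt).

Definition sides_aff : seq (R * R * R) :=
  [seq edge_aff (P i) (P (ordS i) - P i) | i : 'I_n].

Lemma popenE : popen P = halfplanes sides_aff.
Proof.
apply/seteqP; split=> x H.
  by move=> l /mapP[i _ ->]; rewrite aff3_edge; exact: H.
by move=> i; rewrite -aff3_edge; apply: H; apply/map_f; rewrite mem_enum.
Qed.

Lemma measurable_popen : measurable (popen P : set mpt).
Proof. by rewrite popenE; exact: measurable_halfplanes. Qed.

(** The support lies where all the affine functions are at least [k.+1^-1], a closed
    subset of a closed box at a positive distance from the sides. *)
Lemma cutoff_test_fun k a b c d :
  test_fun P (cutoff k (box_aff a b c d ++ sides_aff)).
Proof.
set s := _ ++ _; split; first exact: cutoff_smooth.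
pose K : set pt := (`[a, b] `*` `[c, d]) `&`
  \bigcap_(l in [set l | l \in s]) [set x | 1 <= k.+1%:R * aff3 l x].
have Kpos l x : K x -> l \in s -> 0 < aff3 l x.
  move=> [_ Kx] ls; have := Kx _ ls => /= H.
  by rewrite -(pmulr_rgt0 _ (ltr0Sn R k)); exact: lt_le_trans H.
exists K; last split.
- apply: compact_closedI.
    by apply: compact_setX; exact: segment_compact.
  apply: closed_bigI => l _.
  rewrite (_ : [set x | _] = (fun x => k.+1%:R * aff3 l x) @^-1` [set t | 1 <= t])//.
  apply: closed_comp; last exact: closed_ge.
  by move=> x _; apply: cvgM; [exact: cvg_cst|exact: continuous_affine].
- move=> x Kx; rewrite popenE => l ls; apply: (Kpos l x Kx).
  by rewrite mem_cat ls orbT.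
- move=> x nKx.
  have [H|/existsNP[l /not_implyP[ls /negP]]] :=
      pselect (forall l, l \in s -> 1 <= k.+1%:R * aff3 l x); last first.
    by rewrite -ltNge => /ltW; exact: cutoff_eq0.
  exfalso; apply: nKx; split; last by move=> l /= /H.
  have : halfplanes (box_aff a b c d) x.
    move=> l lb; rewrite -(pmulr_rgt0 _ (ltr0Sn R k)).
    by apply: lt_le_trans (H _ _) => //; rewrite mem_cat lb.
  rewrite halfplanes_box /box/= !in_itv/= => -[/andP[? ?] /andP[? ?]].
  by split; apply/andP; split; exact: ltW.
Qed.

End OnPolygon.
End TestFunctions.

(** * Square integrable functions on the polygon *)

Section DomainSpaces.
Context {R : realType} {n : nat}.
Local Notation pt := (R * R)%type.
Local Notation mpt := (@mpt R).
Local Notation leb2 := (@lebesgue2 R).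
Variable P : 'I_n -> pt.
Local Notation Omega := (popen P).
Let mO := measurable_popen P.

Lemma ipC (f g : pt -> R) : ip P f g = ip P g f.
Proof. by apply: eq_Rintegral => x _; rewrite mulrC. Qed.

Lemma L2_integrable (f g : pt -> R) : L2 P f -> L2 P g ->
  leb2.-integrable Omega (fun x => (f x * g x)%:E).
Proof. exact: sqintM. Qed.

Lemma ipDl (f g k : pt -> R) : L2 P f -> L2 P g -> L2 P k ->
  ip P (fun x => f x + g x) k = ip P f k + ip P g k.
Proof.
move=> Lf Lg Lk; rewrite /ip -RintegralD//; try exact: L2_integrable.
by apply: eq_Rintegral => x _; rewrite mulrDl.
Qed.

Lemma ipZl (c : R) (f k : pt -> R) : L2 P f -> L2 P k ->
  ip P (fun x => c * f x) k = c * ip P f k.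
Proof.
move=> Lf Lk; rewrite /ip -RintegralZl//; try exact: L2_integrable.
by apply: eq_Rintegral => x _; rewrite mulrA.
Qed.

Lemma L2D (f g : pt -> R) : L2 P f -> L2 P g -> L2 P (fun x => f x + g x).
Proof. exact: sqintD. Qed.

Lemma L2Z (c : R) (f : pt -> R) : L2 P f -> L2 P (fun x => c * f x).
Proof. exact: sqintZ. Qed.

Lemma L2B (f g : pt -> R) : L2 P f -> L2 P g -> L2 P (fun x => f x - g x).
Proof. exact: sqintB. Qed.

Lemma ipBl (f g k : pt -> R) : L2 P f -> L2 P g -> L2 P k ->
  ip P (fun x => f x - g x) k = ip P f k - ip P g k.
Proof.
move=> Lf Lg Lk; rewrite /ip -RintegralB//; try exact: L2_integrable.
by apply: eq_Rintegral => x _; rewrite mulrBl.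
Qed.

Lemma ipDr (f g k : pt -> R) : L2 P f -> L2 P g -> L2 P k ->
  ip P k (fun x => f x + g x) = ip P k f + ip P k g.
Proof. by move=> *; rewrite ipC ipDl// !(ipC k). Qed.

Lemma ipBr (f g k : pt -> R) : L2 P f -> L2 P g -> L2 P k ->
  ip P k (fun x => f x - g x) = ip P k f - ip P k g.
Proof. by move=> *; rewrite ipC ipBl// !(ipC k). Qed.

Lemma ipZr (c : R) (f k : pt -> R) : L2 P f -> L2 P k ->
  ip P k (fun x => c * f x) = c * ip P k f.
Proof. by move=> *; rewrite ipC ipZl// (ipC k). Qed.

Lemma norm_sq (f : pt -> R) : norm P f ^+ 2 = ip P f f.
Proof.
by rewrite sqr_sqrtr//; apply: Rintegral_ge0 => x _; rewrite -expr2 sqr_ge0.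
Qed.

Lemma ip_ge0 (f : pt -> R) : 0 <= ip P f f.
Proof. by apply: Rintegral_ge0 => x _; rewrite -expr2 sqr_ge0. Qed.

Lemma ip_ae_eq (f f' g : pt -> R) : L2 P f -> L2 P f' -> L2 P g ->
  dae P (fun x => f x = f' x) -> ip P f g = ip P f' g.
Proof.
move=> Lf Lf' Lg ff'; congr fine; apply: ae_eq_integral => //.
- exact: measurable_int (L2_integrable Lf Lg).
- exact: measurable_int (L2_integrable Lf' Lg).
- by apply: aeS ff' => x ff' /ff' ->.
Qed.

(** Cauchy-Schwarz, from the sign of the quadratic polynomial
    [t |-> ip (f + t g) (f + t g)]. *)
Lemma ip_norm_le (f g : pt -> R) : L2 P f -> L2 P g ->
  `|ip P f g| <= norm P f * norm P g.
Proof.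
move=> Lf Lg.
have Q t : 0 <= ip P f f + 2 * t * ip P f g + t ^+ 2 * ip P g g.
  have Ltg := L2Z t Lg; have := ip_ge0 (fun x => f x + t * g x).
  rewrite ipDl// ?ipDr//; try exact: L2D.
  rewrite !ipZl// !ipZr// (ipC g f).
  by move=> H; apply: le_trans H _; rewrite le_eqVlt; apply/orP; left; apply/eqP; ring.
have S : ip P f g ^+ 2 <= ip P f f * ip P g g.
  have := ip_ge0 f; have := ip_ge0 g; move: Q.
  set a := ip P f f; set b := ip P f g; set c := ip P g g => Q c0 a0.
  have [c00|cn0] := eqVneq c 0.
    rewrite c00 in Q *; have [->|b0] := eqVneq b 0; first by rewrite expr0n mulr0.
    have := Q (- (a + 1) / (2 * b)).
    rewrite (_ : _ + _ = -1); first by rewrite ler0N1.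
    by field.
  have cp : 0 < c by rewrite lt_neqAle eq_sym cn0.
  have := Q (- b / c).
  have -> : a + 2 * (- b / c) * b + (- b / c) ^+ 2 * c = (a * c - b ^+ 2) / c by field.
  by rewrite pmulr_lge0 ?invr_gt0// subr_ge0.
rewrite -(@ler_sqr _ `|_|) ?nnegrE ?mulr_ge0 ?sqrtr_ge0//.
by rewrite exprMn !norm_sq -normrX ger0_norm ?sqr_ge0.
Qed.

Lemma ip_cvg0 (f : pt -> R) (g : nat -> pt -> R) : L2 P f ->
  (forall k, L2 P (g k)) -> norm P (g k) @[k --> \oo] --> (0 : R) ->
  ip P f (g k) @[k --> \oo] --> (0 : R).
Proof.
move=> Lf Lg g0; apply/norm_cvg0P.
apply: (@squeeze_cvgr _ _ _ _ (fun=> 0) (fun k => norm P f * norm P (g k))).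
- by near=> k; rewrite normr_ge0 ip_norm_le.
- exact: cvg_cst.
- by rewrite -[0](mulr0 (norm P f)); apply: cvgM => //; exact: cvg_cst.
Unshelve. all: by end_near. Qed.

Hypothesis Ofin : (leb2 Omega < +oo)%E.

Lemma L2_bounded (M : R) (f : pt -> R) : measurable_fun (Omega : set mpt) f ->
  (forall x, Omega x -> `|f x| <= M) -> L2 P f.
Proof. by move=> mf fM; exact: (sqint_bounded mO Ofin mf fM). Qed.

Lemma continuous_compact_norm_le (K : set pt) (f : pt -> R) : compact K ->
  {within K, continuous f} -> exists M, forall x, K x -> `|f x| <= M.
Proof.
move=> cK cf; have [M [_ HM]] := compact_bounded (continuous_compact cf cK).
exists (M + 1) => x Kx; apply: HM; last by exists x.
by rewrite ltrDl.
Qed.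

Lemma test_fun_le (phi : pt -> R) : test_fun P phi ->
  exists M, forall x, `|phi x| <= M.
Proof.
move=> [sphi [K cK [_ phi0]]].
have [|M HM] := @continuous_compact_norm_le K phi cK.
  exact/continuous_subspaceT/(Ck_continuous (sphi 0)).
exists `|M| => x; have [Kx|/phi0 ->] := pselect (K x); last by rewrite normr0.
by apply: le_trans (HM _ Kx) (ler_norm _).
Qed.

Lemma test_fun_measurable (phi : pt -> R) : test_fun P phi ->
  measurable_fun (Omega : set mpt) phi.
Proof.
move=> [sphi _]; apply: measurable_funTS; apply: continuous_measurable2.
exact: (Ck_continuous (sphi 0)).
Qed.

Lemma test_fun_L2 (phi : pt -> R) : test_fun P phi -> L2 P phi.
Proof.
move=> tphi; have [M HM] := test_fun_le tphi.
by apply: (@L2_bounded M) => //; exact: test_fun_measurable.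
Qed.

Lemma test_fun_derive (e : pt) (phi : pt -> R) : e = ex \/ e = ey ->
  test_fun P phi -> test_fun P (fun x => 'D_e phi x).
Proof.
move=> He [sphi [K cK [KO phi0]]]; split.
  move=> k; have [_ [_ [H1 H2]]] := sphi k.+1.
  by case: He => ->.
exists K => //; split=> // x nKx.
have -> : 'D_e phi x = 'D_e (cst 0 : pt -> R) x; last exact: derive_cst.
apply: near_eq_derive.
have oK : open (~` K) by apply: closed_openC; apply: compact_closed.
by apply: filterS (open_nbhs_nbhs (conj oK nKx)) => y /phi0.
Qed.

Lemma test_funM (phi psi : pt -> R) : test_fun P phi -> test_fun P psi ->
  test_fun P (fun x => phi x * psi x).
Proof.
move=> [s1 [K cK [KO phi0]]] [s2 _]; split; first exact: smoothM.
by exists K => //; split=> // x /phi0 ->; rewrite mul0r.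
Qed.

(** By dominated convergence along the cutoffs, [w] has integral 0 over the part of
    every box inside the polygon; this determines [w] almost everywhere. *)
Lemma fundamental_lemma (w : pt -> R) : L2 P w ->
  (forall phi, test_fun P phi -> ip P w phi = 0) -> dae P (fun x => w x = 0).
Proof.
move=> Lw w0.
have L1 : L2 P (fun=> 1).
  by apply: (@L2_bounded 1) => // x _; rewrite normr1.
have iw : leb2.-integrable Omega (EFin \o w).
  by apply: eq_integrable (L2_integrable Lw L1) => // x _ /=; rewrite mulr1.
pose W := w \_ Omega.
have iW : leb2.-integrable setT (EFin \o W).
  have := iw; move/(integrable_mkcond _ mO); apply: eq_integrable => // x _.
  by rewrite /= /W /patch; case: ifP.
suff : {ae leb2, forall x, W x = 0}.
  by apply: aeS => x + Ox; rewrite /W patchE mem_set.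
apply: ae_eq0_boxes => [|a b c d|a b c d].
- by apply/measurable_EFinP; exact: measurable_int iW.
- by apply: integrableS iW => //; exact: measurable_box.
rewrite /W -Rintegral_mkcondr setIC Rintegral_mkcondr.
pose phi k := cutoff k (box_aff a b c d ++ sides_aff P).
have tphi k : test_fun P (phi k) by exact: cutoff_test_fun.
have Iphi k := L2_integrable Lw (test_fun_L2 (tphi k)).
pose F x := w x * \1_(box a b c d) x.
have mF : measurable_fun (Omega : set mpt) F.
  apply: measurable_funM; first by case: Lw.
  by apply: measurable_indic; exact: measurable_box.
have cvF x : Omega x -> (w x * phi k x) @[k --> \oo] --> F x.
  move=> Ox; apply: cvgM; first exact: cvg_cst.
  have := @cutoff_cvg R (box_aff a b c d ++ sides_aff P) x.
  rewrite halfplanes_cat halfplanes_box -popenE indicI.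
  by rewrite /= [X in _ * X]indicE mem_set// mulr1.
have [_ _ cvgI] : [/\ leb2.-integrable Omega (EFin \o F),
    [sequence \int[leb2]_(x in Omega) `|(w x * phi k x)%:E - (F x)%:E|]_k @ \oo --> 0 &
    [sequence \int[leb2]_(x in Omega) (w x * phi k x)%:E]_k @ \oo
      --> \int[leb2]_(x in Omega) (F x)%:E]%E.
  apply: (@dominated_convergence _ _ _ leb2 _ mO _ _ (fun x => `|w x|%:E)).
  - by move=> k; exact: measurable_int (Iphi k).
  - exact/measurable_EFinP.
  - apply: aeW => x Ox; apply: cvg_EFin; last exact: cvF.
    exact: nearW.
  - exact: integrable_norm.
  - apply: aeW => x k Ox; rewrite lee_fin normrM ler_piMr//.
    by rewrite ger0_norm ?cutoff_ge0 ?cutoff_le1.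
have : (\int[leb2]_(x in Omega) (F x)%:E)%E = 0%E.
  apply: (cvg_unique _ cvgI); first exact: ereal_hausdorff.
  rewrite (_ : [sequence _]_k = fun=> 0%E); first exact: cvg_cst.
  apply/funext => k; rewrite -[LHS]fineK; last exact: integrable_fin_num (Iphi k).
  by congr EFin; exact: w0.
rewrite /Rintegral => I0; rewrite (_ : (\int[_]_(_ in _) _)%E = 0%E)// -I0.
apply: eq_integral => x _; rewrite /F /patch indicE; case: ifP => _.
  by rewrite mulr1.
by rewrite mulr0.
Qed.

End DomainSpaces.

(** * The adjoint equation almost everywhere *)

(** The linear arithmetic of long computations is stated over an arbitrary ordered
    field, with variables in place of the integrals. *)
Lemma adjoint_residual_arith (R : realFieldType) (eps I A B C xx yy c G Z : R) :
  I = - A - eps * (B + C) -> A = - c -> B = - xx -> C = - yy ->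
  I = - (G - Z) -> eps * (xx + yy) + c + G - Z = 0.
Proof. by move=> -> -> -> -> H; lra. Qed.

Lemma tested_adjoint_arith (R : realFieldType) (eps A B C D : R) :
  eps * A + B + C - D = 0 -> - eps * A - B + D = C.
Proof. by move=> H; lra. Qed.

Section AdjointTest.
Context {R : realType} {n : nat}.
Local Notation pt := (R * R)%type.
Local Notation leb2 := (@lebesgue2 R).
Variable P : 'I_n -> pt.
Local Notation Omega := (popen P).
Hypothesis Ofin : (leb2 Omega < +oo)%E.
Let mO := measurable_popen P.

Lemma L2_LinfM (a f : pt -> R) : Linf P a -> L2 P f -> L2 P (fun x => a x * f x).
Proof. by move=> [ma [M aM]] Lf; exact: (sqintM_ae_bounded mO ma aM Lf). Qed.

Lemma wderivP (e : pt) (v : pt -> R) : (exists2 g, L2 P g & is_wderiv P e v g) ->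
  L2 P (wderiv P e v) /\ is_wderiv P e v (wderiv P e v).
Proof.
by move=> [g Lg wg]; apply: (@xgetPex _ _ [set g | L2 P g /\ is_wderiv P e v g]);
  exists g.
Qed.

Lemma H1_wderiv (e : pt) (v : pt -> R) : e = ex \/ e = ey -> H1 P v ->
  L2 P (wderiv P e v) /\ is_wderiv P e v (wderiv P e v).
Proof. by move=> He [_ /(_ _ He)]; exact: wderivP. Qed.

Lemma test_fun_deriveM (e : pt) (phi psi : pt -> R) : e = ex \/ e = ey ->
  test_fun P phi -> test_fun P psi -> forall x,
  'D_e (fun x => phi x * psi x) x = phi x * 'D_e psi x + psi x * 'D_e phi x.
Proof.
move=> He [sphi _] [spsi _] x.
have [_ [d1 _]] := sphi 1; have [_ [d2 _]] := spsi 1.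
have [p1 p2] : derivable phi x e /\ derivable psi x e.
  by case: He => ->; split; [exact: (d1 x).1|exact: (d2 x).1|
                             exact: (d1 x).2|exact: (d2 x).2].
exact: deriveM p1 p2.
Qed.

Variables (eps : R) (beta : pt -> pt) (alpha : pt -> R).
Hypothesis eps0 : 0 < eps.
Hypotheses (b1 : Linf P (fun x => (beta x).1)) (b2 : Linf P (fun x => (beta x).2)).
Hypothesis (divb : is_wdiv P beta (fun=> 0)).
Hypothesis (alphab : Linf P alpha).

Let xex : @ex R = ex \/ @ex R = ey. Proof. by left. Qed.
Let yey : @ey R = ex \/ @ey R = ey. Proof. by right. Qed.

Lemma L2_convection (v : pt -> R) : H1 P v ->
  L2 P (fun x => dot (beta x) (grad P v x)).
Proof.
move=> Hv; rewrite /dot/=.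
by apply: L2D; apply: L2_LinfM => //; [case: (H1_wderiv xex Hv)|case: (H1_wderiv yey Hv)].
Qed.

(** A field without divergence can be moved off a product, the approximation of
    [z] by test functions making [z * phi] a limit of admissible test functions. *)
Lemma convection_by_parts (z phi : pt -> R) : H10 P z -> test_fun P phi ->
  ip P z (fun x => (beta x).1 * 'D_ex phi x + (beta x).2 * 'D_ey phi x) =
  - ip P (fun x => dot (beta x) (grad P z x)) phi.
Proof.
move=> [Hz [zk tzk [c0 c1 c2]]] tphi.
have Lphi := test_fun_L2 Ofin tphi.
have Lphix := test_fun_L2 Ofin (test_fun_derive xex tphi).
have Lphiy := test_fun_L2 Ofin (test_fun_derive yey tphi).
have Lz : L2 P z by case: Hz.
have Lzk k := test_fun_L2 Ofin (tzk k).
have Lzkx k := test_fun_L2 Ofin (test_fun_derive xex (tzk k)).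
have Lzky k := test_fun_L2 Ofin (test_fun_derive yey (tzk k)).
have [Lzx _] := H1_wderiv xex Hz; have [Lzy _] := H1_wderiv yey Hz.
have phib : Linf P phi.
  split; first exact: test_fun_measurable.
  by have [M HM] := test_fun_le tphi; exists M; apply: aeW => x _.
pose B := fun x => (beta x).1 * 'D_ex phi x + (beta x).2 * 'D_ey phi x.
have LB : L2 P B by apply: L2D; exact: L2_LinfM.
pose p1 x := (beta x).1 * phi x; pose p2 x := (beta x).2 * phi x.
have Lp1 : L2 P p1 by exact: L2_LinfM.
have Lp2 : L2 P p2 by exact: L2_LinfM.
have E k : ip P B (zk k) + ip P p1 (fun x => 'D_ex (zk k) x)
   + ip P p2 (fun x => 'D_ey (zk k) x) = 0.
  have := divb (test_funM (tzk k) tphi).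
  have -> : ip P (fun=> 0) (fun x => zk k x * phi x) = 0.
    by rewrite /ip; under eq_Rintegral do rewrite mul0r; rewrite Rintegral_cst ?mul0r.
  rewrite oppr0 => <-; rewrite /ip.
  have I1 := L2_integrable LB (Lzk k).
  have I2 := L2_integrable Lp1 (Lzkx k).
  have I3 := L2_integrable Lp2 (Lzky k).
  have I12 := integrableD mO I1 I2.
  rewrite -(RintegralD mO I1 I2) -(RintegralD mO I12 I3).
  apply: eq_Rintegral => x _; rewrite /dot/= !test_fun_deriveM// /B /p1 /p2; ring.
have cv f g gk : L2 P f -> L2 P g -> (forall k, L2 P (gk k)) ->
    norm P (fun x => gk k x - g x) @[k --> \oo] --> (0 : R) ->
    ip P f (gk k) @[k --> \oo] --> ip P f g.
  move=> Lf Lg Lgk c.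
  have := ip_cvg0 Lf (fun k => L2B (Lgk k) Lg) c.
  move/(cvgD (cvg_cst (ip P f g))); rewrite addr0; apply: cvg_trans.
  apply: near_eq_cvg; near=> k => /=.
  transitivity (ip P f g + ip P f (fun x => gk k x - g x)) => //.
  by rewrite ipBr// addrC subrK.
have L : ip P B z + ip P p1 (wderiv P ex z) + ip P p2 (wderiv P ey z) = 0.
  have := cvgD (cvgD (cv _ _ _ LB Lz Lzk c0) (cv _ _ _ Lp1 Lzx Lzkx c1))
    (cv _ _ _ Lp2 Lzy Lzky c2).
  pose u k := ip P B (zk k) + ip P p1 (fun x => 'D_ex (zk k) x)
   + ip P p2 (fun x => 'D_ey (zk k) x).
  have u0 : u = fun=> 0 by apply/funext => k; exact: E.
  move=> C; have {}C : u k @[k --> \oo] --> ip P B z + ip P p1 (wderiv P ex z)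
     + ip P p2 (wderiv P ey z) by exact: C.
  by rewrite u0 in C; apply: (cvg_unique (@Rhausdorff R) C); exact: cvg_cst.
rewrite ipC -/B.
have -> : ip P (fun x => dot (beta x) (grad P z x)) phi =
    ip P p1 (wderiv P ex z) + ip P p2 (wderiv P ey z).
  rewrite /ip -RintegralD//; try exact: L2_integrable.
  apply: eq_Rintegral => x _; rewrite /dot/= /p1 /p2.
  by move: (wderiv P ex z x) (wderiv P ey z x) => a b; ring.
by apply/eqP; rewrite -subr_eq0 opprK addrA; apply/eqP.
Unshelve. all: by end_near. Qed.

(** Against test functions the residual of the adjoint equation vanishes, after moving
    one derivative in the diffusion term and, by [convection_by_parts], in the
    convection term. *)
Lemma adjoint_ae (g z : pt -> R) : L2 P g ->
  adjoint_solution P eps beta alpha g z ->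
  dae P (fun x => eps * laplacian P z x + dot (beta x) (grad P z x) + g x
                  - alpha x * z x = 0).
Proof.
move=> Lg [[Hz [Hzx Hzy]] Hz0 _ Hdiv].
have Lz : L2 P z by case: Hz.
have [Lzx wzx] := H1_wderiv xex Hz; have [Lzy wzy] := H1_wderiv yey Hz.
have [Lzxx wzxx] := H1_wderiv xex Hzx; have [Lzyy wzyy] := H1_wderiv yey Hzy.
have Lconv := L2_convection Hz.
have Llap : L2 P (laplacian P z) by exact: L2D.
have Laz : L2 P (fun x => alpha x * z x) by exact: L2_LinfM.
have Lel : L2 P (fun x => eps * laplacian P z x) by exact: L2Z.
have Lec : L2 P (fun x => eps * laplacian P z x + dot (beta x) (grad P z x)) by exact: L2D.
have Lecg := L2D Lec Lg.
apply: (fundamental_lemma Ofin); first exact: L2B.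
move=> phi tphi.
have Lphi := test_fun_L2 Ofin tphi.
have Lphix := test_fun_L2 Ofin (test_fun_derive xex tphi).
have Lphiy := test_fun_L2 Ofin (test_fun_derive yey tphi).
have := Hdiv phi tphi.
rewrite (ipBl Lecg Laz Lphi) (ipDl Lec Lg Lphi) (ipDl Lel Lconv Lphi).
rewrite (ipZl _ Llap Lphi) (ipBl Lg Laz Lphi) {1}/laplacian (ipDl Lzxx Lzyy Lphi).
have E0 : \int[leb2]_(x in Omega) dot
   (- pscale (z x) (beta x) - pscale (Num.sqrt eps) (flux P eps z x))
   ('D_ex phi x, 'D_ey phi x) =
  - ip P z (fun x => (beta x).1 * 'D_ex phi x + (beta x).2 * 'D_ey phi x)
  - eps * (ip P (wderiv P ex z) (fun x => 'D_ex phi x)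
         + ip P (wderiv P ey z) (fun x => 'D_ey phi x)).
  have LB : L2 P (fun x => (beta x).1 * 'D_ex phi x + (beta x).2 * 'D_ey phi x).
    by apply: L2D; exact: L2_LinfM.
  rewrite /ip -RintegralD//; try exact: L2_integrable.
  have I := integrableD mO (L2_integrable Lzx Lphix) (L2_integrable Lzy Lphiy).
  rewrite -RintegralZl//.
  rewrite -mulN1r -RintegralZl//; last exact: L2_integrable.
  rewrite -RintegralB//.
  - apply: eq_Rintegral => x _; rewrite /dot/=.
    have := sqr_sqrtr (ltW eps0); rewrite expr2 => E.
    rewrite -[in RHS]E.
    move: (wderiv P ex z x) (wderiv P ey z x) ('D_ex phi x) ('D_ey phi x).
    by move: (Num.sqrt eps) => r a b c d; ring.
  - exact: (integrableZl mO (-1) (L2_integrable Lz LB)).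
  - exact: (integrableZl mO eps I).
exact: adjoint_residual_arith E0 (convection_by_parts Hz0 tphi) (wzxx _ tphi) (wzyy _ tphi).
Qed.

(** Equality almost everywhere admits test functions [d] that are only square
    integrable, such as the difference of two very weak states. *)
Lemma adjoint_test (g z d : pt -> R) : L2 P g -> L2 P d ->
  adjoint_solution P eps beta alpha g z ->
  - eps * ip P d (laplacian P z)
    - ip P d (fun x => dot (beta x) (grad P z x))
    + ip P (fun x => alpha x * d x) z = ip P g d.
Proof.
move=> Lg Ld Hz; have H := adjoint_ae Lg Hz; case: Hz => [[Hz [Hzx Hzy]] _ _ _].
have Lz : L2 P z by case: Hz.
have [Lzxx _] := H1_wderiv xex Hzx; have [Lzyy _] := H1_wderiv yey Hzy.
have Lconv := L2_convection Hz.
have Llap : L2 P (laplacian P z) by exact: L2D.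
have Laz : L2 P (fun x => alpha x * z x) by exact: L2_LinfM.
have Lel : L2 P (fun x => eps * laplacian P z x) by exact: L2Z.
have Lec : L2 P (fun x => eps * laplacian P z x + dot (beta x) (grad P z x)) by exact: L2D.
have Lecg := L2D Lec Lg.
have L0 : L2 P (fun=> 0) by exact: sqint0.
have := ip_ae_eq (L2B Lecg Laz) L0 Ld H.
rewrite (ipBl Lecg Laz Ld) (ipDl Lec Lg Ld) (ipDl Lel Lconv Ld) (ipZl _ Llap Ld).
have -> : ip P (fun=> 0) d = 0.
  by rewrite /ip; under eq_Rintegral do rewrite mul0r; rewrite Rintegral_cst ?mul0r.
have -> : ip P (fun x => alpha x * z x) d = ip P (fun x => alpha x * d x) z.
  apply: eq_Rintegral => x _.
  by move: (alpha x) (z x) (d x) => a b c; ring.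
rewrite (ipC P d (laplacian P z)) (ipC P d (fun x => dot _ _)).
exact: tested_adjoint_arith.
Qed.

End AdjointTest.

(** * Convex polygons *)

Section Convexity.
Context {R : realType}.
Local Notation pt := (R * R)%type.

Lemma ordS_neq m (i : 'I_m) : (1 < m)%N -> ordS i != i.
Proof.
move=> m1; apply/eqP => /(congr1 val) /=; have im := ltn_ord i.
have [E|lt] : i.+1 = m \/ (i.+1 < m)%N.
  by move: im; rewrite leq_eqVlt => /orP[/eqP|]; [left|right].
  by rewrite E modnn => i0; rewrite -i0 in E; rewrite -E in m1.
by rewrite modn_small// => /eqP; rewrite gtn_eqF.
Qed.

Lemma ordSS_neq m (i : 'I_m) : (2 < m)%N -> ordS (ordS i) != i.
Proof.
move=> m2; apply/eqP => /(congr1 val) /= E.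
have im := ltn_ord i; move: E; rewrite -addn1 modnDml addn1 => E.
have [lt|ge] := ltnP i.+2 m; first by move: E; rewrite modn_small//; lia.
by move: E; rewrite -(subnK ge) modnDr modn_small; lia.
Qed.

(** Twice the signed area of the triangle on a side with apex [x]. *)
Definition side_val {m} (Q : 'I_m -> pt) (i : 'I_m) (x : pt) : R :=
  cross (Q (ordS i) - Q i) (x - Q i).

Lemma side_val_seg {m} (Q : 'I_m -> pt) i (a b : pt) (t : R) :
  side_val Q i (seg a b t) = (1 - t) * side_val Q i a + t * side_val Q i b.
Proof. by rewrite /side_val/cross/seg/=; ring. Qed.

Lemma side_val_tail {m} (Q : 'I_m -> pt) i : side_val Q i (Q i) = 0.
Proof. by rewrite /side_val/cross/=; ring. Qed.

Lemma side_val_head {m} (Q : 'I_m -> pt) i : side_val Q i (Q (ordS i)) = 0.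
Proof. by rewrite /side_val/cross/=; ring. Qed.

Lemma seg0 (a b : pt) : seg a b 0 = a.
Proof. by rewrite /seg; case: a => *; congr pair => /=; ring. Qed.

Lemma seg1 (a b : pt) : seg a b 1 = b.
Proof. by rewrite /seg; case: b => *; congr pair => /=; ring. Qed.

Lemma segment_tail (a b : pt) : segment a b a.
Proof. by exists 0; rewrite ?seg0// /= in_itv/= lexx ler01. Qed.

Lemma segment_head (a b : pt) : segment a b b.
Proof. by exists 1; rewrite ?seg1// /= in_itv/= lexx ler01. Qed.

Section Polygon.
Context {m : nat} (Q : 'I_m -> pt).
Hypothesis cQ : convex_polygon Q.

Let m2 : (2 < m)%N. Proof. by case: cQ. Qed.

Lemma side_val_vertex_gt0 i j : j != i -> j != ordS i -> 0 < side_val Q i (Q j).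
Proof. by case: cQ => _; exact. Qed.

Lemma side_val_vertex_ge0 i j : 0 <= side_val Q i (Q j).
Proof.
have [->|ji] := eqVneq j i; first by rewrite side_val_tail.
have [->|jSi] := eqVneq j (ordS i); first by rewrite side_val_head.
exact/ltW/side_val_vertex_gt0.
Qed.

Lemma side_val_side i x : side Q i x -> side_val Q i x = 0.
Proof.
by move=> [t _ <-]; rewrite side_val_seg side_val_tail side_val_head !mulr0 addr0.
Qed.

Lemma pclosed_vertex i : pclosed Q (Q i).
Proof. by move=> j; exact: side_val_vertex_ge0. Qed.

Lemma pclosed_seg (a b : pt) (t : R) : pclosed Q a -> pclosed Q b -> 0 <= t <= 1 ->
  pclosed Q (seg a b t).
Proof.
move=> Qa Qb /andP[t0 t1] j; rewrite -/(side_val Q j _) side_val_seg.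
by rewrite addr_ge0// mulr_ge0//; [rewrite subr_ge0|exact: Qa|exact: Qb].
Qed.

Lemma side_pclosed i : side Q i `<=` pclosed Q.
Proof.
move=> x [t t01 <-]; move: t01; rewrite /= in_itv/= => t01.
by apply: pclosed_seg => //; exact: pclosed_vertex.
Qed.

(** Otherwise the side [i] would join the vertices of the side [j] in the opposite
    order, as in a polygon with two vertices. *)
Lemma side_val_other i j : i != j ->
  0 < side_val Q j (Q i) \/ 0 < side_val Q j (Q (ordS i)).
Proof.
move=> ij; have [iSj|iSj] := eqVneq i (ordS j); last first.
  by left; exact: side_val_vertex_gt0.
right; apply: side_val_vertex_gt0.
  by rewrite iSj ordSS_neq.
by rewrite iSj ordS_neq// ltnW.
Qed.

(** Along the side [i], [side_val Q j] is affine, and nonnegative but not zero at both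
    ends; so it cannot vanish at two points. *)
Lemma sides_meet i j x y : i != j -> side Q i x -> side Q j x ->
  side Q i y -> side Q j y -> x = y.
Proof.
move=> ij [t _ <-] /side_val_side xj [s _ <-] /side_val_side yj.
have [->//|ts] := eqVneq t s; exfalso.
move: xj yj; rewrite !side_val_seg.
have := side_val_vertex_ge0 j i; have := side_val_vertex_ge0 j (ordS i).
have := side_val_other ij.
set A := side_val Q j (Q i); set B := side_val Q j (Q (ordS i)).
move=> AB B0 A0 Et Es.
have : (t - s) * (B - A) = 0.
  transitivity (((1 - t) * A + t * B) - ((1 - s) * A + s * B)); first by ring.
  by rewrite Et Es subrr.
move/eqP; rewrite mulf_eq0 subr_eq0 (negbTE ts)/= subr_eq0 => /eqP BA.
rewrite BA in Et AB; have A00 : A = 0 by rewrite -Et; ring.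
by rewrite A00 ltxx in AB; case: AB.
Qed.

Lemma side_val_interior i j (t : R) : i != j -> 0 < t < 1 ->
  0 < side_val Q j (seg (Q i) (Q (ordS i)) t).
Proof.
move=> ij /andP[t0 t1]; rewrite side_val_seg.
have A0 := side_val_vertex_ge0 j i; have B0 := side_val_vertex_ge0 j (ordS i).
case: (side_val_other ij) => H.
  apply: ltr_pwDl; first by apply: mulr_gt0 => //; rewrite subr_gt0.
  by apply: mulr_ge0 => //; exact: ltW.
apply: ltr_wpDl; last exact: mulr_gt0.
by apply: mulr_ge0 => //; rewrite subr_ge0 ltW.
Qed.

Lemma vertex_neq i : Q i != Q (ordS i).
Proof.
apply/eqP => E.
have S1 : ordS (ordS i) != i by rewrite ordSS_neq.
have S2 : ordS (ordS i) != ordS i by rewrite ordS_neq// ltnW.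
have := side_val_vertex_gt0 S1 S2.
by rewrite /side_val -E subrr /cross/= !mul0r subrr ltxx.
Qed.

Lemma side_vec_neq0 i : Q (ordS i) - Q i != 0.
Proof. by rewrite subr_eq0 eq_sym vertex_neq. Qed.

End Polygon.

Lemma seg_inj (a b : pt) : a != b -> injective (seg a b).
Proof.
move=> ab t s [E1 E2].
have [//|ts] := eqVneq t s; exfalso.
have ts0 : t - s != 0 by rewrite subr_eq0.
move/negP : ab; apply; apply/eqP; case: a b E1 E2 => [a1 a2] [b1 b2]/= E1 E2.
by congr pair; apply: (mulfI ts0); lra.
Qed.

Lemma weighted_sum_le (p q r u v w : R) : 0 <= p -> 0 <= q -> 0 <= r ->
  0 <= u -> 0 <= v -> 0 <= w -> p * u + q * v + r * w <= (v + w + u) * (p + q + r).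
Proof.
move=> p0 q0 r0 u0 v0 w0.
have := mulr_ge0 p0 v0; have := mulr_ge0 p0 w0; have := mulr_ge0 q0 u0.
have := mulr_ge0 q0 w0; have := mulr_ge0 r0 v0; have := mulr_ge0 r0 u0; lra.
Qed.

(** A point of the triangle is the barycentric combination of the vertices whose weights
    are the areas that it spans with the sides. *)
Lemma triangle_bounded (Q : 'I_3 -> pt) : convex_polygon Q ->
  exists M : R, forall x, pclosed Q x -> `|x.1| <= M /\ `|x.2| <= M.
Proof.
move=> cQ; pose i0 : 'I_3 := ord0.
pose a := Q i0; pose b := Q (ordS i0); pose c := Q (ordS (ordS i0)).
have S3 : ordS (ordS (ordS i0)) = i0 by apply: val_inj.
exists (`|a.1| + `|b.1| + `|c.1| + (`|a.2| + `|b.2| + `|c.2|)) => x Qx.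
have D0 : 0 < side_val Q i0 c.
  by apply: side_val_vertex_gt0 => //; rewrite ?ordSS_neq ?ordS_neq.
have l1 : 0 <= side_val Q i0 x by exact: Qx.
have l2 : 0 <= side_val Q (ordS i0) x by exact: Qx.
have l3 : 0 <= side_val Q (ordS (ordS i0)) x by exact: Qx.
move: D0 l1 l2 l3; rewrite /side_val S3 -/a -/b -/c.
set D := cross _ _; set p := cross _ _; set q := cross _ _; set r := cross _ _.
move=> D0 p0 q0 r0.
have pqr : p + q + r = D by rewrite /p/q/r/D/cross/=; ring.
have E1 : x.1 = (p * c.1 + q * a.1 + r * b.1) / D.
  by apply: (mulIf (lt0r_neq0 D0)); rewrite divfK ?gt_eqF// /p/q/r/D/cross/=; ring.
have E2 : x.2 = (p * c.2 + q * a.2 + r * b.2) / D.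
  by apply: (mulIf (lt0r_neq0 D0)); rewrite divfK ?gt_eqF// /p/q/r/D/cross/=; ring.
have B (u v w : R) : `|(p * u + q * v + r * w) / D| <= `|v| + `|w| + `|u|.
  rewrite normrM normfV (gtr0_norm D0) ler_pdivrMr// -pqr.
  apply: le_trans (ler_normD _ _) _; apply: le_trans (lerD (ler_normD _ _) (lexx _)) _.
  rewrite !normrM (ger0_norm p0) (ger0_norm q0) (ger0_norm r0).
  exact: weighted_sum_le.
rewrite E1 E2; split; apply: le_trans (B _ _ _) _.
  by rewrite lerDl !addr_ge0.
by rewrite lerDr !addr_ge0.
Qed.

End Convexity.

(** * Triangulations of a convex polygon *)

Section Overlap.
Context {R : realType}.
Local Notation pt := (R * R)%type.

(** If [v] is parallel to [D], it is the multiple of [D] given by the projection. *)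
Lemma crossZ (D v w : pt) : D != 0 -> cross D v = 0 ->
  cross v w = (dot v D / dot D D) * cross D w.
Proof.
move=> D0; have DD : dot D D != 0.
  apply: contra D0; rewrite /dot paddr_eq0 -?expr2 ?sqr_ge0// !sqrf_eq0.
  move=> /andP[/eqP a /eqP b].
  by apply/eqP; case: D a b => a b /= -> ->.
rewrite /dot/cross in DD *; move=> H; apply: (mulIf DD).
rewrite mulrAC divfK//.
have E : D.1 * v.2 = D.2 * v.1 by apply/eqP; rewrite -subr_eq0; apply/eqP.
have -> : (v.1 * w.2 - v.2 * w.1) * (D.1 * D.1 + D.2 * D.2) =
  (v.1 * w.2 * (D.1 * D.1) + D.2 * (D.2 * v.1) * w.2)
  - ((D.1 * v.2) * D.1 * w.1 + v.2 * w.1 * (D.2 * D.2)) by ring.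
have -> : (v.1 * D.1 + v.2 * D.2) * (D.1 * w.2 - D.2 * w.1) =
  v.1 * w.2 * (D.1 * D.1) + D.2 * (D.1 * v.2) * w.2
  - (D.2 * v.1 * D.1 * w.1 + v.2 * w.1 * (D.2 * D.2)) by ring.
by rewrite E.
Qed.

Lemma crossB_base (D x y p : pt) :
  cross D (x - y) = cross D (x - p) - cross D (y - p).
Proof. by rewrite /cross/=; ring. Qed.

(** With [S] the sum of the ratios [`|B k| / A k], the step [(1 + S)^-1] makes every
    [A k] outweigh [B k]. *)
Lemma small_convex_combination (m : nat) (A B : 'I_m -> R) (p : pred 'I_m) :
  (forall k, p k -> 0 < A k) ->
  exists2 tau : R, 0 < tau <= 1 & forall k, p k -> 0 <= (1 - tau) * A k + tau * B k.
Proof.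
move=> A0; pose S := \sum_(k | p k) `|B k| / A k.
have S0 : 0 <= S by apply: sumr_ge0 => k /A0 ak; rewrite divr_ge0// ltW.
have S1 : 0 < 1 + S by rewrite ltr_pwDl.
exists (1 + S)^-1; first by rewrite invr_gt0 S1 invf_le1// lerDl.
move=> k pk; have ak := A0 _ pk.
have BS : `|B k| <= S * A k.
  rewrite -ler_pdivrMr// /S (bigD1 k)//= lerDl.
  by apply: sumr_ge0 => j /andP[/A0 aj _]; rewrite divr_ge0// ltW.
have -> : (1 - (1 + S)^-1) * A k + (1 + S)^-1 * B k = (1 + S)^-1 * (S * A k + B k).
  by field; rewrite gt_eqF.
rewrite mulr_ge0// ?invr_ge0 ?(ltW S1)//.
have := ler_norm (- B k); rewrite normrN; move: BS; lra.
Qed.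

Section TwoTriangles.
Context {n : nat} (P : 'I_n -> pt) (K L : 'I_3 -> pt) (i j : 'I_3).
Hypotheses (cP : convex_polygon P) (cK : convex_polygon K) (cL : convex_polygon L).
Hypotheses (KP : pclosed K `<=` pclosed P) (LP : pclosed L `<=` pclosed P).
Hypotheses (KL : side K i = side L j) (KP1 : side K i `<=` pboundary P).

Let apex_neq (k : 'I_3) : ordS (ordS k) != k /\ ordS (ordS k) != ordS k.
Proof. by rewrite ordSS_neq// ordS_neq. Qed.

(** A counterclockwise triangle inside the polygon runs along a side of the polygon in
    the direction of that side, so the half plane of its own side contains the
    polygon. *)
Lemma side_on_boundary (T : 'I_3 -> pt) (k : 'I_3) s : convex_polygon T ->
  pclosed T `<=` pclosed P ->
  side_val P s (T k) = 0 -> side_val P s (T (ordS k)) = 0 ->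
  forall x, pclosed P x -> 0 <= side_val T k x.
Proof.
move=> cT TP a0 b0 x Px.
have D0 := side_vec_neq0 cP s.
set D := P (ordS s) - P s in D0.
have c0 : cross D (T (ordS k) - T k) = 0.
  by rewrite (crossB_base D _ _ (P s)) [X in X - _]b0 [X in _ - X]a0 subrr.
have E y : side_val T k y = (dot (T (ordS k) - T k) D / dot D D) * side_val P s y.
  rewrite /side_val (crossZ _ D0 c0) -/D; congr (_ * _).
  by rewrite (crossB_base D _ _ (P s)) [X in _ - X]a0 subr0.
have [n1 n2] := apex_neq k.
have := side_val_vertex_gt0 cT n1 n2; rewrite E => H.
have sc : 0 <= side_val P s (T (ordS (ordS k))) by apply: TP; exact: pclosed_vertex.
rewrite E; apply: mulr_ge0; last exact: Px.
rewrite leNgt; apply/negP => l0; move: H; rewrite ltNge => /negP; apply.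
by apply: mulr_le0_ge0 => //; exact: ltW.
Qed.

(** Two triangles inside a convex polygon that have a common side on its boundary
    lie on the same side of it, so they share more than that side. *)
Lemma common_boundary_side : pclosed K `&` pclosed L = side K i -> False.
Proof.
move=> I.
pose m := seg (K i) (K (ordS i)) 2^-1.
have h01 : 0 < (2^-1 : R) < 1 by rewrite invr_gt0 ltr0n invf_lt1// ltr1n.
have h01' : 0 <= (2^-1 : R) <= 1 by case/andP: h01 => /ltW -> /ltW ->.
have Km : side K i m by exists 2^-1 => //; rewrite /= in_itv.
have [s _ sm] := KP1 Km.
have Pv T (k : 'I_3) : convex_polygon T -> pclosed T `<=` pclosed P ->
    0 <= side_val P s (T k).
  by move=> cT TP; apply: TP; exact: pclosed_vertex.
have [a0 b0] : side_val P s (K i) = 0 /\ side_val P s (K (ordS i)) = 0.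
  have := side_val_side sm; rewrite side_val_seg.
  have := Pv K i cK KP; have := Pv K (ordS i) cK KP.
  set a := side_val _ _ _; set b := side_val _ _ _ => a1 b1 H.
  split; lra.
have onL x : side L j x -> side_val P s x = 0.
  by rewrite -KL => -[t _ <-]; rewrite side_val_seg a0 b0 !mulr0 addr0.
have a0' := onL _ (segment_tail _ _); have b0' := onL _ (segment_head _ _).
(* the midpoint of the common side is interior to it when seen from [L] as well *)
have [t t01 tm] : exists2 t : R, 0 < t < 1 & seg (L j) (L (ordS j)) t = m.
  have : side L j (K i) by rewrite -KL; exact: segment_tail.
  move=> [u /=]; rewrite in_itv/= => /andP[u0 u1] uE.
  have : side L j (K (ordS i)) by rewrite -KL; exact: segment_head.
  move=> [w /=]; rewrite in_itv/= => /andP[w0 w1] wE.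
  have uw : u != w.
    by apply/eqP => E; move: (vertex_neq cK i); rewrite -uE -wE E eqxx.
  exists ((u + w) / 2).
    have := uw; rewrite neq_lt => /orP[] H; apply/andP; split; lra.
  by rewrite /m -uE -wE /seg/=; congr pair; field.
have [n1 n2] := apex_neq i.
pose c := K (ordS (ordS i)).
have Kc : pclosed K c by exact: pclosed_vertex.
have [|tau /andP[tau0 tau1] Htau] := @small_convex_combination 3
   (fun k => side_val L k m) (fun k => side_val L k c) (fun k => j != k).
  by move=> k jk; rewrite -tm; exact: side_val_interior.
(* a point just above the midpoint, towards the apex of [K] *)
pose x := seg m c tau.
have Kx : pclosed K x.
  apply: pclosed_seg => //; last by rewrite ltW.
  by apply: (side_pclosed cK Km).
have Lx : pclosed L x.
  move=> k; rewrite -/(side_val L k x).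
  have [->|kj] := eqVneq k j; last by rewrite /x side_val_seg Htau// eq_sym.
  exact: (side_on_boundary cL LP a0' b0' (KP Kx)).
have : side K i x by rewrite -I.
move/side_val_side; rewrite /x side_val_seg (side_val_side Km) mulr0 add0r.
have := side_val_vertex_gt0 cK n1 n2; rewrite -/c => c0 /eqP.
by rewrite mulf_eq0 (gt_eqF tau0) (gt_eqF c0).
Qed.

End TwoTriangles.
End Overlap.

Section Triangulation.
Context {R : realType} {n : nat}.
Local Notation pt := (R * R)%type.
Local Notation mpt := (@mpt R).
Local Notation leb2 := (@lebesgue2 R).
Variables (P : 'I_n -> pt) (T : mesh R).
Hypotheses (cP : convex_polygon P) (cT : conforming_triangulation P T).

Lemma triangle_convex K : convex_polygon (T K).
Proof. by case: cT. Qed.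

Lemma triangle_sub K : pclosed (T K) `<=` pclosed P.
Proof. by case: cT => _ <- _ x Kx; exists K. Qed.

Lemma eset_pclosed (e : edge T) : eset e `<=` pclosed P.
Proof.
by move=> x ex; apply: (@triangle_sub e.1); apply: (side_pclosed (triangle_convex e.1)) ex.
Qed.

(** Different sides of one triangle meet in a vertex.  Sides of different triangles
    that met in more than one point would coincide with the common side of the two
    triangles, which [common_boundary_side] excludes. *)
Lemma boundary_edges_meet (e e' : edge T) x y : e != e' ->
  boundary_edge P e -> boundary_edge P e' ->
  eset e x -> eset e' x -> eset e y -> eset e' y -> x = y.
Proof.
case: e e' => [K i] [L j] ee' /asboolP eP /asboolP eP' ex ex' ey ey'.
have [KL|KL] := eqVneq K L.
  subst L; have ij : i != j by apply: contra ee' => /eqP ->.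
  exact: (sides_meet (triangle_convex K) ij ex ex' ey ey').
have Ix : (pclosed (T K) `&` pclosed (T L)) x.
  split; first exact: (side_pclosed (triangle_convex K) ex).
  exact: (side_pclosed (triangle_convex L) ex').
have Iy : (pclosed (T K) `&` pclosed (T L)) y.
  split; first exact: (side_pclosed (triangle_convex K) ey).
  exact: (side_pclosed (triangle_convex L) ey').
case: cT => _ _ /(_ _ _ KL)/=[I0|[i' [j' [_ I1]]]|[i' [j' [SS I2]]]].
- by rewrite I0 in Ix.
- by rewrite I1 in Ix Iy; rewrite Ix Iy.
- have Kx : side (T K) i' x by rewrite -I2.
  have Ky : side (T K) i' y by rewrite -I2.
  have [ii|ii] := eqVneq i i'; last exact: (sides_meet (triangle_convex K) ii ex Kx ey Ky).
  rewrite SS in Kx Ky.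
  have [jj|jj] := eqVneq j j'; last exact: (sides_meet (triangle_convex L) jj ex' Kx ey' Ky).
  subst i' j'; exfalso.
  exact: (common_boundary_side cP (triangle_convex K) (triangle_convex L)
    (@triangle_sub K) (@triangle_sub L) SS eP I2).
Qed.

(** The edge coefficients are prescribed against the normal of [e] only; this gives
    their product with the normal seen from the other triangle. *)
Lemma common_edge_normal (e e' : edge T) : eset e = eset e' ->
  exists c : R, enormal e' = pscale c (enormal e).
Proof.
move=> E.
have [s _ sE] : eset e (etail e') by rewrite E; exact: segment_tail.
have [t _ tE] : eset e (ehead e') by rewrite E; exact: segment_head.
have V : ehead e' - etail e' = pscale (t - s) (ehead e - etail e).
  by rewrite -sE -tE /seg/pscale; congr pair => /=; ring.
have l0 : elen (ehead e - etail e) != 0.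
  have : ehead e - etail e != 0 by exact: side_vec_neq0 (triangle_convex e.1) e.2.
  set d := ehead e - etail e => d0.
  rewrite sqrtr_eq0 -ltNge lt_neqAle eq_sym; apply/andP; split.
    rewrite /dot paddr_eq0 -?expr2 ?sqr_ge0// !sqrf_eq0.
    by apply: contra d0 => /andP[/eqP a /eqP b]; case: d a b => a b /= -> ->.
  by rewrite /dot -!expr2 addr_ge0 ?sqr_ge0.
exists ((elen (ehead e' - etail e'))^-1 * (t - s) * elen (ehead e - etail e)).
rewrite /enormal/right_normal V; move: l0.
set d := ehead e - etail e; set l := elen d => l0.
by move: (elen _)^-1 => k; rewrite /pscale/=; congr pair; field.
Qed.

Lemma domain_finite_measure : (leb2 (popen P) < +oo)%E.
Proof.
have [M HM] : exists M : R, forall x, pclosed P x -> `|x.1| <= M /\ `|x.2| <= M.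
  have H K := cid (triangle_bounded (triangle_convex K)).
  exists (\sum_(K < ncells T) `|sval (H K)|) => x.
  case: cT => _ <- _ [K _ Kx]; have [] := svalP (H K) x Kx.
  have MK : sval (H K) <= \sum_(K < ncells T) `|sval (H K)|.
    rewrite (bigD1 K)//=; apply: ler_wpDr; last exact: ler_norm.
    by apply: sumr_ge0.
  by move=> h1 h2; split; [exact: le_trans h1 MK|exact: le_trans h2 MK].
have sub : popen P `<=` box (- (M + 1)) (M + 1) (- (M + 1)) (M + 1).
  move=> x Ox; have Px : pclosed P x by move=> i; exact: ltW (Ox i).
  have [h1 h2] := HM _ Px.
  rewrite /box/= !in_itv/= -!ltr_norml; split; [move: h1|move: h2]; lra.
apply: le_lt_trans (lebesgue2_box_lty (- (M + 1)) (M + 1) (- (M + 1)) (M + 1)).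
apply: le_measure => //; rewrite inE; [exact: measurable_popen|exact: measurable_box].
Qed.

End Triangulation.

(** * Bounded measurable functions along a segment *)

Section Tame.
Context {R : realType}.
Local Notation pt := (R * R)%type.
Local Notation leb := (@lebesgue_measure R).
Definition unit_itv : set (measurableTypeR R) := `[0, 1]%classic.
Local Notation I01 := unit_itv.

Lemma measurable_unit_itv : measurable I01.
Proof. exact: measurable_itv. Qed.
Let mI := measurable_unit_itv.

Lemma unit_itv_lty : (leb I01 < +oo)%E.
Proof.
rewrite /unit_itv lebesgue_measure_itv/= ?lte_fin ?ltr01 -?EFinB; exact: ltry.
Qed.

(** The class in which all coefficients and discrete functions lie on an edge: it is
    stable under products, and its members multiply square integrable functions. *)
Definition tame (a b : pt) (g : pt -> R) : Prop :=
  measurable_fun I01 (g \o seg a b) /\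
  exists M : R, forall x, segment a b x -> `|g x| <= M.

Section OnSegment.
Variables a b : pt.
Implicit Types g h : pt -> R.

Lemma tame_cst (c : R) : tame a b (fun=> c).
Proof. by split; [exact: measurable_cst|exists `|c|]. Qed.

Lemma tameD g h : tame a b g -> tame a b h -> tame a b (fun x => g x + h x).
Proof.
move=> [mg [M HM]] [mh [N HN]]; split; first exact: measurable_funD.
exists (M + N) => x sx; apply: le_trans (ler_normD _ _) _.
by apply: lerD; [exact: HM|exact: HN].
Qed.

Lemma tameM g h : tame a b g -> tame a b h -> tame a b (fun x => g x * h x).
Proof.
move=> [mg [M HM]] [mh [N HN]]; split; first exact: measurable_funM.
exists (M * N) => x sx; rewrite normrM.
by apply: ler_pM => //; [exact: HM|exact: HN].
Qed.

Lemma tameN g : tame a b g -> tame a b (fun x => - g x).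
Proof.
move=> [mg [M HM]]; split; first exact: measurable_funN.
by exists M => x sx; rewrite normrN; exact: HM.
Qed.

Lemma tame_norm g : tame a b g -> tame a b (fun x => `|g x|).
Proof.
move=> [mg [M HM]]; split.
  by apply: measurableT_comp mg; exact: normr_measurable.
by exists M => x sx; rewrite normr_id; exact: HM.
Qed.

Lemma tame_sum (J : Type) (s : seq J) (F : J -> pt -> R) :
  (forall j, tame a b (F j)) -> tame a b (fun x => \sum_(j <- s) F j x).
Proof.
move=> tF; elim: s => [|j s IH].
  by under eq_fun do rewrite big_nil; exact: tame_cst.
by under eq_fun do rewrite big_cons; exact: tameD.
Qed.

Lemma eq_tame g h : (forall x, segment a b x -> g x = h x) -> tame a b g -> tame a b h.
Proof.
move=> gh [mg [M HM]]; split; last by exists M => x sx; rewrite -gh//; exact: HM.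
apply: eq_measurable_fun mg => t /[!inE] t01 /=; apply: gh.
by exists t.
Qed.

Lemma continuous_seg1 : continuous (fun t : R => (seg a b t).1).
Proof.
move=> t; apply: cvgD; apply: cvgM => //; try exact: cvg_cst.
by apply: cvgB => //; exact: cvg_cst.
Qed.

Lemma continuous_seg2 : continuous (fun t : R => (seg a b t).2).
Proof.
move=> t; apply: cvgD; apply: cvgM => //; try exact: cvg_cst.
by apply: cvgB => //; exact: cvg_cst.
Qed.

Lemma continuous_seg : continuous (seg a b).
Proof.
move=> t; exact: (cvg_pair (@continuous_seg1 t) (@continuous_seg2 t)).
Qed.

Lemma tame_within (S : set pt) g : segment a b `<=` S ->
  {within S, continuous g} -> tame a b g.
Proof.
move=> sS cg.
have cgs : {within `[0, 1], continuous (g \o seg a b)}.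
  apply/subspace_continuousP => t t01.
  have St : S (seg a b t) by apply: sS; exists t.
  have cgt := (subspace_continuousP _ _).1 cg _ St.
  apply: cvg_comp cgt => U HU.
  have near_t : \forall r \near t, S (seg a b r) -> U (seg a b r).
    exact: (@continuous_seg t _ HU).
  suff : \forall r \near t, `[0, 1]%classic r -> U (seg a b r) by [].
  by apply: filterS near_t => r SU rI; apply: SU; apply: sS; exists r.
split.
  by apply: subspace_continuous_measurable_fun => //; exact: measurable_itv.
have [M [_ HM]] := compact_bounded (continuous_compact cgs (@segment_compact R 0 1)).
exists (M + 1) => _ [t t01 <-]; apply: HM; last by exists t.
by rewrite ltrDl.
Qed.

Lemma tame_continuous g : continuous g -> tame a b g.
Proof.
move=> cg; apply: (@tame_within setT) => //; exact: continuous_subspaceT.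
Qed.

Lemma tame_aeval p : tame a b (aeval p).
Proof.
apply: tame_continuous => x; rewrite /aeval.
apply: cvgD; last by apply: cvgM; [exact: cvg_cst|exact: cvg_snd].
apply: cvgD; first exact: cvg_cst.
by apply: cvgM; [exact: cvg_cst|exact: cvg_fst].
Qed.

Lemma tame_bool (S : set pt) : measurable (I01 `&` seg a b @^-1` S) ->
  tame a b (fun x => `[< S x >]%:R).
Proof.
move=> mS; split; last first.
  by exists 1 => x _; rewrite ger0_norm ?ler0n// lern1 leq_b1.
have m1 : measurable_fun I01 (\1_(I01 `&` seg a b @^-1` S) : measurableTypeR R -> R).
  by apply: measurable_funTS; exact: measurable_indic.
apply: eq_measurable_fun m1 => t /[!inE] t01; rewrite indicE/=; congr (_%:R : R).
apply: congr1; apply/idP/idP; first by rewrite inE => -[_ ?]; rewrite asboolE.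
by rewrite asboolE inE.
Qed.

Lemma tame_closed (S : set pt) : closed S -> tame a b (fun x => `[< S x >]%:R).
Proof.
move=> cS; apply: tame_bool; apply: measurableI => //.
apply: closed_measurable; apply: closed_comp => // t _.
exact: continuous_seg.
Qed.

Lemma tame_lt0 g : tame a b g -> tame a b (fun x => `[< g x < 0 >]%:R).
Proof.
move=> [mg _]; apply: (tame_bool (S := [set x | g x < 0])).
rewrite (_ : _ @^-1` _ = (g \o seg a b) @^-1` `]-oo, 0[%classic).
  by apply: mg => //; exact: measurable_itv.
by apply/seteqP; split=> t /=; rewrite in_itv.
Qed.

Lemma tame_sg g : tame a b g -> tame a b (fun x => Num.sg (g x)).
Proof.
move=> tg; apply: eq_tame (tameD (tame_lt0 (tameN tg)) (tameN (tame_lt0 tg))) => x _.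
rewrite !asboolb oppr_lt0; case: (ltgtP (g x) 0) => [g0|g0|->].
- by rewrite ltr0_sg// add0r.
- by rewrite gtr0_sg// subr0.
- by rewrite sgr0 subr0.
Qed.

(** The choice is a function of the vector of truth values, which takes finitely many
    values; the function is the sum of its restrictions to their level sets. *)
Lemma tame_pick (E : finType) (S : E -> set pt) (bb : pred E)
    (F : option E -> pt -> R) : (forall e, closed (S e)) ->
  (forall o, tame a b (F o)) ->
  tame a b (fun x => F [pick e | bb e && `[< S e x >]] x).
Proof.
move=> cS tF.
pose vec x : {ffun E -> bool} := [ffun e => `[< S e x >]].
pose G (w : {ffun E -> bool}) x : R :=
  (\prod_(e : E) (if w e then `[< S e x >]%:R else 1 - `[< S e x >]%:R))
  * F [pick e | bb e && w e] x.
have tG w : tame a b (G w).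
  apply: tameM => //.
  elim: (index_enum E) => [|e s IH].
    by under eq_fun do rewrite big_nil; exact: tame_cst.
  under eq_fun do rewrite big_cons.
  apply: tameM => //; case: (w e); first exact: tame_closed.
  by apply: tameD; [exact: tame_cst|apply: tameN; exact: tame_closed].
apply: eq_tame (tame_sum (index_enum {ffun E -> bool}) tG) => x _.
rewrite (bigD1 (vec x))//= [X in _ + X]big1 ?addr0.
  rewrite /G big1 ?mul1r.
    by congr (F _ _); apply: eq_pick => e /=; rewrite ffunE.
  by move=> e _; rewrite ffunE; case: `[< S e x >]; rewrite ?subr0.
move=> w wv; rewrite /G.
(* for another vector of truth values some factor of the product is 0 *)
have [e we] : exists e, w e != vec x e.
  apply/existsP; rewrite -negb_forall; apply: contra wv => /forallP H.
  by apply/eqP/ffunP => e; apply/eqP.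
rewrite (bigD1 e)//=; move: we; rewrite ffunE.
by case: (w e); case: `[< S e x >] => // _; rewrite ?subrr !mul0r.
Qed.

Lemma tame_integrable g : tame a b g ->
  leb.-integrable I01 (EFin \o (g \o seg a b)).
Proof.
move=> [mg [M HM]]; apply: measurable_bounded_integrable => //.
  exact: unit_itv_lty.
exists M; split; first exact: num_real.
move=> y My t t01; apply: ltW; apply: le_lt_trans My; apply: HM.
by exists t.
Qed.

Lemma tame_sqintM g h : tame a b g -> sqint leb I01 (h \o seg a b) ->
  sqint leb I01 ((fun x => g x * h x) \o seg a b).
Proof.
move=> [mg [M HM]] sh; apply: (@sqintM_bounded _ _ _ leb _ mI _ _ M) => // t t01.
by apply: HM; exists t.
Qed.

Lemma tame_sqint g : tame a b g -> sqint leb I01 (g \o seg a b).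
Proof.
move=> [mg [M HM]]; apply: (@sqint_bounded _ _ _ leb _ mI _ M) => //.
  exact: unit_itv_lty.
by move=> t t01; apply: HM; exists t.
Qed.

Lemma line_intE g : line_int a b setT g =
  elen (b - a) * \int[leb]_(t in I01) g (seg a b t).
Proof. by rewrite /line_int preimage_setT setIT. Qed.

Lemma line_int_restrict (A : set pt) g :
  line_int a b A g = line_int a b setT (fun x => \1_A x * g x).
Proof.
rewrite line_intE /line_int Rintegral_mkcondr; congr (_ * _).
apply: eq_Rintegral => t _; rewrite patchE indicE.
have [tA|tA] := pselect (A (seg a b t)).
  by rewrite !mem_set// mul1r.
by rewrite !memNset// mul0r.
Qed.

Lemma line_intD g h : leb.-integrable I01 (EFin \o (g \o seg a b)) ->
  leb.-integrable I01 (EFin \o (h \o seg a b)) ->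
  line_int a b setT (fun x => g x + h x) = line_int a b setT g + line_int a b setT h.
Proof. by move=> ig ih; rewrite !line_intE -mulrDr -RintegralD. Qed.

Lemma line_intZ (c : R) g : leb.-integrable I01 (EFin \o (g \o seg a b)) ->
  line_int a b setT (fun x => c * g x) = c * line_int a b setT g.
Proof. by move=> ig; rewrite !line_intE RintegralZl// mulrCA. Qed.

End OnSegment.
End Tame.

(** * Functions on the boundary of the polygon *)

Section BoundaryFunctions.
Context {R : realType} {n : nat}.
Local Notation pt := (R * R)%type.
Local Notation leb := (@lebesgue_measure R).
Local Notation I01 := (@unit_itv R).
Variable P : 'I_n -> pt.
Implicit Types g h k : pt -> R.
Let mI := @measurable_unit_itv R.

Definition btame g : Prop := forall i : 'I_n, tame (P i) (P (ordS i)) g.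

Definition bintegrable g : Prop := forall i : 'I_n,
  leb.-integrable I01 (EFin \o (g \o seg (P i) (P (ordS i)))).

Lemma L2bD g h : L2b P g -> L2b P h -> L2b P (fun x => g x + h x).
Proof. by move=> Lg Lh i; exact: (sqintD mI (Lg i) (Lh i)). Qed.

Lemma L2bB g h : L2b P g -> L2b P h -> L2b P (fun x => g x - h x).
Proof. by move=> Lg Lh i; exact: (sqintB mI (Lg i) (Lh i)). Qed.

Lemma L2bZ c g : L2b P g -> L2b P (fun x => c * g x).
Proof. by move=> Lg i; exact: (sqintZ mI c (Lg i)). Qed.

Lemma L2b0 : L2b P (fun=> 0).
Proof. by move=> i; exact: sqint0. Qed.

Lemma L2b_sum (J : Type) (s : seq J) (F : J -> pt -> R) :
  (forall j, L2b P (F j)) -> L2b P (fun x => \sum_(j <- s) F j x).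
Proof.
move=> LF; elim: s => [|j s IH].
  by under eq_fun do rewrite big_nil; exact: L2b0.
by under eq_fun do rewrite big_cons; exact: L2bD.
Qed.

Lemma L2b_integrable g h : L2b P g -> L2b P h -> bintegrable (fun x => g x * h x).
Proof. by move=> Lg Lh i; exact: (sqintM mI (Lg i) (Lh i)). Qed.

Lemma btameL2b g h : btame g -> L2b P h -> L2b P (fun x => g x * h x).
Proof. by move=> tg Lh i; exact: (tame_sqintM (tg i) (Lh i)). Qed.

Lemma btame_L2b g : btame g -> L2b P g.
Proof. by move=> tg i; exact: (tame_sqint (tg i)). Qed.

Lemma btame_integrable g : btame g -> bintegrable g.
Proof. by move=> tg i; exact: (tame_integrable (tg i)). Qed.

Lemma bint_restrict (A : set pt) g : bint P A g = bint P setT (fun x => \1_A x * g x).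
Proof. by apply: eq_bigr => i _; exact: line_int_restrict. Qed.

Lemma bintD g h : bintegrable g -> bintegrable h ->
  bint P setT (fun x => g x + h x) = bint P setT g + bint P setT h.
Proof. by move=> ig ih; rewrite -big_split; apply: eq_bigr => i _; exact: line_intD. Qed.

Lemma bintZ c g : bintegrable g ->
  bint P setT (fun x => c * g x) = c * bint P setT g.
Proof. by move=> ig; rewrite mulr_sumr; apply: eq_bigr => i _; exact: line_intZ. Qed.

Lemma bintegrableD g h : bintegrable g -> bintegrable h ->
  bintegrable (fun x => g x + h x).
Proof. by move=> ig ih i; exact: (integrableD mI (ig i) (ih i)). Qed.

Lemma bintegrableZ c g : bintegrable g -> bintegrable (fun x => c * g x).
Proof. by move=> ig i; exact: (integrableZl mI c (ig i)). Qed.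

Lemma bint_sum (J : Type) (s : seq J) (p : pred J) (F : J -> pt -> R) :
  (forall j, bintegrable (F j)) ->
  bint P setT (fun x => \sum_(j <- s | p j) F j x) =
  \sum_(j <- s | p j) bint P setT (F j).
Proof.
move=> iF.
suff [_] : bintegrable (fun x => \sum_(j <- s | p j) F j x) /\
    bint P setT (fun x => \sum_(j <- s | p j) F j x) =
    \sum_(j <- s | p j) bint P setT (F j) by [].
elim: s => [|j s [IH1 IH2]].
  under [X in bint _ _ X]eq_fun do rewrite big_nil.
  under [X in bintegrable X]eq_fun do rewrite big_nil.
  split; first by apply: btame_integrable => i; exact: tame_cst.
  rewrite big_nil /bint big1// => i _.
  by rewrite line_intE Rintegral_cst ?mul0r ?mulr0.
under [X in bint _ _ X]eq_fun do rewrite big_cons.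
under [X in bintegrable X]eq_fun do rewrite big_cons.
rewrite big_cons; case: ifP => // _; split; first exact: bintegrableD.
by rewrite bintD// IH2.
Qed.

Lemma le_bint g h : bintegrable g -> bintegrable h -> (forall x, g x <= h x) ->
  bint P setT g <= bint P setT h.
Proof.
move=> ig ih gh; apply: ler_sum => i _; rewrite !line_intE.
apply: ler_wpM2l; first exact: sqrtr_ge0.
by apply: (le_Rintegral mI (ig i) (ih i)) => t _; exact: gh.
Qed.

Lemma bint_ge0 g : (forall x, 0 <= g x) -> 0 <= bint P setT g.
Proof.
move=> g0; apply: sumr_ge0 => i _; rewrite line_intE mulr_ge0 ?sqrtr_ge0//.
exact: Rintegral_ge0.
Qed.

Lemma normb_sq g : normb P g ^+ 2 = bint P setT (fun x => g x ^+ 2).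
Proof. by rewrite sqr_sqrtr//; apply: bint_ge0 => x; exact: sqr_ge0. Qed.

Lemma eq_bint_ae g h : bintegrable g -> bintegrable h ->
  bae P (fun x => g x = h x) -> bint P setT g = bint P setT h.
Proof.
move=> ig ih gh; apply: eq_bigr => i _; rewrite !line_intE; congr (_ * fine _).
apply: ae_eq_integral => //.
- exact: measurable_int (ig i).
- exact: measurable_int (ih i).
- by apply: aeS (gh i) => t H /H /= ->.
Qed.

Lemma eq_bint (A : set pt) g h : (forall x, g x = h x) -> bint P A g = bint P A h.
Proof. by move=> /funext ->. Qed.

Lemma trace_L2b (v : pt -> R) : L2b P (trace P v).
Proof.
rewrite /trace; case: xgetP => [g _ [Lg _]//|_]; exact: L2b0.
Qed.

Lemma closed_segment (a b : pt) : closed (segment a b).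
Proof.
apply: compact_closed => //; apply: continuous_compact; last exact: segment_compact.
by apply: continuous_subspaceT; exact: continuous_seg.
Qed.

Lemma tame_normal (a b : pt) : tame a b (fun x => (normal P x).1) /\
  tame a b (fun x => (normal P x).2).
Proof.
split; rewrite /normal.
- apply: (@tame_pick _ a b _ (side P) predT
    (fun o _ => (if o is Some i then side_normal P i else 0).1)).
    by move=> i; exact: closed_segment.
  by move=> o; exact: tame_cst.
- apply: (@tame_pick _ a b _ (side P) predT
    (fun o _ => (if o is Some i then side_normal P i else 0).2)).
    by move=> i; exact: closed_segment.
  by move=> o; exact: tame_cst.
Qed.

Lemma tame_dot (a b : pt) (F G : pt -> pt) :
  tame a b (fun x => (F x).1) -> tame a b (fun x => (F x).2) ->
  tame a b (fun x => (G x).1) -> tame a b (fun x => (G x).2) ->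
  tame a b (fun x => dot (F x) (G x)).
Proof. by move=> *; apply: tameD; exact: tameM. Qed.

Lemma dot_pairl (a b : R) (N : pt) : dot (a, b) N = N.1 * a + N.2 * b.
Proof. by rewrite /dot/= (mulrC a) (mulrC b). Qed.

Lemma dnormal_L2b (v : pt -> R) : L2b P (dnormal P v).
Proof.
have H1 : L2b P (fun x => (normal P x).1 * trace P (wderiv P ex v) x).
  by apply: btameL2b; [move=> i; case: (tame_normal (P i) (P (ordS i)))|exact: trace_L2b].
have H2 : L2b P (fun x => (normal P x).2 * trace P (wderiv P ey v) x).
  by apply: btameL2b; [move=> i; case: (tame_normal (P i) (P (ordS i)))|exact: trace_L2b].
have -> : dnormal P v = (fun x => (normal P x).1 * trace P (wderiv P ex v) x
    + (normal P x).2 * trace P (wderiv P ey v) x).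
  by apply/funext => x; exact: dot_pairl.
exact: L2bD.
Qed.

Section Coefficients.
Variable beta : pt -> pt.
Hypothesis cbeta : {within pclosed P, continuous beta}.

Lemma tame_beta (a b : pt) : segment a b `<=` pclosed P ->
  tame a b (fun x => (beta x).1) /\ tame a b (fun x => (beta x).2).
Proof.
move=> sP; split; apply: (tame_within sP) => x.
  by apply: continuous_comp; [exact: cbeta|exact: cvg_fst].
by apply: continuous_comp; [exact: cbeta|exact: cvg_snd].
Qed.

Lemma tame_dot_beta (a b c : pt) : segment a b `<=` pclosed P ->
  tame a b (fun x => dot c (beta x)).
Proof.
by move=> /tame_beta[t1 t2]; apply: tame_dot => //; exact: tame_cst.
Qed.

Hypothesis cP : convex_polygon P.

Lemma btame_beta_normal : btame (fun x => dot (beta x) (normal P x)).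
Proof.
move=> i; have [t1 t2] := tame_beta (side_pclosed cP (i := i)).
by have [n1 n2] := tame_normal (P i) (P (ordS i)); exact: tame_dot.
Qed.

Lemma btame_Gamma_minus : btame (\1_(Gamma_minus P beta)).
Proof.
move=> i; apply: eq_tame (tame_lt0 (btame_beta_normal i)) => x sx.
rewrite indicE; congr (_%:R); apply: congr1; apply/asboolP/idP.
  by move=> H; rewrite inE; split=> //; exists i.
by rewrite inE => -[].
Qed.

Lemma btame_Gamma_plus : btame (\1_(Gamma_plus P beta)).
Proof.
move=> i; apply: eq_tame (tameD (tame_cst _ _ 1) (tameN (btame_Gamma_minus i))) => x sx.
have px : pboundary P x by exists i.
rewrite !indicE; have [H|H] := ltP (dot (beta x) (normal P x)) 0.
  rewrite mem_set; last by split.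
  by rewrite subrr memNset// => -[_]; rewrite leNgt H.
rewrite memNset; last by move=> -[_]; rewrite ltNge H.
by rewrite subr0 mem_set.
Qed.

End Coefficients.
End BoundaryFunctions.

(** * Boundary values of discrete functions *)

Section BoundaryEdges.
Context {R : realType} {n : nat}.
Local Notation pt := (R * R)%type.
Local Notation leb := (@lebesgue_measure R).
Variables (P : 'I_n -> pt) (T : mesh R) (eps : R) (beta : pt -> pt).
Hypotheses (cP : convex_polygon P) (cT : conforming_triangulation P T).
Hypothesis cbeta : {within pclosed P, continuous beta}.

Lemma tame_eset (a b : pt) (e : edge T) : tame a b (\1_(eset e)).
Proof.
apply: eq_tame (tame_closed a b (@closed_segment _ (etail e) (ehead e))) => x _.
rewrite indicE; congr (_%:R); apply: congr1; apply/asboolP/idP; by rewrite inE.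
Qed.

Lemma tame_edge_at (a b : pt) (F : edge T -> pt -> R) :
  (forall e, tame a b (F e)) ->
  tame a b (fun x => if edge_at P T x is Some e then F e x else 0).
Proof.
move=> tF; rewrite /edge_at.
have H := @tame_pick _ a b _ (@eset _ T) (@boundary_edge _ _ P T)
  (fun o x => if o is Some e then F e x else 0).
apply: H.
  by move=> e; exact: closed_segment.
by move=> [e|]; [exact: tF|exact: tame_cst].
Qed.

Lemma tame_vtrace (a b : pt) (v : Vh T) : tame a b (vtrace P v).
Proof. by apply: tame_edge_at => e; exact: tame_aeval. Qed.

Lemma btame_wnormal (q : Wh T) : btame P (wnormal P q).
Proof.
move=> i; have [n1 n2] := tame_normal P (P i) (P (ordS i)).
by apply: tame_dot => //=; exact: tame_vtrace.
Qed.

Lemma btame_kappa_z : btame P (kappa_z P eps beta T).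
Proof.
move=> i; apply: tameD.
  apply: tameN; apply: tameM; first exact: tame_cst.
  by apply: (@tame_edge_at _ _ (fun e _ => C11 eps e)) => e; exact: tame_cst.
apply: tameM; first exact: btame_Gamma_minus.
by apply: tame_norm; exact: btame_beta_normal.
Qed.

Lemma boundary_edge_unique_ae : bae P (fun x => forall e e' : edge T,
  boundary_edge P e -> boundary_edge P e' -> eset e x -> eset e' x -> e = e').
Proof.
move=> i.
suff : {ae leb, forall t : R, forall ee : edge T * edge T,
    `[0, 1]%classic t -> boundary_edge P ee.1 -> boundary_edge P ee.2 ->
    eset ee.1 (seg (P i) (P (ordS i)) t) -> eset ee.2 (seg (P i) (P (ordS i)) t) ->
    ee.1 = ee.2}.
  by apply: aeS => t H t01 e e' ? ? ? ?; exact: (H (e, e')).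
apply: filter_forall => -[e e'] /=.
have [->|ee'] := eqVneq e e'; first exact: aeW.
have [[t0 [b0 b0' s0 s0']]|none] := pselect (exists t0 : R, [/\ boundary_edge P e,
  boundary_edge P e', eset e (seg (P i) (P (ordS i)) t0) &
  eset e' (seg (P i) (P (ordS i)) t0)]); last first.
  by apply: aeW => t _ ? ? ? ?; exfalso; apply: none; exists t.
exists [set t0]; split; first exact: measurable_set1.
  exact: lebesgue_measure_set1.
move=> t /= /not_implyP[_ /not_implyP[_ /not_implyP[_ /not_implyP[s /not_implyP[s' _]]]]].
apply: (seg_inj (vertex_neq cP i)).
exact: (boundary_edges_meet cP cT ee' b0 b0' s s' s0 s0').
Qed.

(** Boundary edges have only single points in common, so almost every point of the
    boundary lies on one of them at most; [edge_at] picks it. *)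
Lemma boundary_sum_ae (F : edge T -> pt -> R) : bae P (fun x =>
  \sum_(e : edge T | boundary_edge P e) \1_(eset e) x * F e x =
  if edge_at P T x is Some e then F e x else 0).
Proof.
move=> i; apply: aeS (boundary_edge_unique_ae i) => t H t01.
move: (H t01); set x := seg _ _ t => {}H.
rewrite /edge_at; case: pickP => [e /andP[be /asboolP ex]|none].
  rewrite (bigD1 e)//= indicE mem_set// mul1r big1 ?addr0// => e' /andP[be' ne].
  rewrite indicE memNset ?mul0r// => ex'.
  by move/eqP: ne; apply; exact: H.
rewrite big1// => e be; rewrite indicE memNset ?mul0r// => ex.
by have := none e; rewrite be asboolT.
Qed.

Lemma m_h1E (u : pt -> R) (r : Wh T) : L2b P u ->
  m_h1 P eps u r = bint P setT (fun x => - Num.sqrt eps * (wnormal P r x * u x)).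
Proof.
move=> Lu; rewrite /m_h1 -mulN1r -bintZ.
  by apply: eq_bint => x; ring.
have Lw := btameL2b (btame_wnormal r) Lu.
have I : bintegrable P (fun x => Num.sqrt eps * (u x * wnormal P r x)).
  apply: bintegrableZ; apply: L2b_integrable => //.
  exact: btame_L2b (btame_wnormal r).
by move: I; congr (bintegrable P _); apply/funext => x; rewrite mulrA.
Qed.

(** The penalty and the inflow term of [m_h2] together have the density [kappa_z]. *)
Lemma m_h2E (u : pt -> R) (v : Vh T) : L2b P u ->
  m_h2 P eps beta u v =
  bint P setT (fun x => kappa_z P eps beta T x * vtrace P v x * u x).
Proof.
move=> Lu.
pose F (e : edge T) x := Num.sqrt eps * C11 eps e * u x * aeval (v e.1) x.
have LF e : L2b P (F e).
  have -> : F e = (fun x => (Num.sqrt eps * C11 eps e * aeval (v e.1) x) * u x).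
    by apply/funext => x; rewrite /F mulrAC.
  apply: btameL2b => // i; apply: tameM; [exact: tame_cst|exact: tame_aeval].
have L1 : L2b P (fun=> 1) by apply: btame_L2b => i; exact: tame_cst.
have L2b_int g : L2b P g -> bintegrable P g.
  move=> Lg; have := L2b_integrable Lg L1.
  by congr (bintegrable P _); apply/funext => x; rewrite mulr1.
have LFe e : L2b P (fun x => \1_(eset e) x * F e x).
  by apply: btameL2b => // i; exact: tame_eset.
have L0 : L2b P (fun x => if edge_at P T x is Some e then F e x else 0).
  have -> : (fun x => if edge_at P T x is Some e then F e x else 0) =
    (fun x => (if edge_at P T x is Some e
       then Num.sqrt eps * C11 eps e * aeval (v e.1) x else 0) * u x).
    by apply/funext => x; case: edge_at => [e|]; [rewrite /F mulrAC|rewrite mul0r].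
  apply: btameL2b => // i; apply: (@tame_edge_at _ _
    (fun e x => Num.sqrt eps * C11 eps e * aeval (v e.1) x)) => e.
  by apply: tameM; [exact: tame_cst|exact: tame_aeval].
have LS : L2b P (fun x => \sum_(e : edge T | boundary_edge P e) \1_(eset e) x * F e x).
  under eq_fun do rewrite big_mkcond.
  apply: (@L2b_sum _ _ _ _ _ (fun e x => if boundary_edge P e
    then \1_(eset e) x * F e x else 0)) => e.
  by case: (boundary_edge P e); [exact: LFe|exact: L2b0].
have LG : L2b P (fun x => \1_(Gamma_minus P beta) x *
   (`|dot (beta x) (normal P x)| * u x * vtrace P v x)).
  have -> : (fun x => \1_(Gamma_minus P beta) x *
   (`|dot (beta x) (normal P x)| * u x * vtrace P v x)) = (fun x =>
    (\1_(Gamma_minus P beta) x * `|dot (beta x) (normal P x)| * vtrace P v x) * u x).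
    by apply/funext => x; ring.
  apply: btameL2b => // i; apply: tameM; last exact: tame_vtrace.
  apply: tameM; first exact: btame_Gamma_minus.
  by apply: tame_norm; exact: btame_beta_normal.
rewrite /m_h2.
under eq_bigr => e _ do rewrite bint_restrict.
rewrite -(bint_sum _ _ (F := fun e x => \1_(eset e) x * F e x)); last first.
  by move=> e; exact: L2b_int.
rewrite (eq_bint_ae (L2b_int _ LS) (L2b_int _ L0) (boundary_sum_ae F)).
rewrite (bint_restrict _ (Gamma_minus P beta)) -mulN1r -(bintZ _ (L2b_int _ L0)).
rewrite -(bintD (bintegrableZ _ (L2b_int _ L0)) (L2b_int _ LG)).
apply: eq_bint => x; rewrite /kappa_z /vtrace /F.
by case: (edge_at P T x) => [e|]; ring.
Qed.

End BoundaryEdges.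

(** * Linear functionals on the discrete spaces *)

Section LinearForms.
Context {R : realType}.
Local Notation pt := (R * R)%type.

Definition lin {V : lmodType R} (f : V -> R) : Prop :=
  forall c x y, f (x + c *: y) = f x + c * f y.

Lemma lin0 {V : lmodType R} : lin (fun _ : V => 0).
Proof. by move=> c x y; rewrite mulr0 addr0. Qed.

Lemma linD {V : lmodType R} (f g : V -> R) : lin f -> lin g -> lin (fun x => f x + g x).
Proof. by move=> lf lg c x y; rewrite lf lg mulrDr addrACA. Qed.

Lemma linZ {V : lmodType R} (k : R) (f : V -> R) : lin f -> lin (fun x => k * f x).
Proof. by move=> lf c x y; rewrite lf mulrDr mulrCA. Qed.

Lemma linMr {V : lmodType R} (k : R) (f : V -> R) : lin f -> lin (fun x => f x * k).
Proof. by move=> lf c x y; rewrite lf mulrDl mulrA. Qed.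

Lemma linN {V : lmodType R} (f : V -> R) : lin f -> lin (fun x => - f x).
Proof. by move=> lf c x y; rewrite lf opprD mulrN. Qed.

Lemma linB {V : lmodType R} (f : V -> R) x y : lin f -> f (x - y) = f x - f y.
Proof. by move=> lf; have := lf (-1) x y; rewrite scaleN1r mulN1r. Qed.

Lemma lin_sum {V : lmodType R} (J : Type) (s : seq J) (p : pred J) (F : J -> V -> R) :
  (forall j, p j -> lin (F j)) -> lin (fun x => \sum_(j <- s | p j) F j x).
Proof.
move=> lF c x y; rewrite mulr_sumr -big_split; apply: eq_bigr => j pj.
exact: lF.
Qed.

Lemma lin_Rintegral {V : lmodType R} d (X : measurableType d)
    (mu : {measure set X -> \bar R}) (D : set X) (F : V -> X -> R) :
  measurable D -> (forall v, mu.-integrable D (EFin \o F v)) ->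
  (forall x, D x -> lin (fun v => F v x)) ->
  lin (fun v => \int[mu]_(x in D) F v x).
Proof.
move=> mD iF lF c v w.
rewrite -RintegralZl// -RintegralD//; last exact: (integrableZl mD c (iF w)).
by apply: eq_Rintegral => x /[!inE] Dx; exact: lF.
Qed.

Lemma lin_line_int {V : lmodType R} (a b : pt) (F : V -> pt -> R) :
  (forall v, tame a b (F v)) ->
  (forall x, segment a b x -> lin (fun v => F v x)) ->
  lin (fun v => line_int a b setT (F v)).
Proof.
move=> tF lF c v w; rewrite !line_intE.
have H : lin (fun v => \int[lebesgue_measure]_(t in unit_itv) F v (seg a b t)).
  apply: lin_Rintegral; first exact: measurable_unit_itv.
    by move=> v'; exact: tame_integrable (tF v').
  by move=> t t01; apply: lF; exists t.
by rewrite H mulrDr mulrCA.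
Qed.

Lemma lin_aeval (x : pt) : lin (fun p : 'rV[R]_3 => aeval p x).
Proof. by move=> c p q; rewrite /aeval !mxE; ring. Qed.

Context {n : nat} (P : 'I_n -> pt) (T : mesh R).

Lemma lin_aeval_cell (x : pt) K : lin (fun v : Vh T => aeval (v K) x).
Proof. by move=> c v w; rewrite !ffunE; exact: lin_aeval. Qed.

Lemma lin_agrad_cell K :
  lin (fun v : Vh T => (agrad (v K)).1) /\ lin (fun v : Vh T => (agrad (v K)).2).
Proof. by split=> c v w; rewrite /agrad/= !ffunE !mxE. Qed.

Lemma lin_fst (f : Vh T -> R) : lin f -> lin (fun q : Wh T => f q.1).
Proof. by move=> lf c v w; exact: lf. Qed.

Lemma lin_snd (f : Vh T -> R) : lin f -> lin (fun q : Wh T => f q.2).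
Proof. by move=> lf c v w; exact: lf. Qed.

Lemma lin_vfun (x : pt) : lin (fun v : Vh T => vfun v x).
Proof.
by apply: lin_sum => K _; apply: linZ; exact: lin_aeval_cell.
Qed.

Lemma lin_vtrace (x : pt) : lin (fun v : Vh T => vtrace P v x).
Proof.
by rewrite /vtrace; case: edge_at => [e|]; [exact: lin_aeval_cell|exact: lin0].
Qed.

Lemma lin_wdiv K : lin (fun r : Wh T => wdiv r K).
Proof.
have [l1 l2] := lin_agrad_cell K.
by apply: linD; [exact: lin_fst l1|exact: lin_snd l2].
Qed.

Lemma lin_avg e e' (x : pt) : lin (fun v : Vh T => avg v e e' x).
Proof. by apply: linZ; apply: linD; exact: lin_aeval_cell. Qed.

Lemma dot_jump (c : pt) (v : Vh T) e e' (x : pt) : dot c (jump v e e' x) =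
  aeval (v e.1) x * dot c (enormal e) + aeval (v e'.1) x * dot c (enormal e').
Proof.
rewrite /jump /dot /pscale/=; ring.
Qed.

Lemma lin_dot_jump (c : pt) e e' (x : pt) : lin (fun v : Vh T => dot c (jump v e e' x)).
Proof.
have -> : (fun v : Vh T => dot c (jump v e e' x)) = (fun v => aeval (v e.1) x *
    dot c (enormal e) + aeval (v e'.1) x * dot c (enormal e')).
  by apply/funext => v; exact: dot_jump.
by apply: linD; apply: linMr; exact: lin_aeval_cell.
Qed.

Lemma dotC (a b : pt) : dot a b = dot b a.
Proof. by rewrite /dot (mulrC a.1) (mulrC a.2). Qed.

Lemma lin_wjump e e' (x : pt) : lin (fun r : Wh T => wjump r e e' x).
Proof.
rewrite /wjump/dot/weval/=.
have l1 K := lin_fst (lin_aeval_cell x K).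
have l2 K := lin_snd (lin_aeval_cell x K).
exact: (linD (linD (linMr _ (l1 _)) (linMr _ (l2 _)))
             (linD (linMr _ (l1 _)) (linMr _ (l2 _)))).
Qed.

End LinearForms.

(** * Integrals over triangles *)

Section CellIntegrals.
Context {R : realType} {n : nat}.
Local Notation pt := (R * R)%type.
Local Notation mpt := (@mpt R).
Local Notation leb2 := (@lebesgue2 R).

Lemma closed_pclosed m (Q : 'I_m -> pt) : closed (pclosed Q).
Proof.
have -> : pclosed Q = \bigcap_(i in [set: 'I_m])
    (aff3 (edge_aff (Q i) (Q (ordS i) - Q i)) @^-1` [set t | 0 <= t]).
  apply/seteqP; split=> x H; first by move=> i _ /=; rewrite aff3_edge; exact: H.
  by move=> i; have := H i I; rewrite /= aff3_edge.
apply: closed_bigI => i _; apply: closed_comp; last exact: closed_ge.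
by move=> x _; exact: continuous_affine.
Qed.

Lemma measurable_pclosed m (Q : 'I_m -> pt) : measurable (pclosed Q : set mpt).
Proof. by apply: closed_measurable2; exact: closed_pclosed. Qed.

Variables (P : 'I_n -> pt).
Hypothesis cP : convex_polygon P.
Local Notation Omega := (popen P).
Let mO := measurable_popen P.

(** The difference lies in finitely many lines. *)
Lemma polygon_boundary_null : leb2.-negligible (pclosed P `\` popen P : set mpt).
Proof.
pose l (i : 'I_n) := edge_aff (P i) (P (ordS i) - P i).
pose F k := if insub k is Some i then line (l i).1.1 (l i).1.2 (l i).2 else set0.
apply: (@negligibleS _ _ _ leb2 (\bigcup_k F k)).
  move=> x [Px nOx].
  have [i] : exists i, ~ 0 < cross (P (ordS i) - P i) (x - P i) by apply/existsNP.
  move/negP; rewrite -leNgt => le0.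
  exists (val i) => //; rewrite /F valK.
  rewrite /line/=; transitivity (aff3 (l i) x) => //.
  by rewrite aff3_edge; apply/eqP; rewrite eq_le le0 Px.
apply: negligible_bigcup => k; rewrite /F; case: insub => [i|]; last exact: negligible_set0.
exists (line (l i).1.1 (l i).1.2 (l i).2); split=> //.
  exact: measurable_line.
have rot (d : pt) : d != 0 -> (- d.2, d.1) != (0, 0).
  apply: contra; rewrite xpair_eqE oppr_eq0; case: d => d1 d2 /=.
  by move=> /andP[/eqP -> /eqP ->].
exact: lebesgue2_line (rot _ (side_vec_neq0 cP i)).
Qed.

Variables (T : mesh R).
Hypothesis cT : conforming_triangulation P T.
Let Ofin := domain_finite_measure cT.

Definition cell_in K : set pt := pclosed (T K) `&` Omega.

Lemma measurable_cell_in K : measurable (cell_in K : set mpt).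
Proof. by apply: measurableI => //; exact: measurable_pclosed. Qed.

(** Data are given on the open domain only; the part of a closed triangle on its
    boundary is null and the integral ignores it, whatever the integrand. *)
Lemma cell_integralE K (F : pt -> R) :
  \int[leb2]_(x in pclosed (T K)) F x = \int[leb2]_(x in cell_in K) F x.
Proof.
have mN : measurable (pclosed (T K) `\` Omega : set mpt).
  by apply: measurableD => //; exact: measurable_pclosed.
have N0 : leb2 (pclosed (T K) `\` Omega) = 0%E.
  apply: measure_negligible => //; apply: negligibleS polygon_boundary_null.
  by move=> x [Kx nOx]; split=> //; exact: triangle_sub Kx.
rewrite /Rintegral (@integral_setD_null _ _ _ leb2 (pclosed (T K)) _ _ mN N0).
congr (fine (integral _ _ _)); rewrite /cell_in setDD.
by [].
Qed.

Lemma L2_cell (S : set pt) K (p : 'rV[R]_3) : measurable (S : set mpt) ->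
  S `<=` pclosed (T K) -> L2 P (fun x => \1_S x * aeval p x).
Proof.
move=> mS SK; have [M HM] := triangle_bounded (triangle_convex cT K).
apply: (L2_bounded Ofin (M := `|p 0 0| + `|p 0 1| * M + `|p 0 2| * M)).
  apply: measurable_funM; first by apply: measurable_indic.
  apply: (@eq_measurable_fun _ _ _ _ _ (fun x : mpt => p 0 1 * x.1 + p 0 2 * x.2 + p 0 0)).
    by move=> x _; rewrite /aeval; ring.
  by apply: measurable_funTS; exact: measurable_affine.
move=> x _; rewrite indicE; have [Sx|nSx] := boolP (x \in S); last first.
  rewrite mul0r normr0.
  have M0 : 0 <= M.
    have [h1 _] := HM _ (pclosed_vertex (triangle_convex cT K) ord0).
    exact: le_trans (normr_ge0 _) h1.
  by rewrite !addr_ge0// mulr_ge0.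
rewrite mul1r /aeval; rewrite inE in Sx.
have [h1 h2] := HM _ (SK _ Sx).
apply: le_trans (ler_normD _ _) _; apply: lerD; last by rewrite normrM ler_wpM2l.
by apply: le_trans (ler_normD _ _) _; apply: lerD => //; rewrite normrM ler_wpM2l.
Qed.

Lemma L2_vfun (v : Vh T) : L2 P (vfun v).
Proof.
apply: (@sqint_sum _ _ _ leb2 Omega mO _ _
  (fun K x => \1_(popen (T K)) x * aeval (v K) x)) => K.
apply: (@L2_cell _ K); first exact: measurable_popen.
by move=> x Kx i; exact: ltW (Kx i).
Qed.

Lemma cell_in_integrable K (f : pt -> R) (p : 'rV[R]_3) : L2 P f ->
  leb2.-integrable (cell_in K) (fun x => (f x * aeval p x)%:E).
Proof.
move=> Lf; have mK := measurable_pclosed (T K).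
have I := L2_integrable Lf (L2_cell p mK (@subset_refl _ _)).
have : leb2.-integrable (cell_in K) (fun x => (f x * (\1_(pclosed (T K)) x * aeval p x))%:E).
  by apply: integrableS I => //; [exact: measurable_cell_in|exact: subIsetr].
apply: eq_integrable; first exact: measurable_cell_in.
by move=> x /[!inE] -[Kx _]; rewrite indicE mem_set// mul1r.
Qed.

Lemma L2_cst (c : R) : L2 P (fun=> c).
Proof. by apply: (L2_bounded Ofin (M := `|c|)). Qed.

Lemma lin_cell {V : lmodType R} K (F : V -> pt -> R) :
  (forall v, leb2.-integrable (cell_in K) (EFin \o F v)) ->
  (forall x, lin (fun v => F v x)) ->
  lin (fun v => \int[leb2]_(x in pclosed (T K)) F v x).
Proof.
move=> iF lF c v w; rewrite !cell_integralE.
exact: (lin_Rintegral (measurable_cell_in K) iF (fun x _ => lF x)).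
Qed.

End CellIntegrals.

(** * Linearity of the discrete forms *)

Section Forms.
Context {R : realType} {n : nat}.
Local Notation pt := (R * R)%type.
Local Notation leb2 := (@lebesgue2 R).
Variables (P : 'I_n -> pt) (T : mesh R).
Hypotheses (cP : convex_polygon P) (cT : conforming_triangulation P T).
Local Notation Omega := (popen P).
Let mO := measurable_popen P.
Variables (eps : R) (beta : pt -> pt) (alpha : pt -> R).
Variables (C12 D11 : edge T -> pt -> pt) (v0 : pt).
Hypothesis cbeta : {within pclosed P, continuous beta}.
Hypotheses (b1 : Linf P (fun x => (beta x).1)) (b2 : Linf P (fun x => (beta x).2)).
Hypothesis alphab : Linf P alpha.
Hypotheses (hC : C12_spec C12 v0) (hD : D11_spec beta D11).

Lemma lin_a_h (r : Wh T) : lin (fun q => a_h P q r).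
Proof.
apply: lin_Rintegral => // [q|x _]; last first.
  apply: linD; apply: linMr.
    exact: (lin_fst (lin_vfun x)).
  exact: (lin_snd (lin_vfun x)).
have L v : L2 P (@vfun R T v) by exact: L2_vfun.
have := integrableD mO (L2_integrable (L q.1) (L r.1)) (L2_integrable (L q.2) (L r.2)).
exact.
Qed.

Lemma a_hC (q r : Wh T) : a_h P q r = a_h P r q.
Proof. by apply: eq_Rintegral => x _; exact: dotC. Qed.

(** [C] is known through its normal component only.  That is enough: a jump is a
    combination of the two normals of the edge, and these are parallel. *)
Lemma tame_coef (C : edge T -> pt -> pt) (w : pt -> R) (e e' : edge T) (y : Vh T) :
  interior_edge e e' ->
  tame (etail e) (ehead e) w ->
  (forall x, eset e x -> dot (C e x) (enormal e) = w x) ->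
  tame (etail e) (ehead e) (fun x => dot (C e x) (jump y e e' x)).
Proof.
move=> /andP[_ /asboolP E] tw Cw; have [c nc] := common_edge_normal cT E.
have t1 := tameM (tame_aeval (etail e) (ehead e) (y e.1)) tw.
have t2 := tameM (tame_aeval (etail e) (ehead e) (y e'.1)) (tameM (tame_cst _ _ c) tw).
apply: eq_tame (tameD t1 t2) => x ex.
rewrite dot_jump nc -(Cw x ex); congr (_ + _ * _).
by rewrite /dot/pscale/=; ring.
Qed.

Let sub_e (e : edge T) : segment (etail e) (ehead e) `<=` pclosed P.
Proof. exact: eset_pclosed. Qed.

Lemma tame_C12 e e' (y : Vh T) : interior_edge e e' ->
  tame (etail e) (ehead e) (fun x => dot (C12 e x) (jump y e e' x)).
Proof.
move=> ee'; apply: (tame_coef y ee' (tame_cst _ _ (2^-1 * Num.sg (dot (enormal e) v0)))).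
by move=> x ex; exact: hC ee' ex.
Qed.

Lemma tame_D11 e e' (y : Vh T) : interior_edge e e' ->
  tame (etail e) (ehead e) (fun x => dot (D11 e x) (jump y e e' x)).
Proof.
move=> ee'; apply: (tame_coef (w := fun x => 2^-1 * Num.sg (dot (enormal e) (beta x))) y ee').
  apply: tameM; first exact: tame_cst.
  by apply: tame_sg; exact: (tame_dot_beta cbeta _ (@sub_e e)).
by move=> x ex; exact: hD ee' ex.
Qed.

Lemma tame_avg (a b : pt) e e' (y : Vh T) : tame a b (avg y e e').
Proof.
by apply: tameM; [exact: tame_cst|apply: tameD; exact: tame_aeval].
Qed.

Lemma tame_jump (a b : pt) e e' (y : Vh T) :
  tame a b (fun x => (jump y e e' x).1) /\ tame a b (fun x => (jump y e e' x).2).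
Proof.
by split; apply: tameD; apply: tameM; do [exact: tame_aeval|exact: tame_cst].
Qed.

Lemma tame_wjump (a b : pt) e e' (r : Wh T) : tame a b (wjump r e e').
Proof.
apply: tameD; apply: tame_dot; rewrite /weval/=;
  do [exact: tame_aeval|exact: tame_cst].
Qed.

Lemma lin_edges (V : lmodType R) (F : V -> edge T -> edge T -> pt -> R) :
  (forall y e e', interior_edge e e' -> tame (etail e) (ehead e) (F y e e')) ->
  (forall e e' x, lin (fun y => F y e e' x)) ->
  lin (fun y => \sum_(e : edge T) \sum_(e' : edge T | interior_edge e e')
     edge_int e (F y e e')).
Proof.
move=> tF lF; apply: lin_sum => e _; apply: lin_sum => e' ee'.
by apply: lin_line_int => [y|x _]; [exact: tF|exact: lF].
Qed.

Lemma b_h_cell_integrable K (y : Vh T) (r : Wh T) : leb2.-integrable (cell_in P K)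
  (EFin \o (fun x => Num.sqrt eps * aeval (y K) x * wdiv r K)).
Proof.
have := cell_in_integrable cT K (y K) (L2_cst cT (Num.sqrt eps * wdiv r K)).
apply: eq_integrable; first exact: measurable_cell_in.
by move=> x _ /=; rewrite mulrAC.
Qed.

Lemma tame_b_h (y : Vh T) (r : Wh T) e e' : interior_edge e e' ->
  tame (etail e) (ehead e) (fun x => Num.sqrt eps
        * (avg y e e' x + dot (C12 e x) (jump y e e' x)) * wjump r e e' x).
Proof.
move=> ee'; apply: tameM; last exact: tame_wjump.
apply: tameM; first exact: tame_cst.
by apply: tameD; [exact: tame_avg|exact: tame_C12].
Qed.

Lemma lin_b_h_left (r : Wh T) : lin (fun y => b_h eps C12 y r).
Proof.
apply: linD.
  apply: linN; apply: lin_sum => K _; apply: (lin_cell cP cT) => [y|x].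
    exact: b_h_cell_integrable.
  by apply: linMr; apply: linZ; exact: lin_aeval_cell.
apply: lin_edges => [y e e' ee'|e e' x]; first exact: tame_b_h.
apply: linMr; apply: linZ; apply: linD; first exact: lin_avg.
exact: lin_dot_jump.
Qed.

Lemma lin_b_h_right (y : Vh T) : lin (fun r => b_h eps C12 y r).
Proof.
apply: linD.
  apply: linN; apply: lin_sum => K _; apply: (lin_cell cP cT) => [r|x].
    exact: b_h_cell_integrable.
  by apply: linZ; exact: lin_wdiv.
apply: (@lin_edges _ (fun r e e' x => Num.sqrt eps
        * (avg y e e' x + dot (C12 e x) (jump y e e' x)) * wjump r e e' x))
  => [r e e' ee'|e e' x]; first exact: tame_b_h.
by apply: linZ; exact: lin_wjump.
Qed.

Lemma c_h_cell_integrable K (y v : Vh T) : leb2.-integrable (cell_in P K)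
  (EFin \o (fun x => alpha x * aeval (y K) x * aeval (v K) x
      - aeval (y K) x * dot (beta x) (agrad (v K)))).
Proof.
have mK := measurable_pclosed (T K).
have Lb : L2 P (fun x => dot (beta x) (agrad (v K))).
  exact: (L2D (L2_LinfM b1 (L2_cst cT (agrad (v K)).1))
              (L2_LinfM b2 (L2_cst cT (agrad (v K)).2))).
have La : L2 P (fun x => alpha x * (\1_(pclosed (T K)) x * aeval (v K) x)).
  exact: (L2_LinfM alphab (L2_cell cT (v K) mK (@subset_refl _ _))).
have mc := measurable_cell_in P K.
have I1 := cell_in_integrable cT K (y K) La.
have I2 := cell_in_integrable cT K (y K) Lb.
have := integrableB mc I1 I2; apply: eq_integrable => //.
move=> x /[!inE] -[Kx _] /=; rewrite -EFinD indicE mem_set// mul1r; congr EFin.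
by ring.
Qed.

Lemma lin_bint (V : lmodType R) (A : set pt) (F : V -> pt -> R) :
  btame P (\1_A) -> (forall y, btame P (F y)) -> (forall x, lin (fun y => F y x)) ->
  lin (fun y => bint P A (F y)).
Proof.
move=> tA tF lF; have H : lin (fun y => bint P setT (fun x => \1_A x * F y x)).
  apply: lin_sum => i _; apply: (@lin_line_int _ _ _ _ (fun y x => \1_A x * F y x)).
    by move=> y; apply: tameM; [exact: tA|exact: tF].
  by move=> x _; apply: linZ; exact: lF.
by move=> c y y'; rewrite !(bint_restrict _ A); exact: H.
Qed.

Lemma lin_c_h (v : Vh T) : lin (fun y => c_h P eps beta alpha D11 y v).
Proof.
apply: linD; last first.
  apply: linN; apply: lin_sum => e _; apply: lin_bint.
  - by move=> i; exact: tame_eset.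
  - move=> y i; apply: tameM; last exact: tame_aeval.
    by apply: tameM; [exact: tame_cst|exact: tame_aeval].
  - by move=> x; apply: linMr; apply: linZ; exact: lin_aeval_cell.
apply: linD; last first.
  apply: lin_bint.
  - exact: btame_Gamma_plus.
  - move=> y i; apply: tameM; last exact: tame_vtrace.
    apply: tameM; last exact: tame_vtrace.
    by apply: eq_tame (btame_beta_normal cbeta cP i) => x _; exact: dotC.
  - by move=> x; apply: linMr; apply: linZ; exact: lin_vtrace.
apply: linD; last first.
  apply: linN.
  apply: (@lin_edges _ (fun y e e' x =>
      Num.sqrt eps * C11 eps e * dot (jump y e e' x) (jump v e e' x)))
    => [y e e' ee'|e e' x].
    apply: tameM; first exact: tame_cst.
    have [j1 j2] := tame_jump (etail e) (ehead e) e e' y.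
    have [k1 k2] := tame_jump (etail e) (ehead e) e e' v.
    exact: tame_dot.
  apply: linZ => c y y'; rewrite ![dot (jump _ e e' x) (jump v e e' x)]dotC.
  exact: lin_dot_jump.
apply: linD.
  apply: lin_sum => K _.
  apply: (lin_cell cP cT (F := fun (y : Vh T) x => alpha x * aeval (y K) x * aeval (v K) x
      - aeval (y K) x * dot (beta x) (agrad (v K)))) => [y|x].
    exact: c_h_cell_integrable.
  apply: linD; first by apply: linMr; apply: linZ; exact: lin_aeval_cell.
  by apply: linN; apply: linMr; exact: lin_aeval_cell.
apply: (@lin_edges _ (fun y e e' x => (avg y e e' x + dot (D11 e x) (jump y e e' x))
        * dot (beta x) (jump v e e' x))) => [y e e' ee'|e e' x].
  apply: tameM; first by apply: tameD; [exact: tame_avg|exact: tame_D11].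
  have [be1 be2] := tame_beta cbeta (@sub_e e).
  have [k1 k2] := tame_jump (etail e) (ehead e) e e' v.
  exact: tame_dot.
apply: linMr; apply: linD; first exact: lin_avg.
exact: lin_dot_jump.
Qed.

End Forms.

(** * The continuous variational inequality *)

Lemma very_weak_affine_arith (R : realFieldType) (eps t F bu bw a1 a2 a3 c1 c2 c3 : R) :
  - eps * c1 - c2 + c3 = F - eps * bw ->
  - eps * a1 - a2 + a3 = F - eps * bu ->
  - eps * (a1 + t * (c1 - a1)) - (a2 + t * (c2 - a2)) + (a3 + t * (c3 - a3)) =
  F - eps * (bu + t * (bw - bu)).
Proof.
move=> Hw Hu.
transitivity ((1 - t) * (- eps * a1 - a2 + a3) + t * (- eps * c1 - c2 + c3)); first by ring.
by rewrite Hw Hu; ring.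
Qed.

Lemma variational_arith (R : realFieldType) (eps F bu bw a1 a2 a3 c1 c2 c3 Q : R) :
  - eps * c1 - c2 + c3 = F - eps * bw ->
  - eps * a1 - a2 + a3 = F - eps * bu ->
  0 <= - eps * (c1 - a1) - (c2 - a2) + (c3 - a3) + Q ->
  0 <= - eps * (bw - bu) + Q.
Proof.
move=> Hw Hu.
have -> : - eps * (c1 - a1) - (c2 - a2) + (c3 - a3) =
  (- eps * c1 - c2 + c3) - (- eps * a1 - a2 + a3) by ring.
rewrite Hw Hu; congr (0 <= _ + Q); ring.
Qed.

(** If the linear term were negative, the value at [t = - G / (Q - G)] would be too. *)
Lemma first_order_ge0 (R : realFieldType) (G Q : R) : 0 <= Q ->
  (forall t, 0 < t <= 1 -> 0 <= t * G + t ^+ 2 / 2 * Q) -> 0 <= G.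
Proof.
move=> Q0 H; rewrite leNgt; apply/negP => G0.
have QG : 0 < Q - G by lra.
have t0 : 0 < - G / (Q - G) by rewrite divr_gt0 ?oppr_gt0.
have t1 : - G / (Q - G) <= 1 by rewrite ler_pdivrMr// mul1r; lra.
have := H _ (introT andP (conj t0 t1)).
have -> : forall t : R, t * G + t ^+ 2 / 2 * Q = t * (G + t * Q / 2) by move=> t; field.
rewrite pmulr_rge0//; apply/negP; rewrite -ltNge.
have -> : G + - G / (Q - G) * Q / 2 = G * (Q - 2 * G) / (2 * (Q - G)).
  by field; rewrite gt_eqF.
rewrite pmulr_llt0 ?invr_gt0 ?mulr_gt0// pmulr_llt0//; lra.
Qed.

Section VariationalInequality.
Context {R : realType} {n : nat}.
Local Notation pt := (R * R)%type.
Variables (P : 'I_n -> pt) (omega ua ub : R) (yd : pt -> R).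
Hypotheses (omega0 : 0 < omega) (Lyd : L2 P yd).

Lemma admissible_convex (u w : pt -> R) (t : R) : 0 <= t <= 1 ->
  admissible P ua ub u -> admissible P ua ub w ->
  admissible P ua ub (fun x => u x + t * (w x - u x)).
Proof.
move=> /andP[t0 t1] [Lu au] [Lw aw]; split.
  by apply: L2bD => //; apply: L2bZ; exact: L2bB.
move=> i; apply: aeS2 (au i) (aw i) => r ur wr r01.
have /andP[u1 u2] := ur r01; have /andP[w1 w2] := wr r01.
move: u1 u2 w1 w2; set a := u _; set b := w _ => u1 u2 w1 w2.
have -> : a + t * (b - a) = (1 - t) * a + t * b by ring.
have s0 : 0 <= 1 - t by rewrite subr_ge0.
have := ler_wpM2l s0 u1; have := ler_wpM2l s0 u2.
have := ler_wpM2l t0 w1; have := ler_wpM2l t0 w2.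
by move=> h1 h2 h3 h4; apply/andP; split; lra.
Qed.

Lemma ip_quad (a d : pt -> R) (t : R) : L2 P a -> L2 P d ->
  ip P (fun x => a x + t * d x) (fun x => a x + t * d x) =
  ip P a a + 2 * t * ip P a d + t ^+ 2 * ip P d d.
Proof.
move=> La Ld; have Ltd := L2Z t Ld.
rewrite (ipDl La Ltd (L2D La Ltd)) (ipDr La Ltd La) (ipDr La Ltd Ltd).
rewrite (ipZl _ Ld La) (ipZl _ Ld Ltd) (ipZr _ Ld La) (ipZr _ Ld Ld) (ipC P d a).
by move: (ip P a a) (ip P a d) (ip P d d) => *; ring.
Qed.

Lemma bint_quad (a d : pt -> R) (t : R) : L2b P a -> L2b P d ->
  bint P setT (fun x => (a x + t * d x) ^+ 2) =
  bint P setT (fun x => a x ^+ 2) + 2 * t * bint P setT (fun x => a x * d x)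
  + t ^+ 2 * bint P setT (fun x => d x ^+ 2).
Proof.
move=> La Ld.
have sq g : L2b P g -> bintegrable P (fun x => g x ^+ 2).
  by move=> Lg; exact: (L2b_integrable Lg Lg).
have I1 := sq _ La; have I2 := sq _ Ld; have I3 := L2b_integrable La Ld.
rewrite -(bintZ _ I3) -(bintZ _ I2).
rewrite -(bintD I1 (bintegrableZ _ I3)).
rewrite -(bintD (bintegrableD I1 (bintegrableZ _ I3)) (bintegrableZ _ I2)).
by apply: eq_bint => x; ring.
Qed.

(** As the state is affine in the control, the cost at [u + t (w - u)] is a quadratic
    polynomial of [t], minimal at 0 on the unit interval. *)
Lemma minimizer_first_order (Y : (pt -> R) -> pt -> R) (u w : pt -> R) :
  (forall v, admissible P ua ub v -> L2 P (Y v)) ->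
  minimizer P ua ub (fun v => cost P omega yd (Y v) v) u ->
  admissible P ua ub w ->
  (forall t, 0 <= t <= 1 -> dae P (fun x =>
     Y (fun x => u x + t * (w x - u x)) x = Y u x + t * (Y w x - Y u x))) ->
  0 <= ip P (fun x => Y u x - yd x) (fun x => Y w x - Y u x)
       + omega * bint P setT (fun x => u x * (w x - u x)).
Proof.
move=> LY [au umin] aw Yaff.
have Lu : L2b P u by case: au.
have Lw : L2b P w by case: aw.
have Le := L2bB Lw Lu; have Ld := L2B (LY _ aw) (LY _ au).
have La := L2B (LY _ au) Lyd.
set d := fun x => Y w x - Y u x in Ld *.
set a := fun x => Y u x - yd x in La *.
set e := fun x => w x - u x in Le *.
apply: (@first_order_ge0 _ _ (ip P d d + omega * bint P setT (fun x => e x ^+ 2))).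
  rewrite addr_ge0 ?ip_ge0// mulr_ge0 ?(ltW omega0)//.
  by apply: bint_ge0 => x; exact: sqr_ge0.
move=> t /andP[t0 t1]; have t01 : 0 <= t <= 1 by rewrite ltW.
have aut := admissible_convex t01 au aw.
have := umin _ aut; rewrite /cost !norm_sq !normb_sq (bint_quad t Lu Le).
have Lut := L2B (LY _ aut) Lyd.
have Lat := L2D La (L2Z t Ld).
have E : dae P (fun x => Y (fun x => u x + t * (w x - u x)) x - yd x = a x + t * d x).
  by apply: aeS (Yaff t t01) => x H Ox; rewrite H// /a/d; ring.
rewrite (ip_ae_eq Lut Lat Lut E) (ipC P (fun x => a x + _)).
rewrite (ip_ae_eq Lut Lat Lat E) (ip_quad t La Ld).
rewrite -/a; move: (ip P a a) (ip P a d) (ip P d d).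
move: (bint P _ _) (bint P _ _) (bint P _ _); clear.
move=> uu ue ee aa ad dd H; lra.
Qed.

End VariationalInequality.

Section ContinuousOptimality.
Context {R : realType} {n : nat}.
Local Notation pt := (R * R)%type.
Local Notation leb2 := (@lebesgue2 R).
Variables (P : 'I_n -> pt) (eps omega ua ub : R) (beta : pt -> pt).
Variables (alpha f yd : pt -> R).
Hypothesis Ofin : (leb2 (popen P) < +oo)%E.
Hypotheses (eps0 : 0 < eps) (omega0 : 0 < omega).
Hypotheses (b1 : Linf P (fun x => (beta x).1)) (b2 : Linf P (fun x => (beta x).2)).
Hypothesis (divb : is_wdiv P beta (fun=> 0)).
Hypotheses (alphab : Linf P alpha) (Lyd : L2 P yd).
Hypothesis wp : state_well_posed P eps beta alpha f.
Local Notation y := (state P eps beta alpha f).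

Lemma state_solution u : L2b P u -> very_weak_solution P eps beta alpha f u (y u).
Proof.
move=> Lu; have [y0 [y0s _]] := wp Lu.
by apply: (@xgetPex _ _ (very_weak_solution P eps beta alpha f u)); exists y0.
Qed.

Lemma state_L2 u : L2b P u -> L2 P (y u).
Proof. by move=> /state_solution[]. Qed.

Let xex : @ex R = ex \/ @ex R = ey. Proof. by left. Qed.
Let yey : @ey R = ex \/ @ey R = ey. Proof. by right. Qed.

Lemma laplacian_L2 v : H2 P v -> L2 P (laplacian P v).
Proof.
move=> [_ [Hx Hy]]; have [Lxx _] := H1_wderiv xex Hx.
by have [Lyy _] := H1_wderiv yey Hy; exact: L2D.
Qed.

Lemma very_weak_affine u w yu yw t : L2b P u -> L2b P w ->
  very_weak_solution P eps beta alpha f u yu ->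
  very_weak_solution P eps beta alpha f w yw ->
  very_weak_solution P eps beta alpha f (fun x => u x + t * (w x - u x))
    (fun x => yu x + t * (yw x - yu x)).
Proof.
move=> Lu Lw [Lyu Eu] [Lyw Ew]; have Ld := L2B Lyw Lyu.
split; first by apply: L2D => //; exact: L2Z.
move=> v H2v H10v; have := Eu v H2v H10v; have := Ew v H2v H10v.
have Hv : H1 P v by case: H2v.
have Lv : L2 P v by case: Hv.
have Llap := laplacian_L2 H2v.
have Lconv := L2_convection b1 b2 Hv.
have Ltd := L2Z t Ld.
have S k : L2 P k -> ip P (fun x => yu x + t * (yw x - yu x)) k =
   ip P yu k + t * (ip P yw k - ip P yu k).
  by move=> Lk; rewrite (ipDl Lyu Ltd Lk) (ipZl _ Ld Lk) (ipBl Lyw Lyu Lk).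
have Sa g : L2 P g -> ip P (fun x => alpha x * g x) v = ip P g (fun x => alpha x * v x).
  by move=> _; apply: eq_Rintegral => x _; rewrite -mulrA mulrCA.
have Lav := L2_LinfM alphab Lv.
rewrite (Sa _ Lyw) (Sa _ Lyu) (Sa _ (L2D Lyu Ltd)).
rewrite (S _ Llap) (S _ Lconv) (S _ Lav).
have Ldn := dnormal_L2b P v.
have B : bint P setT (fun x => (u x + t * (w x - u x)) * dnormal P v x) =
   bint P setT (fun x => u x * dnormal P v x) +
   t * (bint P setT (fun x => w x * dnormal P v x)
        - bint P setT (fun x => u x * dnormal P v x)).
  have Iu := L2b_integrable Lu Ldn; have Iw := L2b_integrable Lw Ldn.
  have -> : (fun x => (u x + t * (w x - u x)) * dnormal P v x) =
    (fun x => (u x * dnormal P v x) + t * (w x * dnormal P v x + -1 * (u x * dnormal P v x))).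
    by apply/funext => x; rewrite mulrDl -mulrA mulrBl mulN1r.
  have Imu := bintegrableZ (-1) Iu; have Iwu := bintegrableD Iw Imu.
  by rewrite (bintD Iu (bintegrableZ t Iwu)) (bintZ _ Iwu) (bintD Iw Imu) (bintZ _ Iu) mulN1r.
by rewrite B => Hw Hu; exact: (very_weak_affine_arith t Hw Hu).
Qed.

Lemma state_affine u w t : L2b P u -> L2b P w -> dae P (fun x =>
  y (fun x => u x + t * (w x - u x)) x = y u x + t * (y w x - y u x)).
Proof.
move=> Lu Lw; pose ut x := u x + t * (w x - u x).
have Lut : L2b P ut by apply: L2bD => //; apply: L2bZ; exact: L2bB.
have [y0 [_ uniq]] := wp Lut.
have E1 := uniq _ (state_solution Lut).
have E2 := uniq _ (very_weak_affine t Lu Lw (state_solution Lu) (state_solution Lw)).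
by apply: aeS2 E1 E2 => x H1 H2 Ox; rewrite H1// H2.
Qed.

(** The very weak equation of the state difference, tested with [z], replaces the
    derivative of the tracking term by a boundary integral. *)
Lemma continuous_variational_inequality u w z :
  minimizer P ua ub (reduced_cost P eps omega beta alpha f yd) u ->
  admissible P ua ub w ->
  adjoint_solution P eps beta alpha (fun x => y u x - yd x) z ->
  0 <= - eps * bint P setT (fun x => (w x - u x) * dnormal P z x)
       + omega * bint P setT (fun x => u x * (w x - u x)).
Proof.
move=> umin aw Hz; have [Lu _] := umin.1; have [Lw _] := aw.
have := minimizer_first_order omega0 Lyd
  (fun v (av : admissible P ua ub v) => state_L2 av.1) umin aw
  (fun t _ => state_affine t Lu Lw).
have Lyu := state_L2 Lu; have Lyw := state_L2 Lw.
have Ld := L2B Lyw Lyu.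
rewrite -(adjoint_test Ofin eps0 b1 b2 divb alphab (L2B Lyu Lyd) Ld Hz).
have [_ Eu] := state_solution Lu; have [_ Ew] := state_solution Lw.
have [H2z H10z _ _] := Hz.
have := Eu z H2z H10z; have := Ew z H2z H10z.
have Hzz : H1 P z by case: H2z.
have Lz : L2 P z by case: Hzz.
have Llap := laplacian_L2 H2z.
have Lconv := L2_convection b1 b2 Hzz.
have Lau := L2_LinfM alphab Lyu; have Law := L2_LinfM alphab Lyw.
rewrite (ipBl Lyw Lyu Llap) (ipBl Lyw Lyu Lconv).
have -> : ip P (fun x => alpha x * (y w x - y u x)) z =
    ip P (fun x => alpha x * y w x) z - ip P (fun x => alpha x * y u x) z.
  rewrite -(ipBl Law Lau Lz); apply: eq_Rintegral => x _.
  by rewrite mulrBr.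
have Ldn := dnormal_L2b P z.
have -> : bint P setT (fun x => (w x - u x) * dnormal P z x) =
   bint P setT (fun x => w x * dnormal P z x) - bint P setT (fun x => u x * dnormal P z x).
  have Iu := L2b_integrable Lu Ldn; have Iw := L2b_integrable Lw Ldn.
  rewrite -[X in _ = _ - X]mul1r -mulNr -(bintZ _ Iu).
  rewrite -(bintD Iw (bintegrableZ _ Iu)); apply: eq_bint => x.
  by rewrite mulrBl mulN1r.
exact: variational_arith.
Qed.

End ContinuousOptimality.

(** * The discrete variational inequality and duality *)

Lemma lin_affine (R : realType) (V : lmodType R) (f : V -> R) t x y : lin f ->
  f (x + t *: (y - x)) = f x + t * (f y - f x).
Proof. by move=> lf; rewrite lf (linB y x lf). Qed.

Lemma affine_equation_arith (R : realFieldType) (t a b au bu aw bw mu mw : R) :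
  a = au + t * (aw - au) -> b = bu + t * (bw - bu) ->
  au + bu = mu -> aw + bw = mw -> a + b = mu + t * (mw - mu).
Proof. by move=> -> -> <- <-; ring. Qed.

Lemma affine_equation_source_arith (R : realFieldType) (t a b au bu aw bw mu mw F : R) :
  a = au + t * (aw - au) -> b = bu + t * (bw - bu) ->
  - au + bu = mu + F -> - aw + bw = mw + F -> - a + b = mu + t * (mw - mu) + F.
Proof.
move=> -> -> Hu Hw; transitivity ((mu + F) + t * ((mw + F) - (mu + F))).
  by rewrite -Hu -Hw; ring.
ring.
Qed.

Lemma duality_arith (R : realFieldType)
    (au aw bu bw m1u m1w cu cw du dw m2u m2w F : R) :
  au + bu = m1u -> aw + bw = m1w -> - cu + du = m2u + F -> - cw + dw = m2w + F ->
  (au - aw) - (cu - cw) = 0 ->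
  (bu - bw) + (du - dw) = (m1u - m1w) + (m2u - m2w).
Proof. by move=> *; lra. Qed.

Section DiscreteOptimality.
Context {R : realType} {n : nat}.
Local Notation pt := (R * R)%type.
Local Notation leb2 := (@lebesgue2 R).
Variables (P : 'I_n -> pt) (T : mesh R).
Hypotheses (cP : convex_polygon P) (cT : conforming_triangulation P T).
Variables (eps omega ua ub : R) (beta : pt -> pt) (alpha f yd : pt -> R).
Variables (C12 D11 : edge T -> pt -> pt) (v0 : pt).
Hypothesis omega0 : 0 < omega.
Hypothesis cbeta : {within pclosed P, continuous beta}.
Hypotheses (b1 : Linf P (fun x => (beta x).1)) (b2 : Linf P (fun x => (beta x).2)).
Hypotheses (alphab : Linf P alpha) (Lf : L2 P f) (Lyd : L2 P yd).
Hypotheses (hC : C12_spec C12 v0) (hD : D11_spec beta D11).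
Hypothesis wp : discrete_well_posed P eps beta alpha C12 D11.
Local Notation dse := (discrete_state_eq P eps beta alpha C12 D11 f).

Definition solution (u : pt -> R) : Vh T * Wh T := xget (0 : Vh T * Wh T) (dse u).

Lemma solutionP u : L2b P u -> dse u (solution u).
Proof.
move=> Lu; have [s [ss _]] := wp Lu Lf.
by apply: (@xgetPex _ (0 : Vh T * Wh T) (dse u)); exists s.
Qed.

Lemma solution_unique u s : L2b P u -> dse u s -> s = solution u.
Proof.
move=> Lu ss; have [s0 [_ uniq]] := wp Lu Lf.
by rewrite -(uniq _ ss) (uniq _ (solutionP Lu)).
Qed.

Let la r := lin_a_h (P := P) cT r.
Let lbl r := lin_b_h_left cP cT eps hC r.
Let lbr y := lin_b_h_right cP cT eps hC y.
Let lc v := lin_c_h cP cT eps cbeta b1 b2 alphab hD v.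

Lemma bint_affine (k u w : pt -> R) (t : R) : btame P k -> L2b P u -> L2b P w ->
  bint P setT (fun x => k x * (u x + t * (w x - u x))) =
  bint P setT (fun x => k x * u x) +
  t * (bint P setT (fun x => k x * w x) - bint P setT (fun x => k x * u x)).
Proof.
move=> /btame_L2b Lk Lu Lw.
have Iu := L2b_integrable Lk Lu; have Iw := L2b_integrable Lk Lw.
have Imu := bintegrableZ (-1) Iu; have Iwu := bintegrableD Iw Imu.
have -> : (fun x => k x * (u x + t * (w x - u x))) =
    (fun x => (k x * u x) + t * (k x * w x + -1 * (k x * u x))).
  by apply/funext => x; ring.
by rewrite (bintD Iu (bintegrableZ t Iwu)) (bintZ _ Iwu) (bintD Iw Imu) (bintZ _ Iu) mulN1r.
Qed.

Lemma bint_diff (k u w : pt -> R) : btame P k -> L2b P u -> L2b P w ->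
  bint P setT (fun x => k x * (u x - w x)) =
  bint P setT (fun x => k x * u x) - bint P setT (fun x => k x * w x).
Proof.
move=> /btame_L2b Lk Lu Lw.
have Iu := L2b_integrable Lk Lu; have Iw := L2b_integrable Lk Lw.
rewrite -mulN1r -(bintZ _ Iw) -(bintD Iu (bintegrableZ _ Iw)).
by apply: eq_bint => x; ring.
Qed.

Lemma m_h1_affine (u w : pt -> R) (t : R) (r : Wh T) : L2b P u -> L2b P w ->
  m_h1 P eps (fun x => u x + t * (w x - u x)) r =
  m_h1 P eps u r + t * (m_h1 P eps w r - m_h1 P eps u r).
Proof.
move=> Lu Lw; have Lut : L2b P (fun x => u x + t * (w x - u x)).
  by apply: L2bD => //; apply: L2bZ; exact: L2bB.
rewrite (m_h1E eps r Lu) (m_h1E eps r Lw) (m_h1E eps r Lut).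
under [LHS]eq_bint => x do rewrite mulrA.
under [X in X + _]eq_bint => x do rewrite mulrA.
under [X in _ * (X - _)]eq_bint => x do rewrite mulrA.
under [X in _ * (_ - X)]eq_bint => x do rewrite mulrA.
apply: bint_affine => // i; apply: tameM; first exact: tame_cst.
exact: btame_wnormal.
Qed.

Lemma m_h2_affine (u w : pt -> R) (t : R) (v : Vh T) : L2b P u -> L2b P w ->
  m_h2 P eps beta (fun x => u x + t * (w x - u x)) v =
  m_h2 P eps beta u v + t * (m_h2 P eps beta w v - m_h2 P eps beta u v).
Proof.
move=> Lu Lw; have Lut : L2b P (fun x => u x + t * (w x - u x)).
  by apply: L2bD => //; apply: L2bZ; exact: L2bB.
rewrite (m_h2E eps cP cT cbeta v Lu) (m_h2E eps cP cT cbeta v Lw).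
rewrite (m_h2E eps cP cT cbeta v Lut).
apply: bint_affine => // i; apply: tameM; last exact: tame_vtrace.
exact: btame_kappa_z.
Qed.

(** The system is linear in the pair and its data, so the affine combination of two
    solutions solves the system for the affine combination of the controls. *)
Lemma solution_affine u w t : L2b P u -> L2b P w ->
  solution (fun x => u x + t * (w x - u x)) =
  solution u + t *: (solution w - solution u).
Proof.
move=> Lu Lw; have Lut : L2b P (fun x => u x + t * (w x - u x)).
  by apply: L2bD => //; apply: L2bZ; exact: L2bB.
apply/esym/solution_unique => //.
have [u1 u2] := solutionP Lu; have [w1 w2] := solutionP Lw.
move: (solution u) (solution w) u1 u2 w1 w2 => su sw u1 u2 w1 w2.
have -> : su + t *: (sw - su) =
  (su.1 + t *: (sw.1 - su.1), su.2 + t *: (sw.2 - su.2)) by [].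
split=> [r|v].
  rewrite (m_h1_affine t r Lu Lw).
  exact: affine_equation_arith (lin_affine t su.2 sw.2 (la r))
    (lin_affine t su.1 sw.1 (lbl r)) (u1 r) (w1 r).
rewrite (m_h2_affine t v Lu Lw).
exact: affine_equation_source_arith (lin_affine t su.2 sw.2 (lbr v))
  (lin_affine t su.1 sw.1 (lc v)) (u2 v) (w2 v).
Qed.

Local Notation yh := (discrete_state P eps beta alpha f C12 D11).

Lemma discrete_state_L2 u : L2 P (yh u).
Proof. exact: L2_vfun. Qed.

Lemma discrete_state_affine u w t : L2b P u -> L2b P w -> forall x,
  yh (fun x => u x + t * (w x - u x)) x = yh u x + t * (yh w x - yh u x).
Proof.
move=> Lu Lw x; rewrite /discrete_state -!/(solution _) solution_affine//.
rewrite (lin_vfun x t (solution u).1 (solution w - solution u).1).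
by rewrite (linB (solution w).1 (solution u).1 (lin_vfun x)).
Qed.

Lemma discrete_variational_inequality u w :
  minimizer P ua ub
    (discrete_reduced_cost P eps omega beta alpha f yd C12 D11) u ->
  admissible P ua ub w ->
  0 <= ip P (fun x => yh u x - yd x) (fun x => yh w x - yh u x)
       + omega * bint P setT (fun x => u x * (w x - u x)).
Proof.
move=> umin aw; have [Lu _] := umin.1; have [Lw _] := aw.
apply: (minimizer_first_order omega0 Lyd (Y := yh) _ umin aw).
  by move=> v _; exact: discrete_state_L2.
by move=> t _; apply: aeW => x _; exact: discrete_state_affine.
Qed.

(** Testing the discrete adjoint system with the difference of two discrete states,
    and their equations with the adjoint pair, leaves only boundary terms. *)
Lemma discrete_duality u w (g : pt -> R) (p : Wh T) (z : Vh T) :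
  L2b P u -> L2b P w ->
  discrete_adjoint_eq P eps beta alpha C12 D11 g p z ->
  ip P g (fun x => yh u x - yh w x) =
  bint P setT (fun x => - Num.sqrt eps * (wnormal P p x * (u x - w x))) +
  bint P setT (fun x => kappa_z P eps beta T x * vtrace P z x * (u x - w x)).
Proof.
move=> Lu Lw [a1 a2]; have Le := L2bB Lu Lw.
have [u1 u2] := solutionP Lu; have [w1 w2] := solutionP Lw.
have -> : (fun x => yh u x - yh w x) = vfun (solution u - solution w).1.
  by apply/funext => x; rewrite (linB (solution u).1 (solution w).1 (lin_vfun x)).
rewrite -a2.
have kp : btame P (fun x => - Num.sqrt eps * wnormal P p x).
  by move=> i; apply: tameM; [exact: tame_cst|exact: btame_wnormal].
have kz : btame P (fun x => kappa_z P eps beta T x * vtrace P z x).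
  by move=> i; apply: tameM; [exact: btame_kappa_z|exact: tame_vtrace].
have -> : bint P setT (fun x => - Num.sqrt eps * (wnormal P p x * (u x - w x))) =
    m_h1 P eps u p - m_h1 P eps w p.
  rewrite (m_h1E eps p Lu) (m_h1E eps p Lw).
  under [LHS]eq_bint => x do rewrite mulrA.
  under [X in X - _]eq_bint => x do rewrite mulrA.
  under [X in _ - X]eq_bint => x do rewrite mulrA.
  exact: bint_diff.
rewrite (bint_diff kz Lu Lw) -(m_h2E eps cP cT cbeta z Lu) -(m_h2E eps cP cT cbeta z Lw).
have E1 := linB (solution u).2 (solution w).2 (la p).
have E2 := linB (solution u).1 (solution w).1 (lbl p).
have E3 := linB (solution u).2 (solution w).2 (lbr z).
have E4 := linB (solution u).1 (solution w).1 (lc z).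
have := a1 (solution u - solution w).2; rewrite a_hC E1 E3 E2 E4.
exact: duality_arith (u1 p) (w1 p) (u2 z) (w2 z).
Qed.

End DiscreteOptimality.

(** * The error estimate *)

(** Here [E] is the squared control error, [a = y - y_h u_h] and [b = y - y_h u] are the
    state errors, and [X] pairs the control error with the adjoint errors [A] and
    [B].  The primed variables are the same quantities written as squared norms. *)
Lemma control_error_estimate (R : realFieldType)
    (omega E E' aa aa' ab bb bb' X AA AA' BB BB' : R) :
  0 < omega -> E' = E -> aa' = aa -> bb' = bb -> AA = AA' -> BB' = BB ->
  0 <= X - omega * E - aa + ab ->
  2 * ab <= aa + bb ->
  X <= omega / 2 * E + omega^-1 * (AA + BB) ->
  omega * E' + aa' <= bb' + 2 / omega * (AA' + BB').
Proof. by move=> w0 -> -> -> <- -> h1 h2 h3; lra. Qed.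

Lemma optimality_sum_arith (R : realFieldType)
    (omega eps ed p k uu hh E aa ab : R) :
  uu + hh = - E ->
  0 <= - eps * - ed + omega * uu ->
  0 <= (p + k) - aa + ab + omega * hh ->
  0 <= (eps * ed + (p + k)) - omega * E - aa + ab.
Proof.
move=> H h1 h2; have -> : E = - (uu + hh) by rewrite H opprK.
lra.
Qed.

Lemma young_two_terms (R : realFieldType) (omega A B e : R) : 0 < omega ->
  (A + B) * e <= omega / 2 * e ^+ 2 + omega^-1 * (A ^+ 2 + B ^+ 2).
Proof.
move=> w0; rewrite -subr_ge0.
have -> : omega / 2 * e ^+ 2 + omega^-1 * (A ^+ 2 + B ^+ 2) - (A + B) * e =
  (2 * omega)^-1 * ((omega * e - (A + B)) ^+ 2 + (A - B) ^+ 2).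
  by field; rewrite gt_eqF.
by rewrite mulr_ge0 ?invr_ge0 ?mulr_ge0 ?(ltW w0)// addr_ge0 ?sqr_ge0.
Qed.

Section Assembly.
Context {R : realType} {n : nat}.
Local Notation pt := (R * R)%type.
Variables (P : 'I_n -> pt).

Lemma boundary_young (omega : R) (A B e : pt -> R) : 0 < omega ->
  L2b P A -> L2b P B -> L2b P e ->
  bint P setT (fun x => (A x + B x) * e x) <=
  omega / 2 * bint P setT (fun x => e x ^+ 2)
  + omega^-1 * (bint P setT (fun x => A x ^+ 2) + bint P setT (fun x => B x ^+ 2)).
Proof.
move=> w0 LA LB Le.
have sq g : L2b P g -> bintegrable P (fun x => g x ^+ 2).
  by move=> Lg; exact: (L2b_integrable Lg Lg).
have IAB := bintegrableD (sq _ LA) (sq _ LB).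
rewrite -(bintD (sq _ LA) (sq _ LB)) -(bintZ _ IAB) -(bintZ _ (sq _ Le)).
rewrite -(bintD (bintegrableZ _ (sq _ Le)) (bintegrableZ _ IAB)).
apply: le_bint.
- exact: (L2b_integrable (L2bD LA LB) Le).
- exact: bintegrableD (bintegrableZ _ (sq _ Le)) (bintegrableZ _ IAB).
- by move=> x; exact: young_two_terms.
Qed.

(** With [a = y - yh] and [b = y - yu], the second factor is [a - b] and the first is
    [(y - yd) - a]. *)
Lemma state_error_terms (yd y yu yh : pt -> R) : L2 P yd -> L2 P y -> L2 P yu -> L2 P yh ->
  ip P (fun x => yh x - yd x) (fun x => yu x - yh x) =
  ip P (fun x => y x - yd x) (fun x => yu x - yh x)
  - ip P (fun x => y x - yh x) (fun x => y x - yh x)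
  + ip P (fun x => y x - yh x) (fun x => y x - yu x).
Proof.
move=> Lyd Ly Lyu Lyh.
have La := L2B Ly Lyh; have Lb := L2B Ly Lyu.
have Lg := L2B Ly Lyd; have Ld := L2B Lyu Lyh.
have -> : (fun x => yh x - yd x) = (fun x => (y x - yd x) - (y x - yh x)).
  by apply/funext => x; ring.
rewrite (ipBl Lg La Ld) -addrA; congr (_ + _).
rewrite -[LHS]mulN1r -(ipZr _ Ld La) addrC -(ipBr Lb La La).
by apply: eq_Rintegral => x _; ring.
Qed.

Lemma ip_cross_le (a b : pt -> R) : L2 P a -> L2 P b ->
  2 * ip P a b <= ip P a a + ip P b b.
Proof.
move=> La Lb; have := ip_ge0 P (fun x => a x + -1 * b x).
rewrite (ip_quad (-1) La Lb); move: (ip P a a) (ip P a b) (ip P b b); clear.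
by move=> aa ab bb H; lra.
Qed.

Lemma control_terms (u w : pt -> R) : L2b P u -> L2b P w ->
  bint P setT (fun x => u x * (w x - u x)) +
  bint P setT (fun x => w x * (u x - w x)) =
  - bint P setT (fun x => (u x - w x) ^+ 2).
Proof.
move=> Lu Lw; have Le := L2bB Lu Lw; have Le' := L2bB Lw Lu.
rewrite -(bintD (L2b_integrable Lu Le') (L2b_integrable Lw Le)).
rewrite -mulN1r -(bintZ _ (L2b_integrable Le Le)).
by apply: eq_bint => x; ring.
Qed.

Lemma bint_opp_diff (u w k : pt -> R) : L2b P u -> L2b P w -> L2b P k ->
  bint P setT (fun x => (w x - u x) * k x) =
  - bint P setT (fun x => (u x - w x) * k x).
Proof.
move=> Lu Lw Lk; rewrite -mulN1r -(bintZ _ (L2b_integrable (L2bB Lu Lw) Lk)).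
by apply: eq_bint => x; ring.
Qed.

(** The boundary values of [z] vanish, so they may be subtracted from those of the
    discrete potential. *)
Lemma boundary_error_terms (eps : R) (e dn wn kappa vt tr : pt -> R) : 0 < eps ->
  L2b P e -> L2b P dn -> L2b P tr -> btame P wn -> btame P kappa -> btame P vt ->
  bae P (fun x => tr x = 0) ->
  bint P setT (fun x => (Num.sqrt eps * (Num.sqrt eps * dn x - wn x)
                         + kappa x * (vt x - tr x)) * e x) =
  eps * bint P setT (fun x => e x * dn x)
  + (bint P setT (fun x => - Num.sqrt eps * (wn x * e x))
     + bint P setT (fun x => kappa x * vt x * e x)).
Proof.
move=> eps0 Le Ldn Ltr twn tk tvt tr0.
have Lwn := btame_L2b twn; have Lvt := btame_L2b tvt.
have LA : L2b P (fun x => Num.sqrt eps * (Num.sqrt eps * dn x - wn x)).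
  by apply: L2bZ; apply: L2bB => //; exact: L2bZ.
have LB : L2b P (fun x => kappa x * (vt x - tr x)).
  by apply: btameL2b => //; exact: L2bB.
have I1 := L2b_integrable Le Ldn.
have I2 := L2b_integrable Lwn Le.
have I3 := L2b_integrable (btameL2b tk Lvt) Le.
rewrite -(bintZ _ I1).
rewrite -(bintD (bintegrableZ _ I2) I3).
rewrite -(bintD (bintegrableZ _ I1) (bintegrableD (bintegrableZ _ I2) I3)).
apply: eq_bint_ae.
- exact: (L2b_integrable (L2bD LA LB) Le).
- exact: bintegrableD (bintegrableZ _ I1) (bintegrableD (bintegrableZ _ I2) I3).
move=> i; apply: aeS (tr0 i) => t H t01; rewrite (H t01).
have := sqr_sqrtr (ltW eps0); rewrite expr2 => E.
by rewrite -[X in _ = X * _ + _]E; ring.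
Qed.

End Assembly.

Theorem theorem4p1 (R : realType) (omega : R) (omega_gt0 : 0 < omega) :
  exists2 C : R, 0 < C &
  forall (n : nat) (P : 'I_n -> R * R) (eps : R) (beta : R * R -> R * R)
    (alpha f yd : R * R -> R) (ua ub : R),
  convex_polygon P ->
  0 < eps ->
  W1inf P (fun x => (beta x).1) -> W1inf P (fun x => (beta x).2) ->
  {within pclosed P, continuous beta} ->
  is_wdiv P beta (fun=> 0) ->
  Linf P alpha -> dae P (fun x => 0 <= alpha x) ->
  L2 P f -> L2 P yd ->
  ua <= ub ->
  state_well_posed P eps beta alpha f ->
  forall (I : Type) (T : I -> mesh R) (v : R * R)
    (C12 D11 : forall h, edge (T h) -> R * R -> R * R),
  (forall h, conforming_triangulation P (T h)) ->
  shape_regular T ->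
  v != 0 ->
  (forall h, C12_spec (C12 h) v) ->
  (forall h, D11_spec beta (D11 h)) ->
  (forall h,
     discrete_well_posed P eps beta alpha (C12 h) (D11 h)) ->
  forall (u z : R * R -> R),
  minimizer P ua ub (reduced_cost P eps omega beta alpha f yd) u ->
  let y := state P eps beta alpha f u in
  adjoint_solution P eps beta alpha (fun x => y x - yd x) z ->
  forall (h : I) (u_h : R * R -> R) (p_h : Wh (T h)) (z_h : Vh (T h)),
  let y_h := discrete_state P eps beta alpha f (C12 h) (D11 h) in
  minimizer P ua ub
    (discrete_reduced_cost P eps omega beta alpha f yd (C12 h) (D11 h)) u_h ->
  discrete_adjoint_eq P eps beta alpha (C12 h) (D11 h)
    (fun x => y x - yd x) p_h z_h ->
  omega * normb P (fun x => u x - u_h x) ^+ 2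
  + norm P (fun x => y x - y_h u_h x) ^+ 2
  <= norm P (fun x => y x - y_h u x) ^+ 2
     + C * (eps * normb P (fun x => wnormal P p_h x - flux_normal P eps z x) ^+ 2
            + normb P (fun x => kappa_z P eps beta (T h) x
                                * (vtrace P z_h x - trace P z x)) ^+ 2).
Proof.
exists (2 / omega); first exact: divr_gt0.
move=> n P eps beta alpha f yd ua ub cP eps0 [b1 _] [b2 _] cbeta divb alphab _ Lf Lyd _ wp.
move=> I T v C12 D11 cT _ _ hC hD dwp u z umin y Hz h u_h p_h z_h y_h uhmin Hadj.
have Ofin := domain_finite_measure (cT h).
have [au _] := umin; have [auh _] := uhmin.
have [Lu _] := au; have [Luh _] := auh.
have VI1 := continuous_variational_inequality Ofin eps0 omega_gt0 b1 b2 divb alphab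
  Lyd wp umin auh Hz.
have VI2 := discrete_variational_inequality cP (cT h) omega_gt0 cbeta b1 b2 alphab Lf
  Lyd (hC h) (hD h) (dwp h) uhmin au.
have dual := discrete_duality cP (cT h) cbeta b1 b2 alphab Lf (hC h) (hD h) (dwp h)
  Lu Luh Hadj.
pose e x := u x - u_h x; have Le : L2b P e := L2bB Lu Luh.
have Ldn := dnormal_L2b P z.
have Ltr := trace_L2b P z.
have twn : btame P (wnormal P p_h) by exact: btame_wnormal.
have tk : btame P (kappa_z P eps beta (T h)) by exact: btame_kappa_z.
have tvt : btame P (vtrace P z_h) by move=> i; exact: tame_vtrace.
have [_ _ tr0 _] := Hz.
have Ly := state_L2 wp Lu.
have Lyu : L2 P (y_h u) by exact: (discrete_state_L2 (cT h)).
have Lyh : L2 P (y_h u_h) by exact: (discrete_state_L2 (cT h)).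
have XE := boundary_error_terms eps0 Le Ldn Ltr twn tk tvt tr0.
have LA : L2b P (fun x => Num.sqrt eps * (Num.sqrt eps * dnormal P z x - wnormal P p_h x)).
  by apply: L2bZ; apply: L2bB; [exact: L2bZ|exact: btame_L2b].
have LB : L2b P (fun x => kappa_z P eps beta (T h) x * (vtrace P z_h x - trace P z x)).
  by apply: btameL2b => //; apply: L2bB => //; exact: btame_L2b.
have AE : bint P setT (fun x =>
      (Num.sqrt eps * (Num.sqrt eps * dnormal P z x - wnormal P p_h x)) ^+ 2)
    = eps * normb P (fun x => wnormal P p_h x - flux_normal P eps z x) ^+ 2.
  have Lf2 : L2b P (fun x => wnormal P p_h x - flux_normal P eps z x).
    by apply: L2bB; [exact: btame_L2b|exact: L2bZ].
  rewrite normb_sq -(bintZ _ (L2b_integrable Lf2 Lf2)); apply: eq_bint => x.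
  rewrite exprMn sqr_sqrtr ?(ltW eps0)// -(sqrrN (Num.sqrt eps * _ - _)) opprB.
  by rewrite /flux_normal expr2.
apply: (control_error_estimate omega_gt0 (normb_sq P e)
  (norm_sq P (fun x => y x - y_h u_h x)) (norm_sq P (fun x => y x - y_h u x)) AE
  (normb_sq P _) _ (ip_cross_le (L2B Ly Lyh) (L2B Ly Lyu))
  (boundary_young omega_gt0 LA LB Le)).
rewrite XE.
move: VI2; rewrite (state_error_terms Lyd Ly Lyu Lyh) dual.
move: VI1; rewrite (bint_opp_diff Lu Luh Ldn).
exact: optimality_sum_arith (control_terms Lu Luh).
Qed.
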